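(* Let $A\in\mathbb{R}^{n\times d}$, $b\in\mathbb{R}^n$, let $g:\mathbb{R}^d\to\mathbb{R}$ be convex and twice differentiable with constant psd Hessian $H^g$, and let $h:\mathbb{R}^d\to\mathbb{R}\cup\{+\infty\}$ be a closed proper convex function. Consider the problem \[ \text{minimize}_{x\in\mathbb{R}^d}\ \tfrac12\|Ax-b\|_2^2+g(x)+h(x), \] and assume it has a solution. Fix initial iterates $\tilde x^0,\tilde z^0,\tilde u^0\in\mathbb{R}^d$, a stepsize $\rho>0$, a summable sequence of tolerances $\{\varepsilon^k\}_{k\ge0}\subset(0,\infty)$, and $\delta\in(0,1)$. Let $H=A^{T}A+H^{g}$ and construct the randomized Nyström preconditioner $P$ of $H$ (with regularization $\rho$) from a $d\times s$ standard Gaussian test matrix with \[ s\geq 8\left(\sqrt{d_{\mathrm{eff}}(\rho)}+\sqrt{8\log(16/\delta)}\right)^{2}. \] Run NysADMM: for $k=0,1,2,\dots$, (i) let $r^k=\rho\tilde z^k-\rho\tilde u^k+A^{T}A\tilde x^k+H^{g}\tilde x^k-A^{T}(A\tilde x^k-b)-\nabla g(\tilde x^k)$, and let $\tilde x^{k+1}$ be the output of $T^k=4+\big\lceil 2\log\big(R/(\varepsilon^k\rho)\big)\big\rceil$ iterations of preconditioned conjugate gradients with preconditioner $P$ (started from $0$) on the system $(H+\rho I)x=r^k$; (ii) $\tilde z^{k+1}=\mathrm{argmin}_z\{h(z)+\frac{\rho}{2}\|\tilde x^{k+1}-z+\tilde u^k\|_2^2\}$; (iii) $\tilde u^{k+1}=\tilde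 u^k+\tilde x^{k+1}-\tilde z^{k+1}$. Assume $\|r^k\|_2\le R$ for all $k$, for some constant $R$. Then with probability at least $1-\delta$: 1. for all $k\ge0$, $\|\tilde x^{k+1}-x^{k+1}\|_2\le\varepsilon^k$, where $x^{k+1}$ is the exact solution of $(H+\rho I)x=r^k$; 2. as $k\to\infty$, $\tilde x^k$ converges to a solution of the primal problem above and $\rho\tilde u^k$ converges to a solution of its dual problem $\text{maximize}_{y}\ -\big(f^*(-y)+h^*(y)\big)$, where $f(x)=\tfrac12\|Ax-b\|_2^2+g(x)$ and $^*$ denotes the convex conjugate.
   Context: For symmetric psd $H$ and $\rho>0$, $d_{\mathrm{eff}}(\rho)=\mathrm{tr}\big(H(H+\rho I)^{-1}\big)$. Given $\Omega\in\mathbb{R}^{d\times s}$ with i.i.d. $N(0,1)$ entries, the Nyström approximation is $H\langle\Omega\rangle=(H\Omega)(\Omega^{T}H\Omega)^{\dagger}(H\Omega)^{T}=U\hat\Lambda U^{T}$ with $U\in\mathbb{R}^{d\times s}$ having orthonormal columns and $\hat\Lambda=\mathrm{diag}(\hat\lambda_1\ge\dots\ge\hat\lambda_s)$; the randomized Nyström preconditioner is $P=\frac{1}{\hat\lambda_s+\rho}U(\hat\Lambda+\rho I)U^{T}+(I-UU^{T})$. The preconditioner is built once and reused in every iteration. $\log$ is the natural logarithm. A sequence $\{\varepsilon^k\}$ of positive numbers is summable if $\sum_k\varepsilon^k<\infty$. *)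

(* Defs.v *)
From HB Require Import structures.
From mathcomp Require Import all_boot all_order all_algebra.
From mathcomp Require Import all_classical all_reals all_analysis.
Set Implicit Arguments.
Unset Strict Implicit.
Unset Printing Implicit Defensive.
Import Order.TTheory GRing.Theory Num.Theory.
Import numFieldNormedType.Exports.
Local Open Scope classical_set_scope.
Local Open Scope ring_scope.

Definition norm2 {R : realType} {d : nat} (v : 'cV[R]_d) : R :=
  Num.sqrt (\sum_(i < d) v i 0 ^+ 2).

Definition dotv {R : realType} {d : nat} (u v : 'cV[R]_d) : R :=
  (u^T *m v) 0 0.

Definition is_mp_pinv {R : realType} {m n : nat}
    (M : 'M[R]_(m, n)) (X : 'M[R]_(n, m)) : Prop :=
  [/\ M *m X *m M = M, X *m M *m X = X,
      (M *m X)^T = M *m X & (X *m M)^T = X *m M].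

Definition mp_pinv {R : realType} {m n : nat} (M : 'M[R]_(m, n)) : 'M[R]_(n, m) :=
  xget 0 [set X | is_mp_pinv M X].

Definition deff {R : realType} {d : nat} (H : 'M[R]_d) (rho : R) : R :=
  \tr (H *m invmx (H + rho%:M)).

Definition nystrom {R : realType} {d s : nat} (H : 'M[R]_d) (Om : 'M[R]_(d, s))
  : 'M[R]_d :=
  (H *m Om) *m mp_pinv (Om^T *m H *m Om) *m (H *m Om)^T.

Definition nystrom_eig {R : realType} {d s : nat} (H : 'M[R]_d)
    (Om : 'M[R]_(d, s)) (U : 'M[R]_(d, s)) (lam : 'rV[R]_s) : Prop :=
  [/\ U^T *m U = 1%:M,
      nystrom H Om = U *m diag_mx lam *m U^T
    & forall i j : 'I_s, (i <= j)%N -> lam 0 j <= lam 0 i].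

Definition lam_last {R : realType} {s : nat} (lam : 'rV[R]_s) : R :=
  nth 0 [seq lam 0 i | i <- enum 'I_s] s.-1.

Definition nys_precond {R : realType} {d s : nat} (rho : R)
    (U : 'M[R]_(d, s)) (lam : 'rV[R]_s) : 'M[R]_d :=
  (lam_last lam + rho)^-1 *: (U *m (diag_mx lam + rho%:M) *m U^T)
  + (1%:M - U *m U^T).

Definition pcg_step {R : realType} {d : nat} (M Pinv : 'M[R]_d)
    (st : 'cV[R]_d * 'cV[R]_d * 'cV[R]_d * 'cV[R]_d) :=
  let: (x, r, z, p) := st in
  let Mp := M *m p in
  let alpha := dotv r z / dotv p Mp in
  let x' := x + alpha *: p in
  let r' := r - alpha *: Mp in
  let z' := Pinv *m r' in
  let beta := dotv r' z' / dotv r z in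
  (x', r', z', z' + beta *: p).

Definition pcg {R : realType} {d : nat} (M P : 'M[R]_d) (c : 'cV[R]_d)
    (T : nat) : 'cV[R]_d :=
  (iter T (pcg_step M (invmx P)) (0, c, invmx P *m c, invmx P *m c)).1.1.1.

Definition pcg_iters {R : realType} (Rb eps rho : R) : nat :=
  Num.truncn ((4 + Num.ceil (2 * ln (Rb / (eps * rho))))%:~R : R).

Definition grad {R : realType} {d : nat} (g : 'cV[R]_d -> R) (x : 'cV[R]_d)
  : 'cV[R]_d :=
  \col_i ('d g x (delta_mx i 0 : 'cV[R]_d)).

Definition twice_diff_const_hessian {R : realType} {d : nat}
    (g : 'cV[R]_d -> R) (Hg : 'M[R]_d) : Prop :=
  forall x, [/\ differentiable g x, differentiable (grad g) x
             & forall v, 'd (grad g) x v = Hg *m v].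

Definition psd {R : realType} {d : nat} (M : 'M[R]_d) : Prop :=
  M^T = M /\ forall v : 'cV[R]_d, 0 <= dotv v (M *m v).

Definition econvex {R : realType} {d : nat} (h : 'cV[R]_d -> \bar R) : Prop :=
  forall (x y : 'cV[R]_d) (t : R), 0 <= t <= 1 ->
    (h (t *: x + (1 - t) *: y)%R <= t%:E * h x + (1 - t)%R%:E * h y)%E.

Definition proper_fun {R : realType} {d : nat} (h : 'cV[R]_d -> \bar R) : Prop :=
  (forall x, h x != -oo%E) /\ exists x, h x \is a fin_num.

(* closed = lower semicontinuous (closed epigraph) *)
Definition closed_proper_convex {R : realType} {d : nat}
    (h : 'cV[R]_d -> \bar R) : Prop :=
  [/\ lower_semicontinuous h, proper_fun h & econvex h].

Definition conjugate {R : realType} {d : nat} (phi : 'cV[R]_d -> \bar R)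
    (y : 'cV[R]_d) : \bar R :=
  ereal_sup [set ((dotv y x)%:E - phi x)%E | x in [set: 'cV[R]_d]].

Definition fsmooth {R : realType} {n d : nat} (A : 'M[R]_(n, d)) (b : 'cV[R]_n)
    (g : 'cV[R]_d -> R) (x : 'cV[R]_d) : R :=
  2^-1 * norm2 (A *m x - b) ^+ 2 + g x.

Definition primal_obj {R : realType} {n d : nat} (A : 'M[R]_(n, d))
    (b : 'cV[R]_n) (g : 'cV[R]_d -> R) (h : 'cV[R]_d -> \bar R)
    (x : 'cV[R]_d) : \bar R :=
  ((fsmooth A b g x)%:E + h x)%E.

Definition primal_solution {R : realType} {n d : nat} (A : 'M[R]_(n, d))
    (b : 'cV[R]_n) (g : 'cV[R]_d -> R) (h : 'cV[R]_d -> \bar R)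
    (x : 'cV[R]_d) : Prop :=
  forall x', (primal_obj A b g h x <= primal_obj A b g h x')%E.

Definition dual_obj {R : realType} {n d : nat} (A : 'M[R]_(n, d))
    (b : 'cV[R]_n) (g : 'cV[R]_d -> R) (h : 'cV[R]_d -> \bar R)
    (y : 'cV[R]_d) : \bar R :=
  (- (conjugate (fun x => (fsmooth A b g x)%:E) (- y) + conjugate h y))%E.

Definition dual_solution {R : realType} {n d : nat} (A : 'M[R]_(n, d))
    (b : 'cV[R]_n) (g : 'cV[R]_d -> R) (h : 'cV[R]_d -> \bar R)
    (y : 'cV[R]_d) : Prop :=
  forall y', (dual_obj A b g h y' <= dual_obj A b g h y)%E.

Definition admm_rhs {R : realType} {n d : nat} (A : 'M[R]_(n, d))
    (b : 'cV[R]_n) (g : 'cV[R]_d -> R) (Hg : 'M[R]_d) (rho : R)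
    (x z u : 'cV[R]_d) : 'cV[R]_d :=
  rho *: z - rho *: u + A^T *m A *m x + Hg *m x - A^T *m (A *m x - b)
  - grad g x.

Definition std_gaussian_matrix {R : realType} {dT : measure_display}
    {T : measurableType dT} (P : probability T R) {d s : nat}
    (Om : T -> 'M[R]_(d, s)) : Prop :=
  [/\ forall i j, measurable_fun [set: T] (fun w => Om w i j),
      forall i j (B : set R), measurable B ->
        P ((fun w => Om w i j) @^-1` B) = normal_prob 0 1 B
    & forall B : 'I_d -> 'I_s -> set R, (forall i j, measurable (B i j)) ->
        P (\big[setI/setT]_(k : 'I_d * 'I_s)
              ((fun w => Om w k.1 k.2) @^-1` B k.1 k.2))
        = (\prod_(k : 'I_d * 'I_s)
              P ((fun w => Om w k.1 k.2) @^-1` B k.1 k.2))%E].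

(* Main.v *)
Require Import Defs.
From HB Require Import structures.
From mathcomp Require Import all_boot all_order all_algebra.
From mathcomp Require Import all_classical all_reals all_analysis.
From mathcomp Require Import measurable_realfun ring lra.
Set Implicit Arguments.
Unset Strict Implicit.
Unset Printing Implicit Defensive.
Import Order.TTheory GRing.Theory Num.Theory.
Import numFieldNormedType.Exports.
Local Open Scope classical_set_scope.
Local Open Scope ring_scope.

(** Write [H (H + rho I)^-1 = F F^T], so that the columns of [F] have total mass
    [d_eff(rho)].  The Gaussian sketch is handled by a PAC-Bayes argument:
    normalised exponential moments of [Om^T S], averaged over random signed sums
    [S] of (scaled copies of) the columns of [F], and of [Om^T f] for the columns
    [f] themselves, have expectation one, so by Markov their sum is at most
    [2 / delta] with probability [1 - delta].  If [Om^T F v = 0], biasing the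
    signs towards [v] contradicts that bound unless [14 |F v|^2 <= 13 |v|^2].

    The Nystrom residual is the [H]-energy of a Galerkin error, which turns this
    into [H - H<Om> <= 13 rho I].  Since the last eigenvalue [l] of the sketch
    satisfies [s l / (l + rho) <= d_eff(rho)], hence [7 l <= rho], the
    preconditioned matrix has condition number at most [16], and the Chebyshev
    bound for conjugate gradients contracts by [3/5 <= e^(-1/2)] per step: the
    prescribed number of iterations reaches accuracy [eps k].

    In the variable [z + u], ADMM iterates the Douglas-Rachford relation, which is
    firmly nonexpansive.  With summable errors the distance to any fixed point
    converges and the steps vanish, so a limit along an ultrafilter is a fixed
    point, to which the whole sequence must converge.  Fixed points are KKT
    points, and these solve the primal and, by weak duality, the dual problem. *)

(** * Quadratic forms and effective dimension *)

Lemma ler_of_sqr (R : realDomainType) (a b : R) :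
  0 <= b -> a ^+ 2 <= a * b -> a <= b.
Proof.
move=> b0; have [a0|a0] := ltP 0 a; first by rewrite expr2 ler_pM2l.
by move=> _; exact: le_trans b0.
Qed.

Section dot_product.
Context (R : realType).
Implicit Types d : nat.

Lemma dotvE d (u v : 'cV[R]_d) : dotv u v = \sum_i u i 0 * v i 0.
Proof. by rewrite /dotv mxE; apply: eq_bigr => i _; rewrite mxE. Qed.

Lemma dotvC d (u v : 'cV[R]_d) : dotv u v = dotv v u.
Proof. by rewrite !dotvE; apply: eq_bigr => i _; rewrite mulrC. Qed.

Lemma dotvDr d (u v w : 'cV[R]_d) : dotv u (v + w) = dotv u v + dotv u w.
Proof. by rewrite /dotv mulmxDr mxE. Qed.

Lemma dotvDl d (u v w : 'cV[R]_d) : dotv (u + v) w = dotv u w + dotv v w.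
Proof. by rewrite ![dotv _ w]dotvC dotvDr. Qed.

Lemma dotvNr d (u v : 'cV[R]_d) : dotv u (- v) = - dotv u v.
Proof. by rewrite /dotv mulmxN mxE. Qed.

Lemma dotvNl d (u v : 'cV[R]_d) : dotv (- u) v = - dotv u v.
Proof. by rewrite dotvC dotvNr dotvC. Qed.

Lemma dotvBr d (u v w : 'cV[R]_d) : dotv u (v - w) = dotv u v - dotv u w.
Proof. by rewrite dotvDr dotvNr. Qed.

Lemma dotvBl d (u v w : 'cV[R]_d) : dotv (u - v) w = dotv u w - dotv v w.
Proof. by rewrite dotvDl dotvNl. Qed.

Lemma dotvZr d (a : R) (u v : 'cV[R]_d) : dotv u (a *: v) = a * dotv u v.
Proof. by rewrite /dotv -scalemxAr mxE. Qed.

Lemma dotvZl d (a : R) (u v : 'cV[R]_d) : dotv (a *: u) v = a * dotv u v.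
Proof. by rewrite dotvC dotvZr dotvC. Qed.

Lemma dotv0r d (u : 'cV[R]_d) : dotv u 0 = 0.
Proof. by rewrite /dotv mulmx0 mxE. Qed.

Lemma dotv0l d (u : 'cV[R]_d) : dotv 0 u = 0.
Proof. by rewrite dotvC dotv0r. Qed.

Lemma dotv_mulmx d e (M : 'M[R]_(d, e)) u v : dotv u (M *m v) = dotv (M^T *m u) v.
Proof. by rewrite /dotv trmx_mul trmxK mulmxA. Qed.

Lemma dotv_delta_mx d (u : 'cV[R]_d) i : dotv (delta_mx i 0) u = u i 0.
Proof.
rewrite dotvE (bigD1 i)//= mxE !eqxx mul1r big1 ?addr0// => j ji.
by rewrite mxE (negbTE ji) mul0r.
Qed.

Lemma dotv_delta_mxE d (M : 'M[R]_d) i :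
  dotv (delta_mx i 0) (M *m delta_mx i 0) = M i i.
Proof. by rewrite dotv_delta_mx -colE mxE. Qed.

Lemma dotv_col_mx m n (a c : 'cV[R]_m) (b e : 'cV[R]_n) :
  dotv (col_mx a b) (col_mx c e) = dotv a c + dotv b e.
Proof. by rewrite /dotv tr_col_mx mul_row_col mxE. Qed.

Lemma dotvv_ge0 d (u : 'cV[R]_d) : 0 <= dotv u u.
Proof. by rewrite dotvE sumr_ge0// => i _; rewrite -expr2 sqr_ge0. Qed.

Lemma dotvv_eq0 d (u : 'cV[R]_d) : dotv u u = 0 -> u = 0.
Proof.
rewrite dotvE => /eqP; rewrite psumr_eq0 => [/allP u0|i _]; last by rewrite -expr2 sqr_ge0.
apply/matrixP => i j; rewrite ord1 mxE.
have := u0 i; rewrite mem_index_enum => /(_ isT); rewrite implyTb.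
by rewrite mulf_eq0 orbb => /eqP.
Qed.

Lemma dotvvD d (u v : 'cV[R]_d) :
  dotv (u + v) (u + v) = dotv u u + 2 * dotv u v + dotv v v.
Proof. by rewrite dotvDl !dotvDr (dotvC v u); ring. Qed.

Lemma dotvvB d (u v : 'cV[R]_d) :
  dotv (u - v) (u - v) = dotv u u - 2 * dotv u v + dotv v v.
Proof. by rewrite dotvvD dotvNr dotvNl dotvNr; ring. Qed.

Lemma dotvvZ d (a : R) (u : 'cV[R]_d) : dotv (a *: u) (a *: u) = a ^+ 2 * dotv u u.
Proof. by rewrite dotvZl dotvZr mulrA expr2. Qed.

Lemma norm2_ge0 d (v : 'cV[R]_d) : 0 <= norm2 v.
Proof. exact: sqrtr_ge0. Qed.

Lemma norm2_sqr d (v : 'cV[R]_d) : norm2 v ^+ 2 = dotv v v.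
Proof.
rewrite sqr_sqrtr ?sumr_ge0// => [|i _]; last exact: sqr_ge0.
by rewrite dotvE; apply: eq_bigr => i _; rewrite expr2.
Qed.

Lemma norm2E d (v : 'cV[R]_d) : norm2 v = Num.sqrt (dotv v v).
Proof. by rewrite -norm2_sqr sqrtr_sqr ger0_norm// norm2_ge0. Qed.

Lemma norm2_le_sqr d (v : 'cV[R]_d) (a : R) :
  0 <= a -> (norm2 v <= a) = (dotv v v <= a ^+ 2).
Proof. by move=> a0; rewrite -norm2_sqr ler_pXn2r ?nnegrE ?norm2_ge0. Qed.

Lemma norm2N d (u : 'cV[R]_d) : norm2 (- u) = norm2 u.
Proof. by rewrite !norm2E dotvNl dotvNr opprK. Qed.

End dot_product.

Section energy.
Context (R : realType) (d : nat) (M : 'M[R]_d).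
Implicit Types x y z : 'cV[R]_d.

Definition energy x y : R := dotv x (M *m y).

Lemma energyDl x y z : energy (x + y) z = energy x z + energy y z.
Proof. exact: dotvDl. Qed.

Lemma energyBl x y z : energy (x - y) z = energy x z - energy y z.
Proof. exact: dotvBl. Qed.

Lemma energyZl a x y : energy (a *: x) y = a * energy x y.
Proof. exact: dotvZl. Qed.

Lemma energyDr x y z : energy x (y + z) = energy x y + energy x z.
Proof. by rewrite /energy mulmxDr dotvDr. Qed.

Lemma energyBr x y z : energy x (y - z) = energy x y - energy x z.
Proof. by rewrite /energy mulmxBr dotvBr. Qed.

Lemma energyZr a x y : energy x (a *: y) = a * energy x y.
Proof. by rewrite /energy -scalemxAr dotvZr. Qed.

Lemma energy0r x : energy x 0 = 0.
Proof. by rewrite /energy mulmx0 dotv0r. Qed.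

Hypothesis Mpsd : psd M.

Lemma energyC x y : energy x y = energy y x.
Proof. by rewrite /energy dotv_mulmx Mpsd.1 dotvC. Qed.

Lemma energy_ge0 x : 0 <= energy x x.
Proof. exact: Mpsd.2. Qed.

Lemma energy_CauchySchwarz x y : energy x y ^+ 2 <= energy x x * energy y y.
Proof.
pose p := Poly [:: energy y y; 2 * energy x y; energy x x].
have := @deg_le2_poly_ge0 R p (size_Poly _).
rewrite !coef_Poly /= => disc; suff /disc : forall t, 0 <= p.[t] by lra.
move=> t; have -> : p.[t] = energy (t *: x + y) (t *: x + y).
  rewrite horner_Poly /= !(energyDl, energyDr, energyZl, energyZr) (energyC y x); ring.
exact: energy_ge0.
Qed.

End energy.

Section dot_product_norm.
Context (R : realType) (d : nat).
Implicit Types u v : 'cV[R]_d.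

Lemma psd1 : psd (1%:M : 'M[R]_d).
Proof. by split=> [|v]; rewrite ?trmx1 ?mul1mx ?dotvv_ge0. Qed.

Lemma dotv_CauchySchwarz u v : dotv u v ^+ 2 <= dotv u u * dotv v v.
Proof. by have := energy_CauchySchwarz psd1 u v; rewrite /energy !mul1mx. Qed.

Lemma entry_sqr_le_dotv u i : u i 0 ^+ 2 <= dotv u u.
Proof.
rewrite -dotv_delta_mx; apply: le_trans (dotv_CauchySchwarz _ _) _.
by rewrite dotv_delta_mx mxE !eqxx mul1r.
Qed.

Lemma dotv_le_norm2 u v : dotv u v <= norm2 u * norm2 v.
Proof.
apply: le_trans (ler_norm _) _.
rewrite -(ler_pXn2r (n := 2))// ?nnegrE ?mulr_ge0 ?norm2_ge0//.
by rewrite real_normK ?num_real// exprMn !norm2_sqr dotv_CauchySchwarz.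
Qed.

Lemma norm2D u v : norm2 (u + v) <= norm2 u + norm2 v.
Proof.
rewrite norm2_le_sqr ?addr_ge0 ?norm2_ge0// dotvvD.
by have := dotv_le_norm2 u v; rewrite -!norm2_sqr; lra.
Qed.

End dot_product_norm.

Lemma mulmx_sum_col (R : realType) (d m : nat) (F : 'M[R]_(d, m)) (v : 'cV[R]_m) :
  F *m v = \sum_j v j 0 *: col j F.
Proof.
apply/matrixP => i j; rewrite ord1 mxE summxE; apply: eq_bigr => l _.
by rewrite !mxE mulrC.
Qed.

Lemma trmx_mulmx_entry (R : realType) (d m : nat) (F : 'M[R]_(d, m)) (u : 'cV[R]_d) j :
  (F^T *m u) j 0 = dotv (col j F) u.
Proof. by rewrite mxE dotvE; apply: eq_bigr => i _; rewrite !mxE. Qed.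

Lemma dotv_tr_contraction (R : realType) (d m : nat) (F : 'M[R]_(d, m)) :
  (forall u : 'cV[R]_d, dotv (F^T *m u) (F^T *m u) <= dotv u u) ->
  forall v, dotv (F *m v) (F *m v) <= dotv v v.
Proof.
move=> Fle v; apply: ler_of_sqr; first exact: dotvv_ge0.
rewrite [X in X ^+ 2]dotv_mulmx mulrC dotvC.
apply: le_trans (dotv_CauchySchwarz _ _) _.
by rewrite ler_wpM2l ?dotvv_ge0.
Qed.

Definition psd_le {R : realType} {d : nat} (A B : 'M[R]_d) : Prop := psd (B - A).

Section psd_order.
Context (R : realType).
Implicit Types d : nat.

Lemma psd_ge0 d (M : 'M[R]_d) (x : 'cV[R]_d) : psd M -> 0 <= dotv x (M *m x).
Proof. by case. Qed.

Lemma psd_tr d (M : 'M[R]_d) : psd M -> M^T = M.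
Proof. by case. Qed.

Lemma psdD d (M N : 'M[R]_d) : psd M -> psd N -> psd (M + N).
Proof.
move=> [Ms M0] [Ns N0]; split=> [|v]; first by rewrite linearD /= Ms Ns.
by rewrite mulmxDl dotvDr addr_ge0.
Qed.

Lemma psdZ d (a : R) (M : 'M[R]_d) : 0 <= a -> psd M -> psd (a *: M).
Proof.
move=> a0 [Ms M0]; split=> [|v]; first by rewrite linearZ /= Ms.
by rewrite -scalemxAl dotvZr mulr_ge0.
Qed.

Lemma psd_scalar d (a : R) : 0 <= a -> psd (a%:M : 'M[R]_d).
Proof. by move=> a0; rewrite -scalemx1; apply: psdZ => //; exact: psd1. Qed.

Lemma psd0 d : psd (0 : 'M[R]_d).
Proof. by split=> [|v]; rewrite ?trmx0// mul0mx dotv0r. Qed.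

Lemma psd_gram n d (A : 'M[R]_(n, d)) : psd (A^T *m A).
Proof.
split=> [|v]; first by rewrite trmx_mul trmxK.
by rewrite -mulmxA dotv_mulmx trmxK dotvv_ge0.
Qed.

Lemma psd_mulmx_eq0 d (M : 'M[R]_d) v :
  psd M -> dotv v (M *m v) <= 0 -> M *m v = 0.
Proof.
move=> Mpsd v0; apply: dotvv_eq0; apply/eqP.
rewrite -sqrf_eq0 eq_le sqr_ge0 andbT -[dotv _ _]/(energy M (M *m v) v).
apply: le_trans (energy_CauchySchwarz Mpsd _ _) _.
by rewrite mulr_ge0_le0// energy_ge0.
Qed.

Lemma psd_congr d e (M : 'M[R]_d) (A : 'M[R]_(d, e)) :
  psd M -> psd (A^T *m M *m A).
Proof.
move=> Mpsd; split=> [|v]; first by rewrite !trmx_mul trmxK psd_tr// mulmxA.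
by rewrite -!mulmxA dotv_mulmx trmxK psd_ge0.
Qed.

Lemma mxtrace_psd_ge0 d (M : 'M[R]_d) : psd M -> 0 <= \tr M.
Proof. by move=> Mpsd; apply: sumr_ge0 => i _; rewrite -dotv_delta_mxE psd_ge0. Qed.

Lemma mulmx_inj_unitmx d (M : 'M[R]_d) :
  (forall v : 'cV[R]_d, M *m v = 0 -> v = 0) -> M \in unitmx.
Proof.
move=> Minj; rewrite -unitmx_tr -row_free_unit -kermx_eq0.
apply/eqP/row_matrixP => i; rewrite row0; apply: trmx_inj.
rewrite trmx0; apply: Minj; apply: trmx_inj.
rewrite trmx_mul trmxK trmx0; apply/sub_kermxP; exact: row_sub.
Qed.

Lemma psd_le_dotv d (A B : 'M[R]_d) (x : 'cV[R]_d) :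
  psd_le A B -> dotv x (A *m x) <= dotv x (B *m x).
Proof. by move=> AB; rewrite -subr_ge0 -dotvBr -mulmxBl psd_ge0. Qed.

Lemma psd_leP d (A B : 'M[R]_d) : A^T = A -> B^T = B ->
  (forall x : 'cV[R]_d, dotv x (A *m x) <= dotv x (B *m x)) -> psd_le A B.
Proof.
move=> As Bs AB; split=> [|x]; first by rewrite linearB /= As Bs.
by rewrite mulmxBl dotvBr subr_ge0.
Qed.

Lemma psd_le_trans d (A B C : 'M[R]_d) : psd_le A B -> psd_le B C -> psd_le A C.
Proof. by move=> AB BC; rewrite /psd_le -(subrKA B); exact: psdD. Qed.

Lemma psd_le_psd d (A B : 'M[R]_d) : psd_le A B -> psd A -> psd B.
Proof. by move=> AB Apsd; rewrite -(subrK A B); exact: psdD. Qed.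

Lemma psd_le_unitmx d (A B : 'M[R]_d) :
  psd_le A B -> psd A -> A \in unitmx -> B \in unitmx.
Proof.
move=> AB Apsd Au; apply: mulmx_inj_unitmx => x Bx.
rewrite -[x](mulKmx Au) (psd_mulmx_eq0 Apsd) ?mulmx0//.
by apply: le_trans (psd_le_dotv x AB) _; rewrite Bx dotv0r.
Qed.

Lemma psd_unitmx_gt0 d (M : 'M[R]_d) (v : 'cV[R]_d) :
  psd M -> M \in unitmx -> v != 0 -> 0 < dotv v (M *m v).
Proof.
move=> Mpsd Mu v0; rewrite ltNge; apply: contra v0 => /(psd_mulmx_eq0 Mpsd) Mv.
by rewrite -[v](mulKmx Mu) Mv mulmx0.
Qed.

Lemma psd_invmx d (M : 'M[R]_d) : psd M -> M \in unitmx -> psd (invmx M).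
Proof.
move=> Mpsd Mu; split=> [|x]; first by rewrite trmx_inv psd_tr.
by rewrite -{1}[x](mulKVmx Mu) dotvC energy_ge0.
Qed.

(* Cauchy-Schwarz in the [A]-energy bounds [<z, x> = <z, A (A^-1 x)>] for
   [z = B^-1 x], and the [A]-energy of [z] is at most [<z, B z> = <z, x>]. *)
Lemma psd_le_invmx d (A B : 'M[R]_d) :
  psd A -> A \in unitmx -> psd_le A B -> psd_le (invmx B) (invmx A).
Proof.
move=> Apsd Au AB; have Bpsd := psd_le_psd AB Apsd; have Bu := psd_le_unitmx AB Apsd Au.
split=> [|x]; first by rewrite linearB /= !trmx_inv !psd_tr.
rewrite mulmxBl dotvBr subr_ge0.
set z := invmx B *m x; set y := invmx A *m x.
have [xB xA] : B *m z = x /\ A *m y = x by rewrite !mulKVmx.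
have yx : energy A y y = dotv x y by rewrite /energy xA dotvC.
have zx : energy A z y = dotv x z by rewrite /energy xA dotvC.
apply: ler_of_sqr; first by rewrite -yx energy_ge0.
rewrite -yx -{1}zx; apply: le_trans (energy_CauchySchwarz Apsd z y) _.
by rewrite ler_wpM2r ?energy_ge0// (le_trans (psd_le_dotv z AB))// xB dotvC.
Qed.

Lemma psd_add_scalar d (H : 'M[R]_d) (rho : R) :
  psd H -> 0 <= rho -> psd (H + rho%:M).
Proof. by move=> Hpsd rho0; apply: psdD => //; exact: psd_scalar. Qed.

Lemma scalar_mx_unitmx d (a : R) : a != 0 -> (a%:M : 'M[R]_d) \in unitmx.
Proof.
by move=> a0; rewrite -scalemx1 unitmxZ ?unitmx1 ?unitfE.
Qed.

Lemma scalar_le_add d (H : 'M[R]_d) (rho : R) : psd H -> psd_le rho%:M (H + rho%:M).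
Proof. by rewrite /psd_le addrK. Qed.

Lemma add_scalar_unitmx d (H : 'M[R]_d) (rho : R) :
  psd H -> 0 < rho -> H + rho%:M \in unitmx.
Proof.
move=> Hpsd rho0; apply: psd_le_unitmx (scalar_le_add rho Hpsd) _ _.
  exact/psd_scalar/ltW.
by rewrite scalar_mx_unitmx// gt_eqF.
Qed.

End psd_order.

Section pivot.
Context (R : realType) (d : nat) (a : R) (b : 'cV[R]_d) (C : 'M[R]_d).
Hypothesis Mpsd : psd (block_mx (a%:M : 'M[R]_1) b^T b C).

Let energy_block (s t : 'cV[R]_1) (x y : 'cV[R]_d) :
  energy (block_mx a%:M b^T b C) (col_mx s x) (col_mx t y) =
  a * dotv s t + dotv s (b^T *m y) + dotv (b^T *m x) t + dotv x (C *m y).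
Proof.
rewrite /energy mul_block_col dotv_col_mx mul_scalar_mx !dotvDr dotvZr.
by rewrite [dotv x (b *m t)]dotv_mulmx !addrA.
Qed.

Let dotv11 : dotv (1 : 'cV[R]_1) 1 = 1.
Proof. by rewrite dotvE big_ord1 !mxE mulr1. Qed.

Lemma pivot_ge0 : 0 <= a.
Proof.
have := energy_ge0 Mpsd (col_mx 1 0).
by rewrite energy_block !mulmx0 !(dotv0r, dotv0l) !addr0 dotv11 mulr1.
Qed.

Lemma pivot_CauchySchwarz x : dotv (b^T *m x) (b^T *m x) <= a * dotv x (C *m x).
Proof.
have := energy_CauchySchwarz Mpsd (col_mx 1 0) (col_mx 0 x).
rewrite !energy_block !mulmx0 !(dotv0r, dotv0l) !addr0 mulr0 !add0r dotv11 mulr1.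
by rewrite !dotvE !big_ord1 mxE mul1r expr2.
Qed.

Lemma pivot_eq0 : a = 0 -> b = 0.
Proof.
move=> a0; apply: trmx_inj; rewrite trmx0; apply/matrixP => i j.
have := pivot_CauchySchwarz (delta_mx j 0); rewrite a0 mul0r => bj_le0.
have bj0 : b^T *m (delta_mx j 0 : 'cV[R]_d) = 0.
  by apply: dotvv_eq0; apply/eqP; rewrite eq_le bj_le0 dotvv_ge0.
by have := congr1 (fun v : 'M[R]_(_, _) => v i 0) bj0; rewrite -colE !mxE.
Qed.

(* When the pivot [a] vanishes so does [b], and the division by [0] is harmless. *)
Lemma schur_complement_psd :
  psd (C - ((Num.sqrt a)^-1 *: b) *m ((Num.sqrt a)^-1 *: b)^T).
Proof.
split=> [|x].
  rewrite linearB /= trmx_mul trmxK.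
  by have := psd_tr Mpsd; rewrite tr_block_mx => /eq_block_mx[_ _ _ ->].
rewrite mulmxBl dotvBr subr_ge0 -mulmxA dotv_mulmx linearZ /= -scalemxAl dotvvZ.
have [a0|an0] := eqVneq a 0.
  have := energy_ge0 Mpsd (col_mx 0 x).
  rewrite energy_block !(dotv0r, dotv0l) mulr0 !add0r.
  by rewrite (pivot_eq0 a0) trmx0 mul0mx dotv0l mulr0.
rewrite exprVn sqr_sqrtr ?pivot_ge0// ler_pdivrMl ?pivot_CauchySchwarz//.
by rewrite lt_def an0 pivot_ge0.
Qed.

Lemma pivot_sqrt_scale : Num.sqrt a *: ((Num.sqrt a)^-1 *: b) = b.
Proof.
have [a0|an0] := eqVneq a 0; first by rewrite (pivot_eq0 a0) !scaler0.
by rewrite scalerA mulfV ?scale1r// sqrtr_eq0 -ltNge lt_def an0 pivot_ge0.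
Qed.

End pivot.

Lemma psd_cholesky (R : realType) (d : nat) (M : 'M[R]_d) :
  psd M -> exists F : 'M[R]_d, M = F *m F^T.
Proof.
elim: d M => [|d IH] M Mpsd; first by exists 0; apply/matrixP => -[].
move: M Mpsd; rewrite -(add1n d) => M Mpsd.
pose a := M 0 0; pose b := dlsubmx M; pose C := drsubmx M.
have ME : M = block_mx a%:M b^T b C.
  rewrite -[LHS]submxK; congr block_mx; last first.
    by rewrite -[in LHS](psd_tr Mpsd) -trmx_dlsub.
  by apply/matrixP => i j; rewrite !ord1 !mxE eqxx; congr (M _ _); exact: val_inj.
rewrite ME in Mpsd *; have [F FE] := IH _ (schur_complement_psd Mpsd).
exists (block_mx (Num.sqrt a)%:M 0 ((Num.sqrt a)^-1 *: b) F).
rewrite tr_block_mx mulmx_block tr_scalar_mx trmx0 !mul0mx !mulmx0 !addr0 -FE.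
rewrite -scalar_mxM -expr2 sqr_sqrtr ?(pivot_ge0 Mpsd)//.
rewrite mul_scalar_mx mul_mx_scalar subrKC -linearZ /=.
by rewrite (pivot_sqrt_scale Mpsd).
Qed.

Section effective_dimension.
Context (R : realType) (d : nat) (rho : R).
Hypothesis rho_gt0 : 0 < rho.
Implicit Types H K : 'M[R]_d.

Lemma deffE H : psd H -> deff H rho = d%:R - rho * \tr (invmx (H + rho%:M)).
Proof.
move=> Hpsd; have Hu := add_scalar_unitmx Hpsd rho_gt0.
rewrite /deff -[X in X *m _](addrK rho%:M) mulmxBl mulmxV// linearB /= mxtrace1.
by rewrite mul_scalar_mx linearZ.
Qed.

Lemma le_deff H K : psd H -> psd_le H K -> deff H rho <= deff K rho.
Proof.
move=> Hpsd HK; have Kpsd := psd_le_psd HK Hpsd.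
have Hu := add_scalar_unitmx Hpsd rho_gt0.
have Hrpsd := psd_add_scalar Hpsd (ltW rho_gt0).
rewrite !deffE// lerD2l lerN2 ler_pM2l// -subr_ge0 -linearB /=.
apply/mxtrace_psd_ge0/psd_le_invmx => //.
by rewrite /psd_le opprD addrACA subrr addr0.
Qed.

Lemma deff_ge0 H : psd H -> 0 <= deff H rho.
Proof.
move=> Hpsd; have := @le_deff 0 H (psd0 _ _); rewrite /psd_le subr0 => /(_ Hpsd).
by rewrite {1}/deff mul0mx mxtrace0.
Qed.

Lemma deff_projector s (U : 'M[R]_(d, s)) (l : R) : U^T *m U = 1%:M -> 0 <= l ->
  deff (l *: (U *m U^T)) rho = s%:R * (l / (l + rho)).
Proof.
move=> UU l0; have lrho : l + rho != 0 by rewrite gt_eqF// ltr_wpDl.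
have UUpsd : psd (U *m U^T) by rewrite -{1}(trmxK U); exact: psd_gram.
rewrite /deff; have Hu := add_scalar_unitmx (psdZ l0 UUpsd) rho_gt0.
have -> : l *: (U *m U^T) *m invmx (l *: (U *m U^T) + rho%:M) =
          (l / (l + rho)) *: (U *m U^T).
  apply: (canLR (mulmxK Hu)); rewrite mulmxDr mul_mx_scalar -scalemxAr -scalemxAl.
  rewrite !scalerA mulmxA -[U *m U^T *m U]mulmxA UU mulmx1 -scalerDl.
  by congr (_ *: _); field.
by rewrite linearZ /= mxtrace_mulC UU mxtrace1 mulrC.
Qed.

Lemma deff_factor H : psd H -> exists F : 'M[R]_d,
  [/\ H *m invmx (H + rho%:M) = F *m F^T,
      forall u, dotv (F^T *m u) (F^T *m u) <= dotv u u &
      \sum_j dotv (col j F) (col j F) = deff H rho].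
Proof.
move=> Hpsd; have Hu := add_scalar_unitmx Hpsd rho_gt0.
have Hrpsd := psd_add_scalar Hpsd (ltW rho_gt0).
pose D := H *m invmx (H + rho%:M).
have DE : D = 1%:M - rho *: invmx (H + rho%:M).
  by rewrite /D -[X in X *m _](addrK rho%:M) mulmxBl mulmxV// mul_scalar_mx.
have invrho : (rho%:M : 'M[R]_d) \in unitmx by rewrite scalar_mx_unitmx ?gt_eqF.
have Dpsd : psd D.
  have := psd_le_invmx (psd_scalar _ (ltW rho_gt0)) invrho (scalar_le_add rho Hpsd).
  move=> /(psdZ (ltW rho_gt0)); rewrite scalerBr invmx_scalar scale_scalar_mx.
  by rewrite mulfV ?gt_eqF// -DE.
have [F FE] := psd_cholesky Dpsd; exists F; split => // [u|].
  rewrite -dotv_mulmx mulmxA -FE -[X in _ <= dotv _ X]mul1mx.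
  apply: psd_le_dotv; rewrite /psd_le DE subKr.
  by apply: psdZ; [exact: ltW | exact: psd_invmx].
rewrite /deff -/D FE mxtrace_mulC; apply: eq_bigr => j _.
by rewrite dotvE mxE; apply: eq_bigr => i _; rewrite !mxE.
Qed.

End effective_dimension.

(** * Independent Gaussian entries *)

Lemma eq_measure_rectangles (R : realType) (d1 d2 : measure_display)
    (T1 : measurableType d1) (T2 : measurableType d2)
    (m1 m2 : {measure set (T1 * T2)%type -> \bar R}) :
  (m1 setT < +oo)%E ->
  (forall A B, measurable A -> measurable B -> m1 (A `*` B) = m2 (A `*` B)) ->
  forall C, measurable C -> m1 C = m2 C.
Proof.
move=> m1oo m12 C mC.
apply: (measure_unique [set A `*` B | A in measurable & B in measurable] (fun=> setT)) => //.
- exact: measurable_prod_measurableType.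
- move=> _ _ [A1 mA1 [B1 mB1 <-]] [A2 mA2 [B2 mB2 <-]].
  by rewrite -setXI; exists (A1 `&` A2); [exact: measurableI|];
    exists (B1 `&` B2); first exact: measurableI.
- by move=> _; exists setT => //; exists setT => //; rewrite setXTT.
- by rewrite bigcup_const.
- by move=> _ [A mA [B mB <-]]; exact: m12.
Qed.

Section independence.
Context (R : realType) (dT dV : measure_display).
Context (T : measurableType dT) (V : measurableType dV).
Context (P : probability T R) (nu : probability V R).

Section pair.
Context (dS : measure_display) (S : measurableType dS).
Context (Y : {mfun T >-> S}) (X : {mfun T >-> V}).

Definition pair_mfun : {mfun T >-> (S * V)%type} :=
  mfun_Sub (mem_set (measurable_fun_pair (measurable_funPT Y) (measurable_funPT X))).

Hypothesis indepYX : forall A B, measurable A -> measurable B ->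
  (P (Y @^-1` A `&` X @^-1` B) = P (Y @^-1` A) * nu B)%E.

Lemma ge0_integral_indep (f : S * V -> \bar R) :
  measurable_fun setT f -> (forall z, 0 <= f z)%E ->
  (\int[P]_w f (Y w, X w) = \int[P]_w \int[nu]_x f (Y w, x))%E.
Proof.
move=> mf f0; transitivity (\int[distribution P pair_mfun]_z f z)%E.
  by rewrite ge0_integral_pushforward// preimage_setT.
rewrite (eq_measure_integral (distribution P Y \x nu)%E); last first.
  move=> C mC _; apply/esym.
  exact: (@product_measure_unique _ _ _ _ R (distribution P Y) nu
            (distribution P pair_mfun)).
rewrite fubini_tonelli1// ge0_integral_pushforward ?preimage_setT//.
- exact: measurable_fun_fubini_tonelli_F.
- by move=> y _; exact: integral_ge0.
Qed.

End pair.

Context (K : eqType) (X : K -> {mfun T >-> V}).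

Definition indep_entries (dS : measure_display) (S : measurableType dS)
    (Y : T -> S) (l : seq K) : Prop :=
  forall A (B : K -> set V), measurable A -> (forall k, measurable (B k)) ->
  (P (Y @^-1` A `&` \big[setI/setT]_(k <- l) (X k @^-1` B k)) =
   P (Y @^-1` A) * \prod_(k <- l) nu (B k))%E.

Lemma indep_entries_comp dS dU (S : measurableType dS) (U : measurableType dU)
    (Y : T -> S) (l : seq K) (g : S -> U) :
  measurable_fun setT g -> indep_entries Y l -> indep_entries (g \o Y) l.
Proof.
move=> mg indep A B mA mB; rewrite comp_preimage; apply: indep => //.
by rewrite -[X in measurable X]setTI; exact: mg.
Qed.

Context (dS : measure_display) (S : measurableType dS) (Y : {mfun T >-> S}).
Context (k : K) (l : seq K).
Hypotheses (kl : k \notin l) (indep : indep_entries Y (k :: l)).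

Lemma indep_entries_head A B : measurable A -> measurable B ->
  (P (Y @^-1` A `&` X k @^-1` B) = P (Y @^-1` A) * nu B)%E.
Proof.
move=> mA mB; pose Bk k' := if k' == k then B else setT.
have Bk_l k' : k' \in l -> Bk k' = setT.
  by rewrite /Bk => k'l; rewrite ifN//; apply: contraNneq kl => <-.
have mBk k' : measurable (Bk k') by rewrite /Bk; case: ifP.
have := indep mA mBk; rewrite !big_cons {1 3}/Bk eqxx.
rewrite [X in (_ * (_ * X))%E]big1_seq => [|k' /Bk_l ->]; last exact: probability_setT.
rewrite [X in _ `&` (_ `&` X)]big1_seq => [|k' /Bk_l ->]; last exact: preimage_setT.
by rewrite setIT mule1.
Qed.

Lemma indep_entries_behead : indep_entries (pair_mfun Y (X k)) l.
Proof.
move=> C B mC mB; pose E := \big[setI/setT]_(k <- l) (X k @^-1` B k).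
have mE : measurable E.
  by apply: bigsetI_measurable => k' _; exact: measurable_funPTI.
have [c cE] : exists c : {nonneg R}, (c%:num%:E = \prod_(k <- l) nu (B k))%E.
  have c0 : (0 <= \prod_(k <- l) nu (B k))%E by exact: prode_ge0.
  have cfin : (\prod_(k <- l) nu (B k))%E \is a fin_num.
    by apply: prode_fin_num => k' _; apply: fin_num_measure; exact: mB.
  by exists (NngNum (fine_ge0 c0)); rewrite fineK.
pose YX := pair_mfun Y (X k).
rewrite -cE muleC -[LHS]/(pushforward (mrestr P mE) YX C).
rewrite -[RHS]/(mscale c (distribution P YX) C).
apply: (@eq_measure_rectangles R _ _ _ _ [the measure _ _ of pushforward (mrestr P mE) YX]) => //.
  by rewrite /= /pushforward/= /mrestr ltey_eq fin_num_measure// preimage_setT setTI.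
move=> A Bk mA mBk; rewrite /= /pushforward/= /mrestr /mscale/= cE.
rewrite -[_ @^-1` _]/(Y @^-1` A `&` X k @^-1` Bk).
rewrite -[distribution _ _ _]/(P (Y @^-1` A `&` X k @^-1` Bk)) [in RHS]indep_entries_head//.
pose B' k' := if k' == k then Bk else B k'.
have B'_l k' : k' \in l -> B' k' = B k'.
  by rewrite /B' => k'l; rewrite ifN//; apply: contraNneq kl => <-.
have mB' k' : measurable (B' k') by rewrite /B'; case: ifP.
have := indep mA mB'; rewrite !big_cons {1 3}/B' eqxx setIA.
rewrite (eq_big_seq (fun k => X k @^-1` B k)) => [->|k' /B'_l -> //].
rewrite (eq_big_seq (fun k => nu (B k))) => [|k' /B'_l -> //].
by rewrite muleA muleC.
Qed.

End independence.

Section normal_integrals.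
Context (R : realType).

Lemma ge0_integral_normal_prob (m sigma : R) (f : R -> \bar R) :
  (forall x, 0 <= f x)%E -> measurable_fun setT f ->
  (\int[normal_prob m sigma]_x f x =
   \int[lebesgue_measure]_x (f x * (normal_pdf m sigma x)%:E))%E.
Proof.
move=> f0 mf; have dom := normal_prob_dominates m sigma.
rewrite -(Radon_Nikodym_SigmaFinite.change_of_variables dom)//.
have mpdf := @measurable_normal_pdf R m sigma.
apply: ae_eq_integral => //.
- apply: emeasurable_funM => //.
  exact: measurable_int (Radon_Nikodym_SigmaFinite.f_integrable _).
- by apply: emeasurable_funM => //; exact/measurable_EFinP.
- apply: ae_eqe_mul2l => /=; apply: integral_ae_eq => //=.
  + exact: Radon_Nikodym_SigmaFinite.f_integrable.
  + exact/measurable_EFinP.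
  + by move=> E E01 mE; rewrite -Radon_Nikodym_SigmaFinite.f_integral.
Qed.

(* The expectation of [expR (- th (y + Z)^2 / 2)] for [Z] normal of variance [m]. *)
Definition smoothed_gauss (th m y : R) : R :=
  (Num.sqrt (1 + th * m))^-1 * expR (- (th / (1 + th * m) * y ^+ 2 / 2)).

Lemma smoothed_gauss_ge0 th m y : 0 <= smoothed_gauss th m y.
Proof. by rewrite mulr_ge0 ?expR_ge0 ?invr_ge0. Qed.

Lemma smoothed_gauss0 th y : smoothed_gauss th 0 y = expR (- (th * y ^+ 2 / 2)).
Proof. by rewrite /smoothed_gauss mulr0 addr0 sqrtr1 invr1 mul1r mulr1. Qed.

Lemma measurable_smoothed_gauss th m (d : measure_display) (T : measurableType d)
    (f : T -> R) :
  measurable_fun setT f -> measurable_fun setT (fun w => smoothed_gauss th m (f w)).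
Proof.
move=> mf; apply: measurable_funM => //; apply: measurableT_comp => //.
apply: measurableT_comp => //; apply: measurable_funM => //.
by apply: measurable_funM => //; exact: measurable_funX.
Qed.

Let measurable_expR_sqr (t a y : R) :
  measurable_fun setT (fun x : R => expR (- (t * (y + a * x) ^+ 2 / 2))).
Proof.
apply: measurableT_comp => //; apply: measurableT_comp => //.
apply: measurable_funM => //; apply: measurable_funM => //.
by apply: measurable_funX; apply: measurable_funD.
Qed.

(* Completing the square: [x] has density proportional to a normal density of
   variance [(1 + t a^2)^-1] after multiplication by the integrand. *)
Lemma integral_normal_expR_sqr (t a y : R) : 0 < 1 + t * a ^+ 2 ->
  (\int[normal_prob (0:R) (1:R)]_x (expR (- (t * (y + a * x) ^+ 2 / 2)))%:E =
   (smoothed_gauss t (a ^+ 2) y)%:E)%E.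
Proof.
rewrite /smoothed_gauss; set q := 1 + _ => q0.
have sq0 : 0 < Num.sqrt q by rewrite sqrtr_gt0.
have sq2 : Num.sqrt q ^+ 2 = q by rewrite sqr_sqrtr// ltW.
rewrite ge0_integral_normal_prob => [|x|]; last 2 first.
- by rewrite lee_fin expR_ge0.
- by apply/measurable_EFinP; exact: measurable_expR_sqr.
pose sigma := (Num.sqrt q)^-1; pose mean := - (t * a * y / q).
transitivity (\int[lebesgue_measure]_x
  ((sigma * expR (- (t / q * y ^+ 2 / 2)))%:E * (normal_pdf mean sigma x)%:E))%E.
  apply: eq_integral => x _; rewrite -!EFinM; congr EFin.
  have sigma0 : sigma != 0 by rewrite invr_neq0 ?gt_eqF.
  rewrite !normal_pdfE ?oner_eq0// /normal_peak /normal_fun expr1n mul1r.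
  rewrite exprVn sq2 -[q^-1 * pi *+ 2]mulrnAr sqrtrM ?invr_ge0 1?ltW// sqrtrV 1?ltW//.
  rewrite invfM invrK mulrCA [RHS]mulrACA -!expRD [sigma * (_ / _)]mulrA mulVf ?gt_eqF//.
  rewrite mul1r; congr (_ * expR _); rewrite /mean; move: (lt0r_neq0 q0); rewrite /q => qn0.
  by field.
rewrite ge0_integralZl//.
- by rewrite integral_normal_pdf mule1.
- by apply/measurable_EFinP; exact: measurable_normal_pdf.
- by move=> x _; rewrite lee_fin normal_pdf_ge0.
- by rewrite lee_fin mulr_ge0// ?expR_ge0// invr_ge0 ltW.
Qed.

Lemma integral_smoothed_gauss (th m a y : R) :
  0 < 1 + th * m -> 0 < 1 + th * (m + a ^+ 2) ->
  (\int[normal_prob (0:R) (1:R)]_x (smoothed_gauss th m (y + a * x))%:E =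
   (smoothed_gauss th (m + a ^+ 2) y)%:E)%E.
Proof.
move=> m0 ma0; pose t := th / (1 + th * m).
have taE : 1 + t * a ^+ 2 = (1 + th * (m + a ^+ 2)) / (1 + th * m).
  by rewrite /t; field; rewrite gt_eqF.
have ta0 : 0 < 1 + t * a ^+ 2 by rewrite taE divr_gt0.
under eq_integral do rewrite /smoothed_gauss -/t EFinM.
rewrite ge0_integralZl//; last by apply/measurable_EFinP; exact: measurable_expR_sqr.
rewrite integral_normal_expR_sqr// -EFinM; congr EFin.
rewrite /smoothed_gauss mulrA -invfM -sqrtrM 1?ltW//; congr (_^-1 * expR _).
  by rewrite taE mulrC divfK ?gt_eqF.
by rewrite taE /t; field; rewrite !gt_eqF.
Qed.

End normal_integrals.

(* The coefficient of the entry [k] of a [d x s] matrix [X] in the coordinate [t]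
   of [X^T f]. *)
Definition entry_weight {R : realType} {d s : nat} (f : 'cV[R]_d) (k : 'I_d * 'I_s)
  (t : 'I_s) : R := (k.2 == t)%:R * f k.1 0.

Definition entry_mass {R : realType} {d s : nat} (f : 'cV[R]_d)
  (l : seq ('I_d * 'I_s)) (t : 'I_s) : R := \sum_(k <- l) entry_weight f k t ^+ 2.

Section gaussian_entries.
Context (R : realType) (dT : measure_display) (T : measurableType dT).
Context (P : probability T R) (d s : nat) (f : 'cV[R]_d).
Context (X : 'I_d * 'I_s -> {mfun T >-> measurableTypeR R}).

Let nu := normal_prob (0 : R) (1 : R).

Let add_entry k (z : s.-tuple R * measurableTypeR R) : s.-tuple R :=
  [tuple tnth z.1 t + entry_weight f k t * z.2 | t < s].

Let measurable_add_entry k : measurable_fun setT (add_entry k).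
Proof.
apply/measurable_fun_tnthP => t; rewrite [X in measurable_fun _ X](_ : _ =
    fun z : s.-tuple R * measurableTypeR R => tnth z.1 t + entry_weight f k t * z.2); last first.
  by apply/funext => z /=; rewrite tnth_mktuple.
apply: measurable_funD; first exact: (measurableT_comp (measurable_tnth t)).
by apply: measurable_funM => //; exact: measurable_snd.
Qed.

Lemma integral_add_entry th (m : 'I_s -> R) (k : 'I_d * 'I_s) (y : s.-tuple R) :
  (forall t, 0 < 1 + th * m t) -> (forall t, 0 < 1 + th * (m t + entry_mass f [:: k] t)) ->
  (\int[nu]_x (\prod_t smoothed_gauss th (m t) (tnth (add_entry k (y, x)) t))%:E =
   (\prod_t smoothed_gauss th (m t + entry_mass f [:: k] t) (tnth y t))%:E)%E.
Proof.
move=> m0 mk0; pose j := k.2.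
have massE t : entry_mass f [:: k] t = ((j == t)%:R * f k.1 0) ^+ 2
  by rewrite /entry_mass big_seq1.
pose others := \prod_(t | t != j) smoothed_gauss th (m t) (tnth y t).
have others0 : 0 <= others by apply: prodr_ge0 => t _; exact: smoothed_gauss_ge0.
have -> : \prod_t smoothed_gauss th (m t + entry_mass f [:: k] t) (tnth y t) =
    others * smoothed_gauss th (m j + f k.1 0 ^+ 2) (tnth y j).
  rewrite (bigD1 j)//= massE eqxx mul1r mulrC; congr (_ * _).
  by apply: eq_bigr => t tj; rewrite massE eq_sym (negbTE tj) mul0r expr0n addr0.
under eq_integral => x _.
  rewrite (bigD1 j)//= tnth_mktuple /entry_weight /= eqxx mul1r mulrC.
  rewrite (eq_bigr (fun t => smoothed_gauss th (m t) (tnth y t))) => [|t tj]; last first.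
    by rewrite tnth_mktuple /entry_weight eq_sym (negbTE tj) !mul0r addr0.
  rewrite -/others EFinM; over.
rewrite ge0_integralZl//; last 2 first.
- apply/measurable_EFinP/measurable_smoothed_gauss.
  by apply: measurable_funD => //; exact: measurable_funM.
- by move=> x _; rewrite lee_fin smoothed_gauss_ge0.
rewrite integral_smoothed_gauss ?EFinM//.
by have := mk0 j; rewrite massE eqxx mul1r.
Qed.

Lemma expectation_gauss_entries th (l : seq ('I_d * 'I_s)) (Y : {mfun T >-> s.-tuple R}) :
  uniq l -> indep_entries P nu X Y l -> (forall t, 0 < 1 + th * entry_mass f l t) ->
  (\int[P]_w (\prod_(t < s) expR (- (th *
      (tnth (Y w) t + \sum_(k <- l) entry_weight f k t * X k w) ^+ 2 / 2)))%:E =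
   \int[P]_w (\prod_(t < s) smoothed_gauss th (entry_mass f l t) (tnth (Y w) t))%:E)%E.
Proof.
elim: l Y => [|k l IH] Y /= => [_ _ _|/andP[kl ul] indep mass_gt0].
  apply: eq_integral => w _; congr EFin; apply: eq_bigr => t _.
  by rewrite /entry_mass !big_nil addr0 smoothed_gauss0.
have mass_cons t : entry_mass f (k :: l) t = entry_mass f l t + entry_mass f [:: k] t.
  by rewrite /entry_mass big_cons big_seq1 addrC.
have mass_ge0 l' (t : 'I_s) : 0 <= entry_mass f l' t by apply: sumr_ge0 => *; exact: sqr_ge0.
have mass_l t : 0 < 1 + th * entry_mass f l t.
  have := mass_gt0 t; rewrite mass_cons; have := mass_ge0 l t; have := mass_ge0 [:: k] t.
  by move: (entry_mass f l t) (entry_mass _ _ t) => a b; have [th0|th0] := leP 0 th; nra.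
have mY' : measurable_fun setT (add_entry k \o pair_mfun Y (X k)).
  exact: measurableT_comp.
pose Y' : {mfun T >-> s.-tuple R} := mfun_Sub (mem_set mY').
have indepY' : indep_entries P nu X Y' l.
  exact: indep_entries_comp (indep_entries_behead kl indep).
have Y'E w t : tnth (Y' w) t = tnth (Y w) t + entry_weight f k t * X k w.
  by rewrite tnth_mktuple.
under eq_integral => w _.
  under eq_bigr do rewrite big_cons addrA -Y'E.
  over.
rewrite IH//.
rewrite (ge0_integral_indep (indep_entries_head kl indep)
  (f := fun z => (\prod_t smoothed_gauss th (entry_mass f l t) (tnth (add_entry k z) t))%:E)).
- apply: eq_integral => w _; rewrite integral_add_entry => [|//|t]; last first.
    by rewrite -mass_cons.
  by congr EFin; apply: eq_bigr => t _; rewrite mass_cons.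
- apply/measurable_EFinP; apply: measurable_prod => t _.
  apply: measurable_smoothed_gauss.
  exact: (measurableT_comp (measurable_tnth t)).
- by move=> z; rewrite lee_fin prodr_ge0// => t _; exact: smoothed_gauss_ge0.
Qed.

End gaussian_entries.

Definition sketch_tilt {R : realType} {d s : nat} (Om : 'M[R]_(d, s)) (th : R)
    (f : 'cV[R]_d) : R :=
  Num.sqrt (1 + th * dotv f f) ^+ s *
  expR (- (th * dotv (Om^T *m f) (Om^T *m f) / 2)).

Lemma sketch_tilt_ge0 (R : realType) (d s : nat) (Om : 'M[R]_(d, s)) th f :
  0 <= sketch_tilt Om th f.
Proof. by rewrite mulr_ge0 ?expR_ge0// exprn_ge0. Qed.

Section gaussian_matrix.
Context (R : realType) (dT : measure_display) (T : measurableType dT).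
Context (P : probability T R) (d s : nat) (Om : T -> 'M[R]_(d, s)).
Hypothesis Om_std : std_gaussian_matrix P Om.

Let mOm i j : measurable_fun setT (fun w => Om w i j : measurableTypeR R).
Proof. by have [mOm _ _] := Om_std; exact: mOm. Qed.

Let entry (k : 'I_d * 'I_s) : {mfun T >-> measurableTypeR R} :=
  mfun_Sub (mem_set (mOm k.1 k.2)).

Let entries := index_enum ('I_d * 'I_s)%type.

Let sum_entries t (F : 'I_d * 'I_s -> R) :
  \sum_(k <- entries) (k.2 == t)%:R * F k = \sum_i F (i, t).
Proof.
rewrite /entries (eq_bigr (fun k => (k.2 == t)%:R * F (k.1, k.2))) => [|[] //].
rewrite -(pair_bigA _ (fun i j => (j == t)%:R * F (i, j)))/=; apply: eq_bigr => i _.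
rewrite (bigD1 t)//= eqxx mul1r big1 ?addr0// => j /negbTE ->; exact: mul0r.
Qed.

Let measurable_expR_sketch th f : measurable_fun setT
  (fun w => expR (- (th * dotv ((Om w)^T *m f) ((Om w)^T *m f) / 2))).
Proof.
apply: measurableT_comp => //; apply: measurableT_comp => //; apply: measurable_funM => //.
apply: measurable_funM => //.
have sketchE w t : ((Om w)^T *m f) t 0 = \sum_i Om w i t * f i 0.
  by rewrite mxE; apply: eq_bigr => i _; rewrite mxE.
rewrite [X in measurable_fun _ X](_ : _ =
    fun w => \sum_t (\sum_i Om w i t * f i 0) * (\sum_i Om w i t * f i 0)).
  by apply: measurable_sum => t; apply: measurable_funM; apply: measurable_sum => i;
    apply: measurable_funM => //; exact: mOm.
by apply/funext => w; rewrite dotvE; apply: eq_bigr => t _; rewrite !sketchE.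
Qed.

Lemma measurable_sketch_tilt th f : measurable_fun setT (fun w => sketch_tilt (Om w) th f).
Proof. by apply: measurable_funM => //; exact: measurable_expR_sketch. Qed.

Let indep_all_entries (y : s.-tuple R) :
  indep_entries P (normal_prob 0 1) entry (cst y) entries.
Proof.
move=> A B mA mB; have [_ lawOm prodOm] := Om_std.
rewrite preimage_cst; case: ifP => _; last by rewrite set0I measure0 mul0e.
rewrite setTI probability_setT mul1e.
have := prodOm (fun i j => B (i, j)) (fun i j => mB (i, j)).
rewrite (eq_bigr (fun k => entry k @^-1` B k)) => [->|[i j] _ //].
by apply: eq_bigr => -[i j] _; exact: (lawOm i j _ (mB (i, j))).
Qed.

Lemma expectation_sketch_tilt th f : 0 < 1 + th * dotv f f ->
  (\int[P]_w (sketch_tilt (Om w) th f)%:E = 1)%E.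
Proof.
move=> th_gt0.
have sketchE w t : ((Om w)^T *m f) t 0 =
    \sum_(k <- entries) entry_weight f k t * entry k w.
  rewrite /entry_weight; under [RHS]eq_bigr do rewrite -mulrA.
  by rewrite sum_entries mxE; apply: eq_bigr => i _; rewrite mxE mulrC.
have massE t : entry_mass f entries t = dotv f f.
  rewrite /entry_mass /entry_weight; under eq_bigr do rewrite exprMn -natrX -mulnn mulnb andbb.
  by rewrite sum_entries dotvE; apply: eq_bigr => i _; rewrite expr2.
pose y0 : s.-tuple R := [tuple 0 | t < s].
have smoothed_y0 t : smoothed_gauss th (entry_mass f entries t) (tnth y0 t) =
    (Num.sqrt (1 + th * dotv f f))^-1.
  by rewrite massE /smoothed_gauss tnth_mktuple expr0n mulr0 mul0r oppr0 expR0 mulr1.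
have mass_gt0 t : 0 < 1 + th * entry_mass f entries t.
  by rewrite massE.
have := expectation_gauss_entries (index_enum_uniq _) (indep_all_entries y0) mass_gt0.
under [in X in _ = X]eq_integral do under eq_bigr do rewrite smoothed_y0.
rewrite integral_cst// [X in (_ * X)%E]probability_setT mule1 prodr_const card_ord => tiltE.
have expE w : expR (- (th * dotv ((Om w)^T *m f) ((Om w)^T *m f) / 2)) =
    \prod_t expR (- (th * (tnth y0 t + \sum_(k <- entries) entry_weight f k t * entry k w)
      ^+ 2 / 2)).
  rewrite dotvE mulr_sumr mulr_suml -sumrN expR_sum; apply: eq_bigr => t _.
  by rewrite tnth_mktuple add0r -sketchE expr2.
under eq_integral do rewrite EFinM.
rewrite ge0_integralZl//; last by apply/measurable_EFinP; exact: measurable_expR_sketch.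
under eq_integral do rewrite expE.
by rewrite tiltE -EFinM exprVn mulfV// expf_neq0// gt_eqF// sqrtr_gt0.
Qed.

End gaussian_matrix.

Lemma probability_le_markov (R : realType) (dT : measure_display) (T : measurableType dT)
    (P : probability T R) (X : {RV P >-> R}) (a delta : R) :
  (forall w, 0 <= X w) -> 0 < a -> 0 < delta -> ('E_P[X] <= a%:E)%E ->
  measurable [set w | X w <= a / delta] /\
  ((1 - delta)%:E <= P [set w | (X w <= a / delta)%R])%E.
Proof.
move=> X0 a0 delta0 EX; have ad0 : 0 < a / delta by rewrite divr_gt0.
have mE : measurable [set w | X w <= a / delta].
  by rewrite -[X in measurable X]setTI; exact: measurable_fun_le.
split=> //; rewrite -[X in P X]setCK probability_setC; last exact: measurableC.
rewrite EFinB; apply: leeB => //.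
apply: (@le_trans _ _ (P [set w | a / delta <= X w])).
  apply: le_measure; rewrite ?inE; first exact: measurableC.
    by rewrite -[X in measurable X]setTI; exact: measurable_fun_le.
  by move=> w /= /negP; rewrite -ltNge => /ltW.
have := @markov _ _ _ P X id (a / delta) ad0 (@measurable_id _ _ _) (fun _ => id)
  (fun _ _ _ _ => id).
have normX w : `|X w| = X w by rewrite ger0_norm.
rewrite [X in (_ <= X)%E](_ : _ = 'E_P[X])%E; last first.
  by congr expectation; apply/funext => w /=.
rewrite [[set _ | _]](_ : _ = [set w | a / delta <= X w]); last first.
  by apply/seteqP; split=> w /=; rewrite lee_fin normX.
move=> /le_trans/(_ EX); rewrite -lee_pdivlMl// -EFinM => /le_trans; apply.
by rewrite lee_fin invf_div divfK// gt_eqF.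
Qed.

(** * Biased random signs *)

Section biased_mean.
Context (R : realType) (V : zmodType).
Implicit Types (l : seq (R * V)) (g h : V -> R) (w : V).

(* The expectation of [g (w + sum_i e_i f_i)] for independent signs [e_i] of mean
   [v_i], where [l] lists the pairs [(v_i, f_i)]. *)
Fixpoint biased_mean l g w : R :=
  if l is x :: l' then
    (1 + x.1) / 2 * biased_mean l' g (w + x.2) + (1 - x.1) / 2 * biased_mean l' g (w - x.2)
  else g w.

Definition unbiased l : seq (R * V) := [seq (0, x.2) | x <- l].

Lemma eq_biased_mean l g h w : g =1 h -> biased_mean l g w = biased_mean l h w.
Proof. by move=> gh; elim: l w => //= x l IH w; rewrite !IH. Qed.

Lemma biased_meanD l g h w :
  biased_mean l (fun S => g S + h S) w = biased_mean l g w + biased_mean l h w.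
Proof. by elim: l w => //= x l IH w; rewrite !IH; ring. Qed.

Lemma biased_meanZ l a g w : biased_mean l (fun S => a * g S) w = a * biased_mean l g w.
Proof. by elim: l w => //= x l IH w; rewrite !IH; ring. Qed.

Lemma biased_mean_cst l a w : biased_mean l (fun=> a) w = a.
Proof. by elim: l w => //= x l IH w; rewrite !IH; field. Qed.

Lemma le_biased_mean l g h w : {in l, forall x, `|x.1| <= 1} -> (forall S, g S <= h S) ->
  biased_mean l g w <= biased_mean l h w.
Proof.
move=> + gh; elim: l w => //= x l IH w l1.
have := l1 x (mem_head _ _); rewrite ler_norml => /andP[? ?].
have {}IH w' := IH w' (sub_in1 (@mem_behead _ (x :: l)) l1).
by apply: lerD; rewrite ler_wpM2l//; lra.
Qed.

End biased_mean.

Lemma expR_jensen (R : realType) (I : Type) (r : seq I) (p z : I -> R) :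
  (forall i, 0 <= p i) -> \sum_(i <- r) p i = 1 ->
  expR (\sum_(i <- r) p i * z i) <= \sum_(i <- r) p i * expR (z i).
Proof.
move=> p0 p1; set m := \sum_(i <- r) _.
have -> : expR m = \sum_(i <- r) p i * (expR m * (1 + (z i - m))).
  rewrite (eq_bigr (fun i => expR m * (p i + p i * z i - m * p i))); last first.
    by move=> i _; ring.
  by rewrite -mulr_sumr big_split big_split /= sumrN -mulr_sumr p1 -/m; ring.
apply: ler_sum => i _; rewrite ler_wpM2l//.
by rewrite -[z i in leRHS](subrKC m) expRD ler_wpM2l ?expR_ge0// expR_ge1Dx.
Qed.

Lemma ln_ge1BV (R : realType) (x : R) : 0 < x -> 1 - x^-1 <= ln x.
Proof.
move=> x0; rewrite -[x in ln x]invrK lnV ?posrE ?invr_gt0// -opprB lerN2.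
by have := @le_ln1Dx R (x^-1 - 1); rewrite subrKC; apply; rewrite ltrBrDl addrN invr_gt0.
Qed.

Lemma ln_odds_bounds (R : realType) (v : R) : -1 < v < 1 ->
  2 * v / (1 + v) <= ln ((1 + v) / (1 - v)) <= 2 * v / (1 - v).
Proof.
move=> /andP[v_gt v_lt]; have [p0 m0] : 0 < 1 + v /\ 0 < 1 - v by split; lra.
have odds_gt0 : 0 < (1 + v) / (1 - v) by rewrite divr_gt0.
have oddsE : (1 + v) / (1 - v) = 1 + 2 * v / (1 - v) by field; rewrite gt_eqF.
apply/andP; split.
  apply: le_trans (ln_ge1BV odds_gt0); rewrite invf_div le_eqVlt; apply/orP; left.
  by apply/eqP; field; rewrite gt_eqF.
by rewrite oddsE le_ln1Dx// -(ltrD2l 1) -oddsE subrr.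
Qed.

Section sign_entropy.
Context (R : realType).
Implicit Types (v a b eta : R).

(* The relative entropy of a sign of mean [v] with respect to a uniform sign. *)
Definition sign_entropy v : R := (1 + v) / 2 * ln (1 + v) + (1 - v) / 2 * ln (1 - v).

Lemma sign_entropy_le v eta : `|v| <= eta -> eta < 1 ->
  sign_entropy v <= v ^+ 2 / 2 * ((1 + eta) / (1 - eta)).
Proof.
rewrite ler_norml => /andP[veta etav] eta1.
have [p0 m0] : 0 < 1 + v /\ 0 < 1 - v by split; lra.
have lnE : ln (1 - v ^+ 2) = ln (1 + v) + ln (1 - v).
  by rewrite -lnM ?posrE//; congr ln; ring.
have ln_prod : ln (1 - v ^+ 2) <= - v ^+ 2.
  by apply: le_ln1Dx; nra.
have ln_ratio : v * (ln (1 + v) - ln (1 - v)) <= 2 * v ^+ 2 / (1 - eta).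
  have := @ln_odds_bounds R v; rewrite -ln_div ?posrE// => /(_ _)/andP[|lower upper]; first lra.
  have [v0|v0] := leP 0 v.
    apply: (@le_trans _ _ (v * (2 * v / (1 - v)))); first by rewrite ler_wpM2l.
    rewrite (_ : v * _ = 2 * v ^+ 2 / (1 - v)); last by ring.
    apply: ler_wpM2l; first by rewrite mulr_ge0 ?sqr_ge0.
    by rewrite lef_pV2 ?posrE; lra.
  apply: (@le_trans _ _ (v * (2 * v / (1 + v)))); first by rewrite ler_wnM2l// ltW.
  rewrite (_ : v * _ = 2 * v ^+ 2 / (1 + v)); last by ring.
  apply: ler_wpM2l; first by rewrite mulr_ge0 ?sqr_ge0.
  by rewrite lef_pV2 ?posrE; lra.
rewrite /sign_entropy.
have -> : v ^+ 2 / 2 * ((1 + eta) / (1 - eta)) = (- v ^+ 2 + 2 * v ^+ 2 / (1 - eta)) / 2.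
  by field; lra.
by lra.
Qed.

Lemma sign_change_of_measure v a b : `|v| < 1 ->
  expR ((1 + v) / 2 * a + (1 - v) / 2 * b - sign_entropy v) <= (expR a + expR b) / 2.
Proof.
rewrite ltr_norml => /andP[v1 v1'].
have [p0 m0] : 0 < 1 + v /\ 0 < 1 - v by split; lra.
pose p e : R := if e then (1 + v) / 2 else (1 - v) / 2.
pose z e : R := if e then a - ln (1 + v) else b - ln (1 - v).
have p_ge0 e : 0 <= p e by rewrite /p; case: e; lra.
have jensen := @expR_jensen R bool [:: true; false] p z p_ge0.
rewrite !big_cons !big_nil !addr0 in jensen.
apply: le_trans (le_trans _ (jensen _)) _.
- by rewrite ler_expR le_eqVlt; apply/orP; left; apply/eqP; rewrite /p /z /sign_entropy; ring.
- by rewrite /p; field.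
rewrite /p /z !expRB !lnK ?posrE// le_eqVlt; apply/orP; left.
by apply/eqP; field; rewrite !gt_eqF.
Qed.

End sign_entropy.

Lemma pac_bayes (R : realType) (V : zmodType) (l : seq (R * V)) (h : V -> R) (w : V) :
  {in l, forall x, `|x.1| < 1} ->
  expR (biased_mean l h w - \sum_(x <- l) sign_entropy x.1) <=
  biased_mean (unbiased l) (expR \o h) w.
Proof.
elim: l w => [|x l IH] w l1 /=; first by rewrite big_nil subr0.
have {}IH w' := IH w' (sub_in1 (@mem_behead _ (x :: l)) l1).
rewrite big_cons addr0 subr0; move: IH; set ent := \sum_(y <- l) _ => IH.
apply: le_trans (_ : (expR (biased_mean l h (w + x.2) - ent) +
                      expR (biased_mean l h (w - x.2) - ent)) / 2 <= _); last first.
  by have := IH (w + x.2); have := IH (w - x.2); lra.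
apply: le_trans (sign_change_of_measure _ _ (l1 x (mem_head _ _))).
by rewrite ler_expR le_eqVlt; apply/orP; left; apply/eqP; field.
Qed.

Lemma unbiased_mean_expectation (R : realType) (V : zmodType) (dT : measure_display)
    (T : measurableType dT) (P : probability T R) (l : seq (R * V)) (G : T -> V -> R) (w : V) :
  (forall S, measurable_fun setT (G ^~ S)) -> (forall t S, 0 <= G t S) ->
  (forall S, (\int[P]_t (G t S)%:E = 1)%E) ->
  [/\ measurable_fun setT (fun t => biased_mean (unbiased l) (G t) w),
      forall t, 0 <= biased_mean (unbiased l) (G t) w &
      (\int[P]_t (biased_mean (unbiased l) (G t) w)%:E = 1)%E].
Proof.
move=> mG G0 intG.
elim: l w => [|x l IH] w /=; first by split.
have [m1 p1 E1] := IH (w + x.2); have [m2 p2 E2] := IH (w - x.2); rewrite addr0 subr0.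
split.
- by apply: measurable_funD; apply: measurable_funM.
- by move=> t; rewrite addr_ge0// mulr_ge0// divr_ge0.
have half0 : (0 : R) <= 1 / 2 by rewrite divr_ge0.
under eq_integral do rewrite EFinD !EFinM.
rewrite ge0_integralD//; last 4 first.
- by move=> t _; rewrite -EFinM lee_fin mulr_ge0.
- by apply/measurable_EFinP; exact: measurable_funM.
- by move=> t _; rewrite -EFinM lee_fin mulr_ge0.
- by apply/measurable_EFinP; exact: measurable_funM.
rewrite !ge0_integralZl//; last 4 first.
- exact/measurable_EFinP.
- by move=> t _; rewrite lee_fin.
- exact/measurable_EFinP.
- by move=> t _; rewrite lee_fin.
by rewrite E1 E2 !mule1 mul1e -EFinD; congr EFin; field.
Qed.

Section signed_sum_moments.
Context (R : realType) (d : nat).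
Implicit Types (l : seq (R * 'cV[R]_d)) (w : 'cV[R]_d).

Definition bias_center l : 'cV[R]_d := \sum_(x <- l) x.1 *: x.2.

Definition bias_noise l : R := \sum_(x <- l) (1 - x.1 ^+ 2) * dotv x.2 x.2.

Lemma biased_mean_mulmx e (W : 'M[R]_(e, d)) l (g : 'cV[R]_e -> R) w :
  biased_mean l (fun S => g (W *m S)) w =
  biased_mean [seq (x.1, W *m x.2) | x <- l] g (W *m w).
Proof. by elim: l w => //= x l IH w; rewrite !IH mulmxDr mulmxBr. Qed.

Lemma biased_mean_dotv l w :
  biased_mean l (fun S => dotv S S) w =
  dotv (w + bias_center l) (w + bias_center l) + bias_noise l.
Proof.
elim: l w => [|[v f] l IH] w /=; first by rewrite /bias_center /bias_noise !big_nil !addr0.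
rewrite /bias_center /bias_noise !big_cons -/(bias_center l) -/(bias_noise l) /= !IH.
rewrite [w + f + _]addrAC [w - f + _]addrAC [v *: f + _]addrC [w + (_ + _)]addrA.
set N := w + bias_center l.
by rewrite (dotvvD N f) (dotvvB N f) (dotvvD N (v *: f)) dotvvZ dotvZr; field.
Qed.

(* The variance is computed one sign at a time: flipping [e_x] changes the
   conditional mean of [|S|^2] by four times [<f_x, S - e_x f_x>], averaged over
   the remaining signs. *)
Definition bias_variance l w : R :=
  4 * \sum_(x <- l) dotv x.2 (w + bias_center l - x.1 *: x.2) ^+ 2 +
  2 * \sum_(x <- l) \sum_(y <- l) dotv x.2 y.2 ^+ 2.

Lemma bias_variance_cons v f l w :
  (1 + v) / 2 * bias_variance l (w + f) + (1 - v) / 2 * bias_variance l (w - f) +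
    4 * (1 - v ^+ 2) * dotv f (w + bias_center l) ^+ 2 <= bias_variance ((v, f) :: l) w.
Proof.
rewrite /bias_variance /bias_center !big_cons -/(bias_center l) /=.
rewrite [w + f + _]addrAC [w - f + _]addrAC [v *: f + _]addrC [w + (_ + _)]addrA.
set N := w + bias_center l; rewrite addrK.
pose A (y : R * 'cV[R]_d) := dotv y.2 (N - y.1 *: y.2).
pose B (y : R * 'cV[R]_d) := dotv y.2 f.
have AB a y : dotv y.2 (N + a *: f - y.1 *: y.2) = A y + a * B y.
  by rewrite addrAC dotvDr dotvZr.
have -> : \sum_(y <- l) dotv y.2 (N + f - y.1 *: y.2) ^+ 2 = \sum_(y <- l) (A y + B y) ^+ 2.
  by apply: eq_bigr => y _; have := AB 1 y; rewrite scale1r mul1r => ->.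
have -> : \sum_(y <- l) dotv y.2 (N - f - y.1 *: y.2) ^+ 2 = \sum_(y <- l) (A y - B y) ^+ 2.
  by apply: eq_bigr => y _; have := AB (- 1) y; rewrite scaleN1r mulN1r => ->.
under [\sum_(y <- l) dotv y.2 (N + _ - _) ^+ 2]eq_bigr do rewrite AB.
have -> : \sum_(y <- l) \sum_(z <- (v, f) :: l) dotv y.2 z.2 ^+ 2 =
    \sum_(y <- l) B y ^+ 2 + \sum_(y <- l) \sum_(z <- l) dotv y.2 z.2 ^+ 2.
  by rewrite -big_split; apply: eq_bigr => y _; rewrite big_cons.
have -> : \sum_(y <- l) dotv f y.2 ^+ 2 = \sum_(y <- l) B y ^+ 2.
  by apply: eq_bigr => y _; rewrite dotvC.
have flip : (1 + v) / 2 * (\sum_(y <- l) (A y + B y) ^+ 2) +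
    (1 - v) / 2 * (\sum_(y <- l) (A y - B y) ^+ 2) <=
    \sum_(y <- l) (A y + v * B y) ^+ 2 + \sum_(y <- l) B y ^+ 2.
  rewrite !mulr_sumr -!big_split /=; apply: ler_sum => y _.
  by have := sqr_ge0 (v * B y); move: (A y) (B y) => a b; lra.
have := sqr_ge0 (dotv f f); have := sqr_ge0 (v * dotv f N).
move: flip; rewrite exprMn; lra.
Qed.

Lemma biased_mean_dotv_sqr l w : {in l, forall x, `|x.1| <= 1} ->
  biased_mean l (fun S => dotv S S ^+ 2) w <=
  biased_mean l (fun S => dotv S S) w ^+ 2 + bias_variance l w.
Proof.
elim: l w => [|[v f] l IH] w l1 /=; first by rewrite /bias_variance !big_nil !mulr0 !addr0.
have := l1 _ (mem_head _ _); rewrite ler_norml => /andP[/= v0 v1].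
have {}IH w' := IH w' (sub_in1 (@mem_behead _ ((v, f) :: l)) l1).
set N := w + bias_center l.
have meanN : biased_mean l (fun S => dotv S S) (w - f) =
    biased_mean l (fun S => dotv S S) (w + f) - 4 * dotv f N.
  rewrite !biased_mean_dotv [w + f + _]addrAC [w - f + _]addrAC -/N.
  by rewrite (dotvvB N f) (dotvvD N f) (dotvC N f); ring.
apply: le_trans (lerD (ler_wpM2l _ (IH (w + f))) (ler_wpM2l _ (IH (w - f)))) _; try lra.
rewrite meanN; set m := biased_mean l _ (w + f).
have := bias_variance_cons v f l w; rewrite -/N; lra.
Qed.

End signed_sum_moments.

(** * Tilted Gaussian sketches *)

Lemma le_ln_expn (R : realType) (x r : R) (n : nat) :
  0 < r -> r ^+ n <= x -> n%:R * (1 - r^-1) <= ln x.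
Proof.
move=> r0 rx; have rn0 : 0 < r ^+ n by rewrite exprn_gt0.
apply: (@le_trans _ _ (ln (r ^+ n))); last by rewrite ler_ln ?posrE// (lt_le_trans rn0).
by rewrite lnXn// -[leRHS]mulr_natl ler_wpM2l// ln_ge1BV.
Qed.

Lemma ln1D_ge_parabola (R : realType) (x y : R) : 0 <= x -> 0 <= y ->
  ln (1 + y) + (x - y) / (1 + y) - (x - y) ^+ 2 / (1 + y) <= ln (1 + x).
Proof.
move=> x0 y0.
have [x1 y1] : 0 < 1 + x /\ 0 < 1 + y by split; lra.
have ratio : 1 - (1 + y) / (1 + x) <= ln (1 + x) - ln (1 + y).
  by rewrite -ln_div ?posrE// -(invf_div (1 + x)) ln_ge1BV// divr_gt0.
suff : (x - y) / (1 + y) - (x - y) ^+ 2 / (1 + y) <= 1 - (1 + y) / (1 + x) by lra.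
rewrite -subr_ge0 (_ : _ - _ = (x - y) ^+ 2 / (1 + y) * (x / (1 + x))).
  by rewrite mulr_ge0// divr_ge0 ?sqr_ge0// ltW.
by field; rewrite !gt_eqF.
Qed.

Lemma sqrtr_expR (R : realType) (x : R) : Num.sqrt (expR x) = expR (x / 2).
Proof.
rewrite {1}(_ : x = x / 2 * 2%:R); last by rewrite divfK.
by rewrite expRM_natr sqrtr_sqr ger0_norm ?expR_ge0.
Qed.

Section tilted_signs.
Context (R : realType) (d s : nat) (Om : 'M[R]_(d, s)) (th : R).
Context (l : seq (R * 'cV[R]_d)).
Hypotheses (th_ge0 : 0 <= th) (bias_lt1 : {in l, forall x, `|x.1| < 1}).
Hypothesis null_center : Om^T *m bias_center l = 0.

Let log_tilt (S : 'cV[R]_d) : R :=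
  s%:R / 2 * ln (1 + th * dotv S S) - th / 2 * dotv (Om^T *m S) (Om^T *m S).

Let expR_log_tilt S : expR (log_tilt S) = sketch_tilt Om th S.
Proof.
have q0 : 0 < 1 + th * dotv S S by rewrite ltr_wpDr// mulr_ge0 ?dotvv_ge0.
rewrite /log_tilt expRD; congr (_ * expR _); last by ring.
by rewrite -{2}(lnK q0) sqrtr_expR -expRM_natl; congr expR; ring.
Qed.

Let bias_le1 : {in l, forall x, `|x.1| <= 1}.
Proof. by move=> x /bias_lt1/ltW. Qed.

Lemma biased_mean_sketch_le :
  biased_mean l (fun S => dotv (Om^T *m S) (Om^T *m S)) 0 <=
  \sum_(x <- l) dotv (Om^T *m x.2) (Om^T *m x.2).
Proof.
rewrite (biased_mean_mulmx _ _ (fun S => dotv S S)) biased_mean_dotv mulmx0 add0r.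
have -> : bias_center [seq (x.1, Om^T *m x.2) | x <- l] = 0.
  rewrite -null_center /bias_center big_map mulmx_sumr.
  by apply: eq_bigr => x _; rewrite scalemxAr.
rewrite dotv0l add0r /bias_noise big_map !big_seq; apply: ler_sum => x _ /=.
by rewrite ler_piMl ?dotvv_ge0// lerBlDr lerDl sqr_ge0.
Qed.

Lemma biased_mean_ln_ge (y m : R) : 0 <= y ->
  m = th * biased_mean l (fun S => dotv S S) 0 ->
  ln (1 + y) + (m - y) / (1 + y)
    - (th ^+ 2 * bias_variance l 0 + (m - y) ^+ 2) / (1 + y) <=
  biased_mean l (fun S => ln (1 + th * dotv S S)) 0.
Proof.
move=> y0 mE; have y1 : 0 < 1 + y by rewrite ltr_wpDr.
pose parabola (S : 'cV[R]_d) : R := ln (1 + y) - (y + y ^+ 2) / (1 + y) +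
  ((1 + 2 * y) / (1 + y) * th * dotv S S + - (th ^+ 2 / (1 + y)) * dotv S S ^+ 2).
have parabola_le S : parabola S <= ln (1 + th * dotv S S).
  apply: le_trans (ln1D_ge_parabola _ y0); last by rewrite mulr_ge0 ?dotvv_ge0.
  by rewrite le_eqVlt; apply/orP; left; apply/eqP; rewrite /parabola; field; rewrite gt_eqF.
apply: le_trans (le_biased_mean 0 bias_le1 parabola_le).
rewrite biased_meanD biased_mean_cst biased_meanD !biased_meanZ -[_ * th * _]mulrA -mE.
have -> : ln (1 + y) + (m - y) / (1 + y)
    - (th ^+ 2 * bias_variance l 0 + (m - y) ^+ 2) / (1 + y) =
    ln (1 + y) - (y + y ^+ 2) / (1 + y) + ((1 + 2 * y) / (1 + y) * m
      - th ^+ 2 / (1 + y) *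
        (biased_mean l (fun S => dotv S S) 0 ^+ 2 + bias_variance l 0)).
  by rewrite mE; field; rewrite gt_eqF.
rewrite !lerD2l mulNr lerN2 ler_wpM2l ?divr_ge0 ?sqr_ge0 ?(ltW y1)//.
exact: biased_mean_dotv_sqr.
Qed.

Lemma sketch_tilt_pac_bayes (y m G : R) : 0 <= y -> 0 < G ->
  m = th * biased_mean l (fun S => dotv S S) 0 ->
  biased_mean (unbiased l) (sketch_tilt Om th) 0 <= G ->
  s%:R / 2 * (ln (1 + y) + (m - y) / (1 + y)
    - (th ^+ 2 * bias_variance l 0 + (m - y) ^+ 2) / (1 + y))
  - th / 2 * \sum_(x <- l) dotv (Om^T *m x.2) (Om^T *m x.2)
  - \sum_(x <- l) sign_entropy x.1 <= ln G.
Proof.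
move=> y0 G0 mE leG; rewrite -ler_expR lnK ?posrE//; apply: le_trans leG.
rewrite -(eq_biased_mean _ _ expR_log_tilt).
apply: le_trans (pac_bayes log_tilt 0 bias_lt1); rewrite ler_expR lerD2r.
rewrite /log_tilt; under eq_biased_mean do rewrite -mulNr.
rewrite biased_meanD !biased_meanZ; apply: lerD.
  by rewrite ler_wpM2l ?divr_ge0// biased_mean_ln_ge.
by rewrite mulNr lerN2 ler_wpM2l ?divr_ge0// biased_mean_sketch_le.
Qed.

End tilted_signs.

Section trace_tilt.
Context (R : realType) (d s : nat) (tau : R) (fs : seq 'cV[R]_d).
Hypothesis tau01 : 0 < tau < 1.

Let mass := \sum_(f <- fs) dotv f f.

(* The parameters are negative, so that a bound on [trace_tilt] limits the sketched
   mass of [fs] from above. *)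
Definition trace_tilt (Om : 'M[R]_(d, s)) : R :=
  \sum_(f <- fs) dotv f f / mass * sketch_tilt Om (- (tau / dotv f f)) f.

Let mass_ge0 : 0 <= mass.
Proof. by apply: sumr_ge0 => f _; exact: dotvv_ge0. Qed.

Let weight_ge0 (f : 'cV[R]_d) : 0 <= dotv f f / mass.
Proof. by rewrite divr_ge0 ?dotvv_ge0. Qed.

Let tilt_norm (f : 'cV[R]_d) : 0 < 1 + - (tau / dotv f f) * dotv f f.
Proof.
have /andP[_ tau1] := tau01.
have [->|f0] := eqVneq (dotv f f) 0; first by rewrite mulr0 addr0.
by rewrite mulNr divfK// subr_gt0.
Qed.

Lemma trace_tilt_ge0 Om : 0 <= trace_tilt Om.
Proof. by apply: sumr_ge0 => f _; rewrite mulr_ge0// sketch_tilt_ge0. Qed.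

Let sketch_mass (Om : 'M[R]_(d, s)) := \sum_(f <- fs) dotv (Om^T *m f) (Om^T *m f).

Let expR_le_trace_tilt Om : mass != 0 ->
  Num.sqrt (1 - tau) ^+ s * expR (tau / 2 * sketch_mass Om / mass) <= trace_tilt Om.
Proof.
move=> mass_n0; pose z f := tau / 2 * (dotv (Om^T *m f) (Om^T *m f) / dotv f f).
have -> : trace_tilt Om =
    Num.sqrt (1 - tau) ^+ s * \sum_(f <- fs) dotv f f / mass * expR (z f).
  rewrite mulr_sumr; apply: eq_bigr => f _; rewrite /sketch_tilt mulNr.
  have [->|f0] := eqVneq (dotv f f) 0; first by rewrite !mul0r mulr0.
  by rewrite divfK// [in RHS]mulrCA; congr (_ * (_ * expR _)); rewrite /z; field.
have -> : tau / 2 * sketch_mass Om / mass = \sum_(f <- fs) dotv f f / mass * z f.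
  rewrite mulr_sumr mulr_suml; apply: eq_bigr => f _; rewrite /z.
  have [f0|f0] := eqVneq (dotv f f) 0; last by field; rewrite f0 mass_n0.
  by rewrite f0 (dotvv_eq0 f0) mulmx0 dotv0r !(mul0r, mulr0).
apply: ler_wpM2l; first exact: exprn_ge0.
by apply: expR_jensen => //; rewrite -mulr_suml mulfV.
Qed.

Lemma sketch_mass_le Om (G : R) : 0 < G -> trace_tilt Om <= G ->
  \sum_(f <- fs) dotv (Om^T *m f) (Om^T *m f) <=
  \sum_(f <- fs) dotv f f * (2 * ln G / tau + s%:R / (1 - tau)).
Proof.
move=> G0 leG; rewrite -mulr_suml -/mass -/(sketch_mass Om).
have /andP[tau0 tau1] := tau01; have tau1' : 0 < 1 - tau by rewrite subr_gt0.
have [m0|mass_n0] := eqVneq mass 0.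
  rewrite m0 mul0r /sketch_mass big_seq big1// => f fs_f.
  suff /eqP/dotvv_eq0 -> : dotv f f == 0 by rewrite mulmx0 dotv0r.
  move/eqP: m0; rewrite /mass psumr_eq0 => [/allP/(_ f fs_f)//|i _]; exact: dotvv_ge0.
have mass_gt0 : 0 < mass by rewrite lt_def mass_n0.
have := le_trans (expR_le_trace_tilt Om mass_n0) leG.
have -> : Num.sqrt (1 - tau) = expR (ln (1 - tau) / 2) by rewrite -sqrtr_expR lnK ?posrE.
rewrite -expRM_natl -expRD -{1}(lnK (x := G)) ?posrE// ler_expR => tilt_le.
have ln_tau : s%:R / 2 * - (tau / (1 - tau)) <= s%:R / 2 * ln (1 - tau).
  rewrite ler_wpM2l ?divr_ge0//; apply: le_trans (ln_ge1BV tau1').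
  by rewrite le_eqVlt; apply/orP; left; apply/eqP; field; rewrite gt_eqF.
have -> : mass * (2 * ln G / tau + s%:R / (1 - tau)) =
    (ln G + s%:R / 2 * (tau / (1 - tau))) * mass / (tau / 2).
  by field; rewrite !gt_eqF.
by rewrite ler_pdivlMr ?divr_gt0// -ler_pdivrMr// mulrC; lra.
Qed.

Lemma expectation_trace_tilt (dT : measure_display) (T : measurableType dT)
    (P : probability T R) (Om : T -> 'M[R]_(d, s)) :
  std_gaussian_matrix P Om ->
  measurable_fun setT (fun w => trace_tilt (Om w)) /\
  (\int[P]_w (trace_tilt (Om w))%:E <= 1)%E.
Proof.
move=> Om_std; have mtilt f := measurable_sketch_tilt Om_std (- (tau / dotv f f)) f.
split; first by apply: measurable_sum => f; exact: measurable_funM.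
under eq_integral do rewrite /trace_tilt -sumEFin.
rewrite ge0_integral_sum//; last 2 first.
- by move=> f; apply/measurable_EFinP; exact: measurable_funM.
- by move=> f w _; rewrite lee_fin mulr_ge0// sketch_tilt_ge0.
apply: (@le_trans _ _ (\sum_(f <- fs) dotv f f / mass)%:E).
  rewrite -sumEFin; apply: lee_sum => f _; under eq_integral do rewrite EFinM.
  rewrite ge0_integralZl//; last 3 first.
  - exact/measurable_EFinP.
  - by move=> w _; rewrite lee_fin sketch_tilt_ge0.
  - by rewrite lee_fin.
  by rewrite (expectation_sketch_tilt Om_std)// mule1.
rewrite lee_fin -mulr_suml -/mass.
by have [->|m0] := eqVneq mass 0; rewrite ?mul0r ?mulfV.
Qed.

End trace_tilt.

Lemma ln3_ge1 (R : realType) : 1 <= ln (3 : R).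
Proof.
apply: le_trans (@le_ln_expn R 3 (8 / 7) 8 _ _); rewrite ?divr_gt0//.
  by rewrite invf_div; lra.
by rewrite !exprS expr0; lra.
Qed.

Lemma ln16_ge2 (R : realType) : 2 <= ln (16 : R).
Proof. by apply: le_trans (@le_ln_expn R 16 2 4 _ _) => //; rewrite ?exprS ?expr0; lra. Qed.

Lemma sum_sqr_sub_le (R : realFieldType) (I : Type) (r : seq I) (g h : I -> R) :
  \sum_(i <- r) (g i - h i) ^+ 2 <=
  13 / 12 * \sum_(i <- r) g i ^+ 2 + 13 * \sum_(i <- r) h i ^+ 2.
Proof.
rewrite !mulr_sumr -big_split /=; apply: ler_sum => i _.
by have := sqr_ge0 (g i / 12 + h i); move: (g i) (h i) => a b; lra.
Qed.

Lemma sub_sqr_mono (R : realDomainType) (a b : R) :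
  a <= b -> a + b <= 1 -> a - a ^+ 2 <= b - b ^+ 2.
Proof.
move=> ab ab1; rewrite -subr_ge0 (_ : _ - _ = (b - a) * (1 - (a + b))); last by ring.
by rewrite mulr_ge0// subr_ge0.
Qed.

Lemma margin_polynomial (R : realFieldType) (y a : R) : 0 <= y <= 1 ->
  a = - (1 - (1 - y) ^+ 2) / 2 - 1 / 200 ->
  83 / 200 + y ^+ 2 / 32 + (1 - y) ^+ 2 * (1 + y / 2) / 2 <=
  1 - 2 / 25 + (a - a ^+ 2) / 3.
Proof.
move=> /andP[y0 y1] ->.
have y2 : 0 <= y * (1 - y) by rewrite mulr_ge0// subr_ge0.
have y3 : 0 <= y * (y * (1 - y)) by rewrite mulr_ge0.
have y4 : 0 <= y * (y * (y * (1 - y))) by rewrite mulr_ge0.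
by lra.
Qed.

(* The tangent of the logarithm at [2], minus the variance and trace penalties. *)
Lemma pac_bayes_margin (R : realType) (y m V : R) :
  0 <= y <= 1 -> 2 - (1 - (1 - y) ^+ 2) / 2 - 1 / 200 <= m <= 2 -> V <= 6 / 25 ->
  83 / 200 + y ^+ 2 / 32 <=
  ln (1 + 2) + (m - 2) / (1 + 2) - (V + (m - 2) ^+ 2) / (1 + 2)
  - (1 - y) ^+ 2 * (1 + y / 2) / 2.
Proof.
move=> y01 /andP[m_ge m_le] V_le.
have ln3 := ln3_ge1 R; rewrite (_ : 1 + 2 = 3); last by ring.
have := margin_polynomial y01 erefl; set a := _ - 1 / 200 => poly.
have am : a <= m - 2 by move: m_ge; rewrite /a; move: (1 - (1 - y) ^+ 2) => u; lra.
have a0 : a <= 0 by apply: le_trans am _; rewrite subr_le0.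
have m0 : m - 2 <= 0 by rewrite subr_le0.
clearbody a; have sum_le1 : a + (m - 2) <= 1 by lra.
have := sub_sqr_mono am sum_le1.
move: (ln 3) (m - 2) ln3 {am a0 m0 m_ge m_le sum_le1} => L b L1.
move: (_ * (1 + y / 2)) (y ^+ 2) poly => t z poly; lra.
Qed.

Section null_direction.
Context (R : realType) (d s : nat) (Om : 'M[R]_(d, s)) (l : seq (R * 'cV[R]_d)).
Context (p q G : R).
Let K := (p + q) ^+ 2.
Let y := q / (p + q).
Hypotheses (p_ge0 : 0 <= p) (q_gt0 : 0 < q) (q2_ge16 : 16 <= q ^+ 2).
Hypotheses (s_ge : 8 * K <= s%:R) (G_gt0 : 0 < G) (lnG_le : ln G <= q ^+ 2 / 8).
Hypothesis bias_small : {in l, forall x, `|x.1| <= 1 / 80}.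
Hypothesis vector_small : {in l, forall x, dotv x.2 x.2 <= 1}.
Hypothesis vector_mass : \sum_(x <- l) dotv x.2 x.2 = p ^+ 2.
Hypothesis bessel : forall u, \sum_(x <- l) dotv x.2 u ^+ 2 <= dotv u u.
Hypothesis bias_mass : \sum_(x <- l) x.1 ^+ 2 <= 42 / 13 * K.
Hypothesis center_mass : dotv (bias_center l) (bias_center l) = 3 * K.

Let pq_gt0 : 0 < p + q. Proof. by rewrite ltr_wpDl. Qed.
Let K_gt0 : 0 < K. Proof. by rewrite exprn_gt0. Qed.
Let y01 : 0 <= y <= 1.
Proof. by rewrite divr_ge0 ?(ltW q_gt0) ?(ltW pq_gt0)//= ler_pdivrMr// mul1r lerDr. Qed.
Let p2E : p ^+ 2 = (1 - y) ^+ 2 * K. Proof. by rewrite /y /K; field; rewrite gt_eqF. Qed.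
Let q2E : q ^+ 2 = y ^+ 2 * K. Proof. by rewrite /y /K; field; rewrite gt_eqF. Qed.
Let p2_le : p ^+ 2 <= K.
Proof. rewrite p2E ler_piMl ?(ltW K_gt0)// expr_le1//; have /andP[] := y01; lra. Qed.
Let K_ge16 : 16 <= K.
Proof. by rewrite (le_trans q2_ge16)// /K ler_pXn2r ?nnegrE ?(ltW q_gt0) ?(ltW pq_gt0)// lerDr. Qed.

Let bias_sqr_small : {in l, forall x, x.1 ^+ 2 <= 1 / 1000}.
Proof.
move=> x /bias_small v_le; rewrite -real_normK ?num_real//.
by apply: le_trans (lerXn2r 2 _ _ v_le) _; rewrite ?nnegrE ?divr_ge0// expr2; lra.
Qed.

Let entropy_le : \sum_(x <- l) sign_entropy x.1 <= 829 / 500 * K.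
Proof.
have eta1 : 1 / 80 < 1 :> R by lra.
have ratio : (1 + 1 / 80) / (1 - 1 / 80) = 81 / 79 :> R by field.
apply: (@le_trans _ _ (\sum_(x <- l) 81 / 158 * x.1 ^+ 2)).
  rewrite !big_seq; apply: ler_sum => x /bias_small v_le.
  by have := sign_entropy_le v_le eta1; rewrite ratio; lra.
by rewrite -mulr_sumr; have := bias_mass; have := K_gt0; lra.
Qed.

Let weighted_noise_le : \sum_(x <- l) x.1 ^+ 2 * dotv x.2 x.2 <= K / 1000.
Proof.
apply: (@le_trans _ _ (\sum_(x <- l) 1 / 1000 * dotv x.2 x.2)).
  by rewrite !big_seq; apply: ler_sum => x /bias_sqr_small; exact/ler_wpM2r/dotvv_ge0.
by rewrite -mulr_sumr vector_mass; have := p2_le; lra.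
Qed.

Let variance_le : bias_variance l 0 <= 46 / 3 * K.
Proof.
rewrite /bias_variance add0r.
have linear_le : \sum_(x <- l) dotv x.2 (bias_center l - x.1 *: x.2) ^+ 2 <=
    (13 / 4 + 13 / 1000) * K.
  under eq_bigr do rewrite dotvBr dotvZr.
  apply: le_trans (sum_sqr_sub_le _ _ _) _.
  have := bessel (bias_center l); rewrite center_mass.
  have : \sum_(x <- l) (x.1 * dotv x.2 x.2) ^+ 2 <= K / 1000.
    apply: le_trans weighted_noise_le; rewrite !big_seq; apply: ler_sum => x xl.
    by rewrite exprMn ler_wpM2l ?sqr_ge0// expr2 ler_piMl ?dotvv_ge0// vector_small.
  by move: (\sum_(x <- l) _) (\sum_(x <- l) _) => a b; lra.
have quad_le : \sum_(x <- l) \sum_(z <- l) dotv x.2 z.2 ^+ 2 <= p ^+ 2.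
  rewrite -vector_mass; apply: ler_sum => x _; apply: le_trans (bessel _).
  by apply: ler_sum => z _; rewrite dotvC.
by have := p2_le; have := K_gt0; lra.
Qed.

Let mean_bounds : 2 - (1 - (1 - y) ^+ 2) / 2 - 1 / 200 <=
  (2 * K)^-1 * biased_mean l (fun S => dotv S S) 0 <= 2.
Proof.
have W0 : 0 <= \sum_(x <- l) x.1 ^+ 2 * dotv x.2 x.2.
  by apply: sumr_ge0 => x _; rewrite mulr_ge0 ?sqr_ge0 ?dotvv_ge0.
have -> : biased_mean l (fun S => dotv S S) 0 =
    3 * K + (1 - y) ^+ 2 * K - \sum_(x <- l) x.1 ^+ 2 * dotv x.2 x.2.
  rewrite biased_mean_dotv add0r center_mass -addrA -p2E -vector_mass -sumrB.
  by congr (_ + _); apply: eq_bigr => x _; rewrite mulrBl mul1r.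
have := p2_le; rewrite p2E; have := weighted_noise_le; move: W0.
rewrite [(2 * K)^-1 * _]mulrC; move: (\sum_(x <- l) _) ((1 - y) ^+ 2) => W u W0 W_le u_le.
by apply/andP; split; rewrite ?ler_pdivlMr ?ler_pdivrMr ?mulr_gt0//; have := K_gt0; lra.
Qed.

Lemma null_direction_absurd : Om^T *m bias_center l = 0 ->
  \sum_(x <- l) dotv (Om^T *m x.2) (Om^T *m x.2) <= p ^+ 2 * (s%:R * (1 + y / 2)) ->
  biased_mean (unbiased l) (sketch_tilt Om (2 * K)^-1) 0 <= G -> False.
Proof.
move=> null_center trace_le leG.
have bias_lt1 : {in l, forall x, `|x.1| < 1} by move=> x /bias_small/le_lt_trans; apply; lra.
have th_ge0 : 0 <= (2 * K)^-1 by rewrite invr_ge0 mulr_ge0// ltW.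
have two_ge0 : (0 : R) <= 2 by [].
have := sketch_tilt_pac_bayes th_ge0 bias_lt1 null_center two_ge0 G_gt0 erefl leG.
have V_le : (2 * K)^-1 ^+ 2 * bias_variance l 0 <= 6 / 25.
  rewrite exprVn ler_pdivrMl ?exprn_gt0 ?mulr_gt0//; apply: le_trans variance_le _.
  have : 16 * K <= K * K by rewrite ler_wpM2r// ltW.
  by have := K_gt0; move: K => k; lra.
have := pac_bayes_margin y01 mean_bounds V_le.
set B := ln _ + _ - _ => margin; apply/negP; rewrite -ltNge.
have trace_penalty : (2 * K)^-1 / 2 * \sum_(x <- l) dotv (Om^T *m x.2) (Om^T *m x.2) <=
    s%:R / 2 * ((1 - y) ^+ 2 * (1 + y / 2) / 2).
  apply: le_trans (ler_wpM2l (divr_ge0 th_ge0 two_ge0) trace_le) _.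
  rewrite p2E le_eqVlt; apply/orP; left; apply/eqP; field; exact: lt0r_neq0.
have gain : 4 * K * (83 / 200 + y ^+ 2 / 32) <=
    s%:R / 2 * (B - (1 - y) ^+ 2 * (1 + y / 2) / 2).
  apply: ler_pM => //; first by rewrite mulr_ge0// ltW.
  - by rewrite addr_ge0 ?divr_ge0 ?sqr_ge0.
  - by move: s_ge; lra.
have := entropy_le; move: lnG_le; rewrite q2E; move: K_gt0 gain trace_penalty.
move: (ln G) (\sum_(x <- l) sign_entropy _) (_ * \sum_(x <- l) _) => g e t.
by move: B ((1 - y) ^+ 2 * _ / 2) (y ^+ 2) {margin} => B r z; lra.
Qed.
End null_direction.

Section column_copies.
Context (R : realType) (d m : nat) (F : 'M[R]_(d, m)).
Implicit Types v : 'cV[R]_m.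

(* Splitting each column into [N.+1] copies scaled by [1 / sqrt N.+1] preserves
   quadratic sums and makes every bias small, so that the signs behave like the
   entries of a Gaussian vector. *)
Definition column_copies (N : nat) v : seq (R * 'cV[R]_d) :=
  [seq ((Num.sqrt N.+1%:R)^-1 * v j 0, (Num.sqrt N.+1%:R)^-1 *: col j F)
    | j <- index_enum 'I_m, _ <- index_enum 'I_N.+1].

Variables (N : nat) (v : 'cV[R]_m).

Lemma unbiased_column_copies : unbiased (column_copies N v) = unbiased (column_copies N 0).
Proof. by rewrite /unbiased !map_allpairs. Qed.

Lemma sum_column_copies (V : lmodType R) (G : R * 'cV[R]_d -> V) :
  (forall a b f, G (a * b, a *: f) = a ^+ 2 *: G (b, f)) ->
  \sum_(x <- column_copies N v) G x = \sum_j G (v j 0, col j F).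
Proof.
move=> quadratic; rewrite big_allpairs_dep; apply: eq_bigr => j _.
rewrite quadratic sumr_const card_ord -scaler_nat scalerA exprVn sqr_sqrtr//.
by rewrite mulfV ?scale1r// pnatr_eq0.
Qed.

Lemma sum_column_copiesM (G : R * 'cV[R]_d -> R) :
  (forall a b f, G (a * b, a *: f) = a ^+ 2 * G (b, f)) ->
  \sum_(x <- column_copies N v) G x = \sum_j G (v j 0, col j F).
Proof. exact: (@sum_column_copies R^o). Qed.

Lemma column_copies_center : bias_center (column_copies N v) = F *m v.
Proof.
rewrite /bias_center sum_column_copies ?mulmx_sum_col// => a b f /=.
by rewrite !scalerA; congr (_ *: _); ring.
Qed.

Lemma column_copies_bias_mass : \sum_(x <- column_copies N v) x.1 ^+ 2 = dotv v v.
Proof.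
rewrite (sum_column_copiesM (G := fun x => x.1 ^+ 2)) => [|a b f]; last exact: exprMn.
by rewrite dotvE; apply: eq_bigr => j _; rewrite expr2.
Qed.

Lemma column_copies_mass :
  \sum_(x <- column_copies N v) dotv x.2 x.2 = \sum_j dotv (col j F) (col j F).
Proof.
by rewrite (sum_column_copiesM (G := fun x => dotv x.2 x.2))// => a b f; exact: dotvvZ.
Qed.

Lemma column_copies_vectors :
  [seq x.2 | x <- column_copies N v] = [seq x.2 | x <- column_copies N 0].
Proof. by rewrite !map_allpairs. Qed.

Lemma column_copies_dotv_sqr (u : 'cV[R]_d) :
  \sum_(x <- column_copies N v) dotv x.2 u ^+ 2 = dotv (F^T *m u) (F^T *m u).
Proof.
rewrite (sum_column_copiesM (G := fun x => dotv x.2 u ^+ 2)) => [|a b f /=].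
  by rewrite [RHS]dotvE; apply: eq_bigr => j _; rewrite trmx_mulmx_entry expr2.
by rewrite dotvZl exprMn.
Qed.

Let copy_scale : (Num.sqrt N.+1%:R)^-1 ^+ 2 = N.+1%:R^-1 :> R.
Proof. by rewrite exprVn sqr_sqrtr. Qed.

Lemma column_copies_bias_le :
  {in column_copies N v, forall x, x.1 ^+ 2 <= dotv v v / N.+1%:R}.
Proof.
move=> x /allpairsP[[j i] /= [_ _ ->]] /=.
by rewrite exprMn copy_scale mulrC ler_wpM2r ?invr_ge0// entry_sqr_le_dotv.
Qed.

Lemma column_copies_dotv_le :
  (forall u : 'cV[R]_d, dotv (F^T *m u) (F^T *m u) <= dotv u u) ->
  {in column_copies N v, forall x, dotv x.2 x.2 <= 1}.
Proof.
move=> F_contraction x /allpairsP[[j i] /= [_ _ ->]] /=.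
have col_le1 : dotv (col j F) (col j F) <= 1.
  rewrite colE (le_trans (dotv_tr_contraction F_contraction _))//.
  by rewrite dotv_delta_mx mxE !eqxx.
rewrite dotvvZ copy_scale; apply: le_trans (ler_piMr _ col_le1) _; rewrite ?invr_ge0//.
by rewrite invf_le1 ?ler1n// ltr0n.
Qed.

End column_copies.

Section gaussian_sketch_null.
Context (R : realType) (d m s : nat) (F : 'M[R]_(d, m)) (delta : R).
Hypothesis F_contraction : forall u, dotv (F^T *m u) (F^T *m u) <= dotv u u.
Hypothesis delta01 : 0 < delta < 1.

Let mass := \sum_j dotv (col j F) (col j F).
Let p := Num.sqrt mass.
Let q := Num.sqrt (8 * ln (16 / delta)).
Let K := (p + q) ^+ 2.
Let y := q / (p + q).

Hypothesis sketch_size : 8 * K <= s%:R.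

Let delta_gt0 : 0 < delta. Proof. by case/andP: delta01. Qed.

Let mass_ge0 : 0 <= mass.
Proof. by apply: sumr_ge0 => j _; exact: dotvv_ge0. Qed.

Let ln_delta : 2 <= ln (16 / delta).
Proof.
apply: le_trans (ln16_ge2 R) _; have /andP[_ d1] := delta01.
by rewrite ler_ln ?posrE ?divr_gt0// ler_pdivlMr// ler_piMr// ltW.
Qed.

Let q2E : q ^+ 2 = 8 * ln (16 / delta).
Proof. by rewrite sqr_sqrtr//; have := ln_delta; lra. Qed.

Let q_gt0 : 0 < q.
Proof. by rewrite sqrtr_gt0; have := ln_delta; lra. Qed.

Let lnG_le : ln (2 / delta) <= q ^+ 2 / 8.
Proof.
rewrite q2E [8 * _]mulrC mulfK// ler_ln ?posrE ?divr_gt0//.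
by rewrite ler_wpM2r ?invr_ge0 ?(ltW delta_gt0)// ler_nat.
Qed.

Let pq_gt0 : 0 < p + q.
Proof. by rewrite ltr_wpDl// sqrtr_ge0. Qed.

Let y_gt0 : 0 < y.
Proof. exact: divr_gt0. Qed.

Let y_le1 : y <= 1.
Proof. by rewrite ler_pdivrMr// mul1r lerDr sqrtr_ge0. Qed.

Let N := Num.truncn (80 ^+ 2 * (42 / 13 * K)).

Let directions := [seq x.2 | x <- column_copies F N 0].

Let certificate (O : 'M[R]_(d, s)) : R :=
  biased_mean (unbiased (column_copies F N 0)) (sketch_tilt O (2 * K)^-1) 0 +
  trace_tilt (y / 4) directions O.

Let K_gt0 : 0 < K. Proof. exact: exprn_gt0. Qed.

Let y4_01 : 0 < y / 4 < 1.
Proof. by rewrite divr_gt0//= ltr_pdivrMr// mul1r; have := y_le1; lra. Qed.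

Let copies_bias_small v : dotv v v <= 42 / 13 * K ->
  {in column_copies F N v, forall x, `|x.1| <= 1 / 80}.
Proof.
move=> v_le x /column_copies_bias_le bias_le.
rewrite -[X in X <= _]sqrtr_sqr -[1 / 80]ger0_norm ?divr_ge0// -sqrtr_sqr ler_wsqrtr//.
apply: le_trans bias_le _; rewrite ler_pdivrMr// expr_div_n expr1n mul1r.
rewrite ler_pdivlMl//; apply: le_trans (ler_wpM2l _ v_le) _; first exact: exprn_ge0.
by apply/ltW; rewrite truncnS_gt.
Qed.

Let trace_scale_le : 2 * ln (2 / delta) / (y / 4) + s%:R / (1 - y / 4) <= s%:R * (1 + y / 2).
Proof.
have y14 : 0 < 1 - y / 4 by have /andP[_] := y4_01; rewrite subr_gt0.
have tail : s%:R / (1 - y / 4) <= s%:R * (1 + y / 3).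
  rewrite ler_pdivrMr// -mulrA ler_peMr//.
  have -> : (1 + y / 3) * (1 - y / 4) = 1 + y * (1 - y) / 12 by field.
  by rewrite lerDl divr_ge0// mulr_ge0 ?(ltW y_gt0)// subr_ge0.
have head : 2 * ln (2 / delta) / (y / 4) <= s%:R * (y / 8).
  rewrite ler_pdivrMr ?divr_gt0//.
  have : q ^+ 2 = y ^+ 2 * K by rewrite /y /K; field; rewrite gt_eqF.
  have := ler_wpM2l (sqr_ge0 y) sketch_size; have := lnG_le.
  by move: (ln _) (q ^+ 2) => L Q; rewrite expr2 => *; lra.
have : 0 <= s%:R * y by rewrite mulr_ge0// ltW.
lra.
Qed.

Let certificate_null O v : certificate O <= 2 / delta -> O^T *m (F *m v) = 0 ->
  14 * dotv (F *m v) (F *m v) <= 13 * dotv v v.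
Proof.
move=> cert_le null; rewrite leNgt; apply/negP => expands.
have Fv_gt0 : 0 < dotv (F *m v) (F *m v) by have := dotvv_ge0 v; lra.
have G_gt0 : 0 < 2 / delta by rewrite divr_gt0.
pose c := Num.sqrt (3 * K / dotv (F *m v) (F *m v)).
have c2 : c ^+ 2 = 3 * K / dotv (F *m v) (F *m v).
  by rewrite sqr_sqrtr// divr_ge0 ?mulr_ge0// ltW.
have p2 : p ^+ 2 = mass by rewrite sqr_sqrtr.
have cv_le : dotv (c *: v) (c *: v) <= 42 / 13 * K.
  rewrite dotvvZ c2 mulrAC ler_pdivrMr//.
  by have := ler_wpM2l (ltW K_gt0) (ltW expands); lra.
apply: (@null_direction_absurd _ _ _ O (column_copies F N (c *: v)) p q (2 / delta)) => //.
- exact: sqrtr_ge0.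
- by rewrite q2E; have := ln_delta; lra.
- exact: copies_bias_small.
- exact: column_copies_dotv_le.
- by rewrite column_copies_mass p2.
- by move=> u; rewrite column_copies_dotv_sqr.
- by rewrite column_copies_bias_mass.
- by rewrite column_copies_center -scalemxAr dotvvZ c2 divfK ?gt_eqF.
- by rewrite column_copies_center -!scalemxAr null scaler0.
- rewrite -(big_map snd predT (fun f => dotv (O^T *m f) (O^T *m f))) column_copies_vectors.
  have trace_le : trace_tilt (y / 4) directions O <= 2 / delta.
    apply: le_trans cert_le; rewrite lerDr -(biased_mean_cst (unbiased (column_copies F N 0)) 0 0).
    apply: le_biased_mean => [x|S]; last exact: sketch_tilt_ge0.
    by case/mapP => z _ ->; rewrite normr0.
  apply: le_trans (sketch_mass_le y4_01 G_gt0 trace_le) _.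
  by rewrite -mulr_suml big_map column_copies_mass p2 ler_wpM2l.
- rewrite unbiased_column_copies; apply: le_trans cert_le.
  by rewrite lerDl trace_tilt_ge0.
Qed.

Lemma gaussian_sketch_null (dT : measure_display) (T : measurableType dT)
    (P : probability T R) (Om : T -> 'M[R]_(d, s)) : std_gaussian_matrix P Om ->
  exists E : set T, [/\ measurable E, ((1 - delta)%:E <= P E)%E &
    forall w v, E w -> (Om w)^T *m (F *m v) = 0 ->
      14 * dotv (F *m v) (F *m v) <= 13 * dotv v v].
Proof.
move=> Om_std.
have th_gt0 (f : 'cV[R]_d) : 0 < 1 + (2 * K)^-1 * dotv f f.
  by rewrite ltr_wpDr// mulr_ge0 ?dotvv_ge0// invr_ge0 mulr_ge0// ltW.
have [sign_meas sign_ge0 sign_mean] := @unbiased_mean_expectation R _ _ _ P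
  (column_copies F N 0) (fun w => sketch_tilt (Om w) (2 * K)^-1) 0
  (measurable_sketch_tilt Om_std _) (fun w => sketch_tilt_ge0 _ _)
  (fun f => expectation_sketch_tilt Om_std (th_gt0 f)).
have [trace_meas trace_mean] := expectation_trace_tilt directions y4_01 Om_std.
have cert_meas : measurable_fun setT (fun w => certificate (Om w)) by exact: measurable_funD.
pose X : {RV P >-> R} := mfun_Sub (mem_set cert_meas).
have X_mean : ('E_P[X] <= 2%:E)%E.
  rewrite unlock /=; under eq_integral do rewrite EFinD.
  rewrite ge0_integralD//; last 4 first.
  - by move=> w _; rewrite lee_fin.
  - exact/measurable_EFinP.
  - by move=> w _; rewrite lee_fin trace_tilt_ge0.
  - exact/measurable_EFinP.
  by rewrite sign_mean (_ : 2%:E = 1 + 1)%E ?leeD2l// -EFinD.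
have [E_meas E_prob] := probability_le_markov (X := X)
  (fun w => addr_ge0 (sign_ge0 w) (trace_tilt_ge0 _ _ _)) (ltr0n R 2) delta_gt0 X_mean.
by exists [set w | X w <= 2 / delta]; split=> // w v; exact: certificate_null.
Qed.

End gaussian_sketch_null.

(** * Nystrom approximation *)

Lemma psd_congr_eq0 (R : realType) (d e : nat) (M : 'M[R]_d) (A : 'M[R]_(d, e)) :
  psd M -> A^T *m M *m A = 0 -> M *m A = 0.
Proof.
move=> Mpsd A0; apply/matrixP => i j.
suff /matrixP/(_ i 0) : M *m (A *m (delta_mx j 0 : 'cV_e)) = 0 by rewrite mulmxA -colE !mxE.
apply: psd_mulmx_eq0 => //; rewrite -{1}[A]trmxK -dotv_mulmx.
by rewrite !mulmxA A0 mul0mx dotv0r.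
Qed.

Lemma gram_unitmx (R : realType) (m r : nat) (C : 'M[R]_(m, r)) :
  row_full C -> C^T *m C \in unitmx.
Proof.
move=> /row_fullP[B BC]; apply: mulmx_inj_unitmx => v CCv.
have Cv : C *m v = 0 by apply: dotvv_eq0; rewrite dotv_mulmx mulmxA CCv dotv0l.
by rewrite -[v]mul1mx -BC -mulmxA Cv mulmx0.
Qed.

Lemma mp_pinvP (R : realType) (m n : nat) (M : 'M[R]_(m, n)) : is_mp_pinv M (mp_pinv M).
Proof.
suff [X MX] : exists X, is_mp_pinv M X by exact: xgetI MX.
pose C := col_base M; pose D := row_base M; have MCD : C *m D = M := mulmx_base M.
have CCu : C^T *m C \in unitmx by rewrite gram_unitmx// col_base_full.
have DDu : D *m D^T \in unitmx.
  by rewrite -{1}[D]trmxK gram_unitmx// -[row_full _]/(_ == _) mxrank_tr; exact: row_base_free.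
rewrite -MCD; move: C D CCu DDu {MCD} => C D CCu DDu.
pose X := D^T *m invmx (D *m D^T) *m invmx (C^T *m C) *m C^T; exists X.
have MX : C *m D *m X = C *m invmx (C^T *m C) *m C^T.
  by rewrite !mulmxA -[C *m D *m D^T]mulmxA mulmxK.
have XM : X *m (C *m D) = D^T *m invmx (D *m D^T) *m D.
  by rewrite !mulmxA -[_ *m C^T *m C]mulmxA mulmxKV.
split.
- by rewrite MX !mulmxA -[_ *m C^T *m C]mulmxA mulmxKV.
- by rewrite XM !mulmxA -[_ *m D *m D^T]mulmxA mulmxKV.
- by rewrite MX !trmx_mul trmxK trmx_inv trmx_mul trmxK mulmxA.
- by rewrite XM !trmx_mul trmxK trmx_inv trmx_mul trmxK mulmxA.
Qed.

Section nystrom.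
Context (R : realType) (d s : nat) (H : 'M[R]_d) (Om : 'M[R]_(d, s)).
Hypothesis Hpsd : psd H.

Let G := Om^T *m H *m Om.

(* The [H]-orthogonal projection onto the range of the sketch. *)
Definition galerkin : 'M[R]_d := Om *m mp_pinv G *m Om^T *m H.

Lemma nystrom_galerkin : nystrom H Om = H *m galerkin.
Proof. by rewrite /nystrom /galerkin trmx_mul (psd_tr Hpsd) !mulmxA. Qed.

Lemma sketch_galerkin_residual : Om^T *m (H *m (1%:M - galerkin)) = 0.
Proof.
have [GXG _ _ _] := mp_pinvP G.
pose B := Om *m (1%:M - G *m mp_pinv G)^T.
have HB : H *m B = 0.
  apply: psd_congr_eq0 => //; rewrite /B trmx_mul trmxK !mulmxA.
  rewrite -[_ *m H]mulmxA -[_ *m Om]mulmxA -/G.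
  by rewrite mulmxBl mul1mx GXG subrr mul0mx.
have := congr1 trmx HB; rewrite trmx0 !trmx_mul trmxK psd_tr// => <-.
by rewrite !(mulmxBl, mulmxBr) mul1mx mulmx1 /galerkin /G !mulmxA.
Qed.

Let galerkin_orthogonal : galerkin^T *m H *m (1%:M - galerkin) = 0.
Proof.
rewrite {1}/galerkin !trmx_mul (psd_tr Hpsd) trmxK -!mulmxA.
by rewrite sketch_galerkin_residual !mulmx0.
Qed.

Lemma nystrom_congr : nystrom H Om = galerkin^T *m H *m galerkin.
Proof.
have /eqP := galerkin_orthogonal; rewrite mulmxBr mulmx1 subr_eq0 => /eqP tr_eq.
have sym : (galerkin^T *m H)^T = galerkin^T *m H.
  by rewrite tr_eq; exact: psd_tr (psd_congr _ Hpsd).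
by rewrite -tr_eq -sym trmx_mul trmxK (psd_tr Hpsd) nystrom_galerkin.
Qed.

Lemma nystrom_residual_congr :
  H - nystrom H Om = (1%:M - galerkin)^T *m H *m (1%:M - galerkin).
Proof.
rewrite [RHS](_ : _ = H *m (1%:M - galerkin) - galerkin^T *m H *m (1%:M - galerkin)).
  by rewrite galerkin_orthogonal subr0 mulmxBr mulmx1 nystrom_galerkin.
by rewrite [_^T]linearB /= trmx1 -mulmxA mulmxBl mul1mx mulmxA.
Qed.

Lemma nystrom_psd : psd (nystrom H Om).
Proof. by rewrite nystrom_congr; exact: psd_congr. Qed.

Lemma nystrom_le : psd_le (nystrom H Om) H.
Proof. by rewrite /psd_le nystrom_residual_congr; exact: psd_congr. Qed.

(* With [e] the Galerkin error of [a], the residual applied to [a] is [H e = F v]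
   for [v = F^T (H + rho) e], and [|v|^2 = |H e|^2 + rho (e, H e)]. *)
Lemma nystrom_residual_le (rho c : R) (F : 'M[R]_d) : 0 < rho -> 0 < c ->
  H *m invmx (H + rho%:M) = F *m F^T ->
  (forall v, Om^T *m (F *m v) = 0 ->
    (c + 1) * dotv (F *m v) (F *m v) <= c * dotv v v) ->
  psd_le (H - nystrom H Om) (c * rho)%:M.
Proof.
move=> rho0 c0 FF null_le; split=> [|a].
  by rewrite !linearB /= tr_scalar_mx (psd_tr nystrom_psd) (psd_tr Hpsd).
have Mu := add_scalar_unitmx Hpsd rho0.
pose e := (1%:M - galerkin) *m a; set v := F^T *m ((H + rho%:M) *m e).
have Fv : F *m v = H *m e by rewrite /v mulmxA -FF mulmxA mulmxKV.
have resE : (H - nystrom H Om) *m a = H *m e.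
  by rewrite /e nystrom_galerkin mulmxA mulmxBr mulmx1.
have energyE : dotv a (H *m e) = dotv e (H *m e).
  by rewrite -{1}resE nystrom_residual_congr -!mulmxA dotv_mulmx trmxK.
have vv : dotv v v = dotv (H *m e) (H *m e) + rho * dotv e (H *m e).
  rewrite {1}/v -dotv_mulmx Fv mulmxDl mul_scalar_mx dotvDl dotvZl.
  by rewrite [dotv e _]dotvC.
have /null_le : Om^T *m (F *m v) = 0.
  by rewrite Fv /e [H *m _]mulmxA mulmxA sketch_galerkin_residual mul0mx.
rewrite Fv vv -energyE => He_le; rewrite mulmxBl resE mul_scalar_mx dotvBr dotvZr.
rewrite -(pmulr_rge0 _ (mulr_gt0 c0 rho0)).
have := dotvv_ge0 ((c * rho) *: a - H *m e); rewrite dotvvB dotvvZ dotvZl.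
by move: He_le; move: (dotv _ _) (dotv _ _) (dotv _ _) => x y z; lra.
Qed.
End nystrom.

Lemma psd_diag_mx (R : realType) (s : nat) (lam : 'rV[R]_s) :
  psd (diag_mx lam) <-> forall i, 0 <= lam 0 i.
Proof.
split=> [lam_psd i|lam_ge0].
  by have := psd_ge0 (delta_mx i 0) lam_psd; rewrite dotv_delta_mxE mxE eqxx.
split=> [|v]; first exact: tr_diag_mx.
rewrite dotvE; apply: sumr_ge0 => i _.
by rewrite mul_diag_mx mxE mulrCA -expr2 mulr_ge0// sqr_ge0.
Qed.

Lemma psd_coprojector (R : realType) (d s : nat) (U : 'M[R]_(d, s)) :
  U^T *m U = 1%:M -> psd (1%:M - U *m U^T).
Proof.
move=> UU; suff <- : (1%:M - U *m U^T)^T *m (1%:M - U *m U^T) = 1%:M - U *m U^T.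
  exact: psd_gram.
rewrite [_^T]linearB /= trmx1 trmx_mul trmxK mulmxBr mulmx1 mulmxBl mul1mx.
by rewrite -mulmxA [U^T *m _]mulmxA UU mul1mx subrr subr0.
Qed.

Lemma lam_last_min (R : realType) (s : nat) (lam : 'rV[R]_s) :
  (0 < s)%N -> (forall i j : 'I_s, (i <= j)%N -> lam 0 j <= lam 0 i) ->
  exists2 i, lam_last lam = lam 0 i & forall j, lam_last lam <= lam 0 j.
Proof.
case: s lam => // s lam _ lam_mono.
have lastE : lam_last lam = lam 0 ord_max.
  rewrite /lam_last (nth_map ord_max) ?size_enum_ord//.
  by congr (lam 0 _); apply/val_inj; rewrite /= nth_enum_ord.
by exists ord_max => // j; rewrite lastE lam_mono// -ltnS.
Qed.

Section preconditioner.
Context (R : realType) (d s : nat) (H : 'M[R]_d) (Om U : 'M[R]_(d, s)).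
Context (lam : 'rV[R]_s) (rho : R).
Hypotheses (Hpsd : psd H) (rho_gt0 : 0 < rho) (s_gt0 : (0 < s)%N).
Hypothesis eig : nystrom_eig H Om U lam.

Let N := nystrom H Om.
Let l := lam_last lam.
Let Pc := nys_precond rho U lam.

Let UU : U^T *m U = 1%:M. Proof. by case: eig. Qed.

Let NE : N = U *m diag_mx lam *m U^T. Proof. by case: eig. Qed.

Lemma nystrom_eigenvalue_ge0 i : 0 <= lam 0 i.
Proof.
move: i; apply/psd_diag_mx.
have <- : U^T *m N *m U = diag_mx lam by rewrite NE !mulmxA UU mul1mx -mulmxA UU mulmx1.
exact/psd_congr/nystrom_psd.
Qed.

Lemma lam_last_ge0 : 0 <= l.
Proof.
have [_ _ mono] := eig; have [i + _] := lam_last_min s_gt0 mono.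
by rewrite /l => ->; exact: nystrom_eigenvalue_ge0.
Qed.

Let l_rho : 0 < l + rho. Proof. by rewrite ltr_wpDl// lam_last_ge0. Qed.

Lemma lam_last_projector_le : psd_le (l *: (U *m U^T)) N.
Proof.
have [_ _ mono] := eig; have [_ _ last_le] := lam_last_min s_gt0 mono.
rewrite /psd_le; suff -> : N - l *: (U *m U^T) = U^T^T *m diag_mx (lam - const_mx l) *m U^T.
  by apply: psd_congr; apply/psd_diag_mx => i; rewrite !mxE subr_ge0.
rewrite trmxK linearB /= diag_const_mx mulmxBr mulmxBl -NE.
by rewrite mul_mx_scalar -scalemxAl.
Qed.

(* [H] dominates [l] times a projector of rank [s], whose effective dimension is
   [s l / (l + rho)]. *)
Lemma lam_last_le_deff (c : R) : 0 <= c -> (c + 1) * deff H rho <= s%:R -> c * l <= rho.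
Proof.
move=> c0 deff_le.
have proj_psd : psd (l *: (U *m U^T)).
  by rewrite -{1}[U]trmxK; apply: psdZ (psd_gram _); exact: lam_last_ge0.
have := le_deff rho_gt0 proj_psd (psd_le_trans lam_last_projector_le (nystrom_le Om Hpsd)).
rewrite deff_projector ?lam_last_ge0// => deff_ge.
have := le_trans (ler_wpM2l (addr_ge0 c0 ler01) deff_ge) deff_le.
by rewrite mulrCA ger_pMr ?ltr0n// mulrA ler_pdivrMr//; lra.
Qed.

Lemma nys_precondE :
  (l + rho) *: Pc = N + rho%:M + l *: (1%:M - U *m U^T).
Proof.
rewrite /Pc /nys_precond scalerDr scalerA mulfV ?gt_eqF// scale1r mulmxDr mulmxDl -NE.
rewrite mul_mx_scalar -scalemxAl scalerDl.
have -> : rho%:M = rho *: (U *m U^T) + rho *: (1%:M - U *m U^T).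
  by rewrite -scalerDr subrKC scalemx1.
by rewrite [l *: _ + rho *: _]addrC !addrA.
Qed.

Let quadE x : (l + rho) * dotv x (Pc *m x) =
  dotv x (N *m x) + rho * dotv x x + l * dotv x ((1%:M - U *m U^T) *m x).
Proof.
rewrite -dotvZr scalemxAl nys_precondE; move: (1%:M - _) => V.
by rewrite !mulmxDl !dotvDr mul_scalar_mx -scalemxAl !dotvZr.
Qed.

Let coprojector_le x : dotv x ((1%:M - U *m U^T) *m x) <= dotv x x.
Proof.
rewrite mulmxBl mul1mx dotvBr gerBl -{1}[U]trmxK; exact: psd_ge0 (psd_gram _).
Qed.

Let nys_precond_tr : Pc^T = Pc.
Proof.
have /psd_tr : psd ((l + rho) *: Pc).
  rewrite nys_precondE; apply: psdD (psdZ lam_last_ge0 (psd_coprojector UU)).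
  exact: psdD (nystrom_psd Om Hpsd) (psd_scalar d (ltW rho_gt0)).
by rewrite linearZ => /(scalerI (lt0r_neq0 l_rho)).
Qed.

Lemma nys_precond_le (a : R) : l <= a * rho ->
  psd_le (((l + rho) / (1 + a)) *: Pc) (H + rho%:M).
Proof.
move=> l_le; have a_ge0 : 0 <= a by rewrite -(pmulr_lge0 _ rho_gt0) (le_trans lam_last_ge0).
apply: psd_leP => [||x]; first by rewrite linearZ /= nys_precond_tr.
  by rewrite linearD /= tr_scalar_mx psd_tr.
rewrite -scalemxAl dotvZr mulrAC ler_pdivrMr; last by rewrite ltr_wpDr.
rewrite quadE [(H + _) *m x]mulmxDl mul_scalar_mx dotvDr dotvZr.
have := psd_le_dotv x (nystrom_le Om Hpsd); rewrite -/N.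
have := mulr_ge0 a_ge0 (psd_ge0 x Hpsd).
have := ler_wpM2l lam_last_ge0 (coprojector_le x).
have := ler_wpM2r (dotvv_ge0 x) l_le.
by move: (dotv _ _) (dotv _ _) (dotv _ _) (dotv _ _) => u v w z; lra.
Qed.

Lemma le_nys_precond (c : R) : 0 <= c -> psd_le (H - N) (c * rho)%:M ->
  psd_le (H + rho%:M) (((c + 1) * (l + rho)) *: Pc).
Proof.
move=> c_ge0 res_le; apply: psd_leP => [||x].
- by rewrite linearD /= tr_scalar_mx psd_tr.
- by rewrite linearZ /= nys_precond_tr.
rewrite -scalemxAl dotvZr -mulrA quadE [(H + _) *m x]mulmxDl mul_scalar_mx dotvDr dotvZr.
have := psd_le_dotv x res_le; rewrite mulmxBl mul_scalar_mx dotvBr dotvZr.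
have := mulr_ge0 c_ge0 (psd_ge0 x (nystrom_psd Om Hpsd)).
have := mulr_ge0 (addr_ge0 c_ge0 ler01)
  (mulr_ge0 lam_last_ge0 (psd_ge0 x (psd_coprojector UU))).
by rewrite -/N; move: (dotv _ _) (dotv _ _) (dotv _ _) (dotv _ _) => u v w z; lra.
Qed.

End preconditioner.

(** * Preconditioned conjugate gradients *)

Section self_adjoint.
Context (R : realType) (d : nat) (M : 'M[R]_d).
Hypothesis Mpsd : psd M.
Implicit Types (x y u v : 'cV[R]_d) (S C : 'M[R]_d).

Definition energy_self_adjoint S := forall x y, energy M (S *m x) y = energy M x (S *m y).

(* With [g = (S - al) x] and [h = (be - S) x], the contraction property amounts to
   [energy g h >= 0], and [(be - al) g], [(be - al) h] are recovered from [g], [h]. *)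
Lemma energy_interval_contraction S (al be : R) x : energy_self_adjoint S -> al < be ->
  (forall y, al * energy M y y <= energy M y (S *m y) <= be * energy M y y) ->
  energy M ((be + al) *: x - 2 *: (S *m x)) ((be + al) *: x - 2 *: (S *m x)) <=
  (be - al) ^+ 2 * energy M x x.
Proof.
move=> S_adj al_be S_bounds; have diff_gt0 : 0 < be - al by rewrite subr_gt0.
pose g := S *m x - al *: x; pose h := be *: x - S *m x.
have gh : be *: g - S *m g = S *m h - al *: h.
  rewrite /g /h !mulmxBr -!scalemxAr; move: (S *m (S *m x)) (S *m x) => s2 s1.
  by apply/matrixP => i j; rewrite !mxE; ring.
have xE : (be - al) *: x = g + h.
  by apply/matrixP => i j; rewrite !mxE; ring.
have SxE : (be + al) *: x - 2 *: (S *m x) = h - g.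
  by rewrite /g /h; move: (S *m x) => s1; apply/matrixP => i j; rewrite !mxE; ring.
clearbody g h; have gh_ge0 : 0 <= energy M g h.
  rewrite -(pmulr_rge0 _ diff_gt0).
  have /andP[_ g_le] := S_bounds g; have /andP[h_ge _] := S_bounds h.
  have := congr1 (energy M g) gh; have := congr1 (energy M h) gh.
  rewrite !energyBr !energyZr -(S_adj g h) [energy M (S *m g) h](energyC Mpsd).
  by rewrite [energy M h g](energyC Mpsd); lra.
have -> : (be - al) ^+ 2 * energy M x x = energy M (g + h) (g + h).
  by rewrite -xE energyZl energyZr expr2 mulrA.
rewrite SxE !(energyBl, energyBr, energyDl, energyDr) (energyC Mpsd h g).
lra.
Qed.

Section chebyshev_iteration.
Variables (C : 'M[R]_d) (x : 'cV[R]_d).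

Fixpoint chebyshev_pair (n : nat) : 'cV[R]_d * 'cV[R]_d :=
  if n is n'.+1 then
    let: (u, v) := chebyshev_pair n' in (v, 2 *: (C *m v) - u)
  else (0, x).

(* [chebyshev_pair n] is [(U_(n-1)(C) x, U_n(C) x)] for the polynomials of the second
   kind, so this is [T_(n+1)(C) x]. *)
Definition chebyshevT (n : nat) : 'cV[R]_d :=
  C *m (chebyshev_pair n).2 - (chebyshev_pair n).1.

Let chebyshev_pell n : energy_self_adjoint C ->
  let: (u, v) := chebyshev_pair n in
  energy M v v - 2 * energy M v (C *m u) + energy M u u = energy M x x.
Proof.
move=> C_adj; elim: n => [|n /=]; first by rewrite /= mulmx0 !energy0r; ring.
case: (chebyshev_pair n) => u v <-.
rewrite !(energyBl, energyBr, energyZl, energyZr) -(C_adj v u).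
rewrite !(energyC Mpsd u) (C_adj v u); ring.
Qed.

Lemma chebyshevT_contraction n : energy_self_adjoint C ->
  (forall y, energy M (C *m y) (C *m y) <= energy M y y) ->
  energy M (chebyshevT n) (chebyshevT n) <= energy M x x.
Proof.
move=> C_adj C_contract; have := chebyshev_pell n C_adj.
rewrite /chebyshevT; case: (chebyshev_pair n) => u v /= <-.
rewrite -(C_adj v u) !(energyBl, energyBr) (energyC Mpsd u).
by have := C_contract v; lra.
Qed.

End chebyshev_iteration.
End self_adjoint.

Section chebyshev_values.
Context (R : realType) (zeta : R).
Hypothesis zeta_gt1 : 1 < zeta.

(* The values of [U_(n-1)] and [T_n] at [(zeta + zeta^-1) / 2]. *)
Definition chebyshevU_value (n : nat) : R := (zeta ^+ n - zeta ^- n) / (zeta - zeta^-1).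
Definition chebyshevT_value (n : nat) : R := (zeta ^+ n + zeta ^- n) / 2.

Let zeta_gt0 : 0 < zeta. Proof. exact: lt_trans zeta_gt1. Qed.
Let zeta_neq0 : zeta != 0. Proof. by rewrite gt_eqF. Qed.
Let denom_neq0 : zeta * zeta - 1 != 0.
Proof. by rewrite gt_eqF// subr_gt0 -expr2 exprn_egt1. Qed.

Lemma chebyshevU_value0 : chebyshevU_value 0 = 0.
Proof. by rewrite /chebyshevU_value !expr0 invr1 subrr mul0r. Qed.

Lemma chebyshevU_value1 : chebyshevU_value 1 = 1.
Proof.
rewrite /chebyshevU_value !expr1 mulfV// subr_eq0; apply: contra denom_neq0 => /eqP zetaV.
by rewrite {2}zetaV mulfV// subrr.
Qed.

Lemma chebyshevU_value_rec n : chebyshevU_value n.+2 =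
  (zeta + zeta^-1) * chebyshevU_value n.+1 - chebyshevU_value n.
Proof.
rewrite /chebyshevU_value !exprS !invfM; move: (expf_neq0 n zeta_neq0).
by move: (zeta ^+ n) => z z0; field; rewrite zeta_neq0 denom_neq0 z0.
Qed.

Lemma chebyshevT_value_U n : chebyshevT_value n.+1 =
  (zeta + zeta^-1) / 2 * chebyshevU_value n.+1 - chebyshevU_value n.
Proof.
rewrite /chebyshevU_value /chebyshevT_value !exprS !invfM; move: (expf_neq0 n zeta_neq0).
by move: (zeta ^+ n) => z z0; field; rewrite zeta_neq0 denom_neq0 z0.
Qed.

Lemma chebyshevT_value_rate n : 1 <= 2 * zeta^-1 ^+ n * chebyshevT_value n.
Proof.
have zn : 0 < zeta ^+ n by rewrite exprn_gt0.
rewrite /chebyshevT_value exprVn (_ : _ * _ = 1 + (zeta ^+ n)^-1 ^+ 2).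
  by rewrite lerDl sqr_ge0.
by field; rewrite gt_eqF.
Qed.

End chebyshev_values.

Lemma dotv_span_eq0 (R : realType) (d : nat) (u : 'cV[R]_d) (X : seq 'cV[R]_d) :
  {in X, forall x, dotv u x = 0} -> {in <<X>>%VS, forall y, dotv u y = 0}.
Proof.
move=> uX y; suff /subvP sub : (<<X>> <= lker (linfun (mulmx u^T)))%VS.
  by move=> /sub; rewrite memv_ker lfunE /= /dotv => /eqP ->; rewrite mxE.
apply/span_subvP => x /uX ux; rewrite memv_ker lfunE /=.
by apply/eqP/matrixP => i j; rewrite !ord1 [RHS]mxE; exact: ux.
Qed.

Lemma mulmx_span_subv (R : realType) (d e : nat) (S : 'M[R]_(e, d)) (X : seq 'cV[R]_d)
    (V : {vspace 'cV[R]_e}) :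
  {in X, forall x, S *m x \in V} -> {in <<X>>%VS, forall y, S *m y \in V}.
Proof.
move=> SX y; suff /subvP sub : (<<X>> <= linfun (mulmx S) @^-1: V)%VS.
  by move=> /sub; rewrite -memv_preim lfunE.
by apply/span_subvP => x /SX; rewrite -memv_preim lfunE.
Qed.

Section conjugate_gradients.
Context (R : realType) (d : nat) (M P : 'M[R]_d) (c : 'cV[R]_d).
Hypotheses (Mpsd : psd M) (Mu : M \in unitmx) (Ppsd : psd P) (Pu : P \in unitmx).

Let state n := iter n (pcg_step M (invmx P)) (0, c, invmx P *m c, invmx P *m c).
Let iterate n := (state n).1.1.1.
Let residual n := (state n).1.1.2.
Let precond_residual n := (state n).1.2.
Let direction n := (state n).2.
Let step_size n :=
  dotv (residual n) (precond_residual n) / energy M (direction n) (direction n).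
Let momentum n := dotv (residual n.+1) (precond_residual n.+1) /
  dotv (residual n) (precond_residual n).

Let stateS n :
  (iterate n.+1, residual n.+1, precond_residual n.+1, direction n.+1) =
  pcg_step M (invmx P) (iterate n, residual n, precond_residual n, direction n).
Proof.
have stateE k : (iterate k, residual k, precond_residual k, direction k) = state k.
  by rewrite /iterate /residual /precond_residual /direction; case: (state k) => [[[]]].
by rewrite !stateE.
Qed.

Let iterateS n : iterate n.+1 = iterate n + step_size n *: direction n.
Proof. exact: (congr1 (fun st => st.1.1.1) (stateS n)). Qed.

Let residualS n : residual n.+1 = residual n - step_size n *: (M *m direction n).
Proof. exact: (congr1 (fun st => st.1.1.2) (stateS n)). Qed.

Let precond_residualE n : precond_residual n = invmx P *m residual n.
Proof. by case: n => // n; rewrite residualS; exact: (congr1 (fun st => st.1.2) (stateS n)). Qed.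

Let directionS n : direction n.+1 = precond_residual n.+1 + momentum n *: direction n.
Proof.
rewrite /momentum precond_residualE residualS.
exact: (congr1 (fun st => st.2) (stateS n)).
Qed.

Let residualE n : residual n = c - M *m iterate n.
Proof.
elim: n => [|n IH]; first by rewrite /residual /iterate /= mulmx0 subr0.
by rewrite residualS iterateS IH mulmxDr -scalemxAr opprD addrA.
Qed.

Let krylov n : {vspace 'cV[R]_d} := <<[seq direction i | i <- iota 0 n]>>%VS.

Let direction_krylov n i : (i < n)%N -> direction i \in krylov n.
Proof. by move=> i_lt; apply/memv_span/map_f; rewrite mem_iota. Qed.

Let krylov_le m n : (m <= n)%N -> (krylov m <= krylov n)%VS.
Proof.
move=> mn; apply/sub_span => _ /mapP[i + ->]; rewrite mem_iota add0n => /= im.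
by apply: map_f; rewrite mem_iota (leq_trans im).
Qed.

Let dotv_krylov_eq0 n u : (forall i, (i < n)%N -> dotv u (direction i) = 0) ->
  {in krylov n, forall y, dotv u y = 0}.
Proof.
by move=> u_dir; apply: dotv_span_eq0 => _ /mapP[i + ->]; rewrite mem_iota => /u_dir.
Qed.

Let precond_residual_krylov n i : (i < n)%N -> precond_residual i \in krylov n.
Proof.
case: i => [|i] i_lt; first exact: (direction_krylov (i := 0%N)).
have -> : precond_residual i.+1 = direction i.+1 - momentum i *: direction i.
  by rewrite directionS addrK.
by rewrite rpredB ?rpredZ ?direction_krylov// ltnW.
Qed.

Let iterate_krylov n : iterate n \in krylov n.
Proof.
elim: n => [|n IH]; first exact: rpred0.
by rewrite iterateS rpredD ?rpredZ ?direction_krylov//; exact: (subvP (krylov_le (leqnSn n))).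
Qed.

Let precond_mul_direction i : step_size i != 0 ->
  invmx P *m (M *m direction i) =
  (step_size i)^-1 *: (precond_residual i - precond_residual i.+1).
Proof.
move=> step_neq0; rewrite !precond_residualE -mulmxBr residualS subKr.
by rewrite -scalemxAr scalerA mulVf// scale1r.
Qed.

Let krylovS n y : (forall i, (i < n)%N -> step_size i != 0) ->
  y \in krylov n -> invmx P *m M *m y \in krylov n.+1.
Proof.
move=> step_neq0; apply: mulmx_span_subv => _ /mapP[i + ->].
rewrite mem_iota add0n => /= i_lt; rewrite -mulmxA precond_mul_direction ?step_neq0//.
by rewrite rpredZ// rpredB// precond_residual_krylov// ltnS// ltnW.
Qed.

Let conjugate n := [/\ forall i, (i < n)%N -> dotv (residual n) (direction i) = 0,
  forall i, (i < n)%N -> energy M (direction n) (direction i) = 0,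
  dotv (residual n) (direction n) = dotv (residual n) (precond_residual n) &
  residual n != 0 -> step_size n != 0].

Let residual_neq0_step n : residual n != 0 ->
  dotv (residual n) (direction n) = dotv (residual n) (precond_residual n) ->
  [/\ 0 < dotv (residual n) (precond_residual n),
      0 < energy M (direction n) (direction n) & step_size n != 0].
Proof.
move=> r_neq0 rpE; have rz : 0 < dotv (residual n) (precond_residual n).
  by rewrite precond_residualE psd_unitmx_gt0 ?unitmx_inv//; exact: psd_invmx.
have pMp : 0 < energy M (direction n) (direction n).
  apply: psd_unitmx_gt0 => //; apply: contraTneq rz => p0.
  by rewrite -rpE p0 dotv0r ltxx.
by split=> //; rewrite mulf_neq0 ?invr_neq0// gt_eqF.
Qed.

Let conjugateS n : (forall i, (i <= n)%N -> residual i != 0 /\ conjugate i) -> conjugate n.+1.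
Proof.
move=> inv; have [r_neq0 [r_orth p_conj rp _]] := inv n (leqnn n).
have [rz pMp step_n] := residual_neq0_step r_neq0 rp.
have stepE : step_size n * energy M (direction n) (direction n) =
    dotv (residual n) (precond_residual n) by rewrite /step_size divfK// gt_eqF.
have step_neq0 i : (i < n)%N -> step_size i != 0.
  by move=> /ltnW/inv[ri [_ _ rpi _]]; have [] := residual_neq0_step ri rpi.
have r_orthS i : (i < n.+1)%N -> dotv (residual n.+1) (direction i) = 0.
  rewrite residualS dotvBl dotvZl [dotv (M *m _) _]dotvC -/(energy M _ _) (energyC Mpsd).
  rewrite ltnS leq_eqVlt => /predU1P[->|i_lt]; first by rewrite stepE rp subrr.
  by rewrite r_orth// p_conj// mulr0 subr0.
have r_krylov := dotv_krylov_eq0 r_orthS.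
have rpS : dotv (residual n.+1) (direction n.+1) =
    dotv (residual n.+1) (precond_residual n.+1).
  by rewrite directionS dotvDr dotvZr r_orthS// mulr0 addr0.
have zM y : energy M (precond_residual n.+1) y =
    dotv (residual n.+1) (invmx P *m M *m y).
  rewrite /energy precond_residualE dotvC dotv_mulmx (psd_tr (psd_invmx Ppsd Pu)) dotvC.
  by rewrite mulmxA.
split=> // [i|r'_neq0]; last by have [] := residual_neq0_step r'_neq0 rpS.
rewrite directionS energyDl energyZl zM ltnS leq_eqVlt => /predU1P[->|i_lt]; last first.
  by rewrite p_conj// mulr0 addr0 r_krylov// krylovS// direction_krylov.
rewrite -mulmxA precond_mul_direction// dotvZr dotvBr.
rewrite (r_krylov _ (precond_residual_krylov (ltnSn n))) /momentum -stepE.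
by field; rewrite step_n gt_eqF.
Qed.

Let conjugate_all n : (forall i, (i < n)%N -> residual i != 0) ->
  forall i, (i <= n)%N -> conjugate i.
Proof.
elim: n => [_ [|//] _|n IH r_neq0 i].
  split=> // r0; have [] // := residual_neq0_step r0; exact: erefl.
have {}IH := IH (fun i i_lt => r_neq0 i (ltnW i_lt)).
rewrite leq_eqVlt => /predU1P[->|i_lt]; last exact: IH.
by apply: conjugateS => j j_le; split; [exact: r_neq0 | exact: IH].
Qed.

Let solution := invmx M *m c.

Let residual_error n : residual n = M *m (solution - iterate n).
Proof. by rewrite residualE /solution mulmxBr mulKVmx. Qed.

(* Once the residual vanishes the step size is [0 / 0 = 0], and the iteration stalls. *)
Let residual_stalls i n : residual i = 0 -> (i <= n)%N -> residual n = 0.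
Proof.
elim: n => [|n IH] ri; first by case: i ri.
rewrite leq_eqVlt => /predU1P[<-//|/(IH ri) rn].
by rewrite residualS rn /step_size rn dotv0l mul0r scale0r subrr.
Qed.

Let residual_iterate_orth n : (forall i, (i < n)%N -> residual i != 0) ->
  {in krylov n, forall y, dotv (residual n) y = 0}.
Proof. by move=> r_neq0; apply: dotv_krylov_eq0; have [] := conjugate_all r_neq0 (leqnn n). Qed.

Let error n := solution - pcg M P c n.

Let pcg_optimal n t y : (forall i, (i < n)%N -> residual i != 0) ->
  y - t *: solution \in krylov n ->
  t ^+ 2 * energy M (error n) (error n) <= energy M y y.
Proof.
move=> r_neq0 y_krylov; have r_orth := residual_iterate_orth r_neq0.
have energy_errorE x : energy M (error n) x = dotv (residual n) x.
  by rewrite (energyC Mpsd) /energy dotvC residual_error.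
have ee : energy M (error n) (error n) = dotv (residual n) solution.
  by rewrite energy_errorE dotvBr (r_orth _ (iterate_krylov n)) subr0.
have ey : energy M (error n) y = t * energy M (error n) (error n).
  by rewrite ee energy_errorE -[y](subrK (t *: solution)) dotvDr r_orth// add0r dotvZr.
have := energy_CauchySchwarz Mpsd (error n) y; rewrite ey exprMn.
have := energy_ge0 Mpsd (error n); rewrite le_eqVlt => /predU1P[<- _|e_gt0].
  by rewrite mulr0 energy_ge0.
by rewrite [_ ^+ 2 * _]mulrC expr2 -mulrA ler_pM2l// mulrC.
Qed.

Section chebyshev_comparison.
Variables (zeta b : R).
Hypothesis zeta_gt1 : 1 < zeta.

Let c0 := (zeta + zeta^-1) / 2.
Let C := c0%:M - b *: (invmx P *m M).

Let mulC (y : 'cV[R]_d) : C *m y = c0 *: y - b *: (invmx P *m M *m y).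
Proof. by rewrite mulmxBl mul_scalar_mx -scalemxAl. Qed.

Let mulC_krylov n a (y : 'cV[R]_d) : (forall i, (i < n)%N -> step_size i != 0) ->
  y - a *: solution \in krylov n -> C *m y - (c0 * a) *: solution \in krylov n.+1.
Proof.
move=> step_neq0; set z := y - _ => z_krylov; rewrite -[y](subrK (a *: solution)) -/z.
have -> : C *m (z + a *: solution) - (c0 * a) *: solution =
    c0 *: z - b *: (invmx P *m M *m z + a *: direction 0).
  rewrite mulC mulmxDr -scalemxAr -[_ *m solution]mulmxA mulKVmx//.
  by rewrite [c0 *: (z + _)]scalerDr scalerA addrAC addrK.
have in_krylovS : {subset krylov n <= krylov n.+1} by apply/subvP/krylov_le.
apply: rpredB; apply: rpredZ; first exact: in_krylovS.
by apply: rpredD; [exact: krylovS | apply: rpredZ; exact: direction_krylov].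
Qed.

Let step_size_neq0 n : (forall i, (i < n)%N -> residual i != 0) ->
  forall i, (i < n)%N -> step_size i != 0.
Proof.
move=> r_neq0 i i_lt; have [_ _ _ step_neq0] := conjugate_all r_neq0 (ltnW i_lt).
exact/step_neq0/r_neq0.
Qed.

Let chebyshev_pair_krylov n : (forall i, (i < n)%N -> residual i != 0) ->
  (chebyshev_pair C solution n).1 - chebyshevU_value zeta n *: solution \in krylov n /\
  (chebyshev_pair C solution n).2 - chebyshevU_value zeta n.+1 *: solution \in krylov n.
Proof.
have in_krylovS m : {subset krylov m <= krylov m.+1} by apply/subvP/krylov_le.
elim: n => [_|n IH r_neq0] /=.
  by rewrite chebyshevU_value0 chebyshevU_value1// scale0r scale1r !subrr rpred0.
have r_neq0' i (i_lt : (i < n)%N) := r_neq0 i (ltnW i_lt).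
have := IH r_neq0'; case: (chebyshev_pair C solution n) => u v /= [u_krylov v_krylov].
split; first exact: in_krylovS.
have -> : 2 *: (C *m v) - u - chebyshevU_value zeta n.+2 *: solution =
    2 *: (C *m v - (c0 * chebyshevU_value zeta n.+1) *: solution) -
    (u - chebyshevU_value zeta n *: solution).
  rewrite chebyshevU_value_rec// /c0; move: (C *m v) => w.
  by apply/matrixP => i j; rewrite !mxE; field; exact: lt0r_neq0 (lt_trans ltr01 zeta_gt1).
by apply: rpredB; [apply/rpredZ/mulC_krylov => //; exact: step_size_neq0 | exact: in_krylovS].
Qed.

Let chebyshevT_krylov n : (forall i, (i < n.+1)%N -> residual i != 0) ->
  chebyshevT C solution n - chebyshevT_value zeta n.+1 *: solution \in krylov n.+1.
Proof.
move=> r_neq0; have r_neq0' i (i_lt : (i < n)%N) := r_neq0 i (ltnW i_lt).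
have := chebyshev_pair_krylov r_neq0'; rewrite /chebyshevT.
case: (chebyshev_pair C solution n) => u v /= [u_krylov v_krylov].
rewrite chebyshevT_value_U// -/c0 scalerBl opprD opprK addrACA [- u + _]addrC -[_ - u]opprB.
apply: rpredB; first by apply: mulC_krylov => //; exact: step_size_neq0.
exact: (subvP (krylov_le (leqnSn n))).
Qed.

Lemma pcg_error_chebyshev n : energy_self_adjoint M C ->
  (forall y, energy M (C *m y) (C *m y) <= energy M y y) ->
  chebyshevT_value zeta n ^+ 2 * energy M (error n) (error n) <= energy M solution solution.
Proof.
move=> C_adj C_contract.
have [[i i_le ri]|no_stall] := pselect (exists2 i, (i <= n)%N & residual i = 0).
  have /eqP := residual_error n; rewrite (residual_stalls ri i_le) eq_sym => /eqP Me.
  by rewrite [energy M (error n) _]/energy Me dotv0r mulr0 energy_ge0.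
have r_neq0 i : (i < n)%N -> residual i != 0.
  by move=> i_lt; apply/eqP => ri; apply: no_stall; exists i => //; exact: ltnW.
case: n r_neq0 {no_stall} => [_|n r_neq0].
  rewrite /error /pcg /= subr0 /chebyshevT_value !expr0 invr1.
  by rewrite (_ : (1 + 1) / 2 = 1) ?expr1n ?mul1r//; field.
by apply: le_trans (pcg_optimal r_neq0 (chebyshevT_krylov r_neq0)) _; exact: chebyshevT_contraction.
Qed.

End chebyshev_comparison.
End conjugate_gradients.

Section pcg_rate.
Context (R : realType) (d : nat) (M P : 'M[R]_d).
Hypotheses (Mpsd : psd M) (Mu : M \in unitmx).

Lemma invmx_mul_self_adjoint : psd P -> P \in unitmx -> energy_self_adjoint M (invmx P *m M).
Proof.
move=> Ppsd Pu x y; rewrite /energy -!mulmxA [RHS]dotv_mulmx (psd_tr Mpsd).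
by rewrite [RHS]dotv_mulmx (psd_tr (psd_invmx Ppsd Pu)).
Qed.

Lemma energy_invmx_mul_bounds (al be : R) : psd P -> P \in unitmx -> 0 < al -> 0 < be ->
  psd_le (al *: P) M -> psd_le M (be *: P) ->
  forall x, al * energy M x x <= energy M x (invmx P *m M *m x) <= be * energy M x x.
Proof.
move=> Ppsd Pu al_gt0 be_gt0 PM MP x.
have unitZ a : 0 < a -> a *: P \in unitmx by move=> a0; rewrite unitmxZ// unitfE gt_eqF.
have quadE a : 0 < a -> dotv (M *m x) (invmx (a *: P) *m (M *m x)) =
    energy M x (invmx P *m M *m x) / a.
  move=> a0; rewrite invmxZ ?unitZ// -scalemxAl dotvZr [RHS]mulrC.
  by rewrite /energy -mulmxA [in RHS]dotv_mulmx (psd_tr Mpsd).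
have MxE : dotv (M *m x) (invmx M *m (M *m x)) = energy M x x.
  by rewrite mulKmx// dotvC.
have := psd_le_dotv (M *m x) (psd_le_invmx Mpsd Mu MP).
have := psd_le_dotv (M *m x) (psd_le_invmx (psdZ (ltW al_gt0) Ppsd) (unitZ _ al_gt0) PM).
rewrite !quadE// MxE ler_pdivlMr// ler_pdivrMr// => lo hi.
by rewrite mulrC lo mulrC hi.
Qed.

Section spectral_interval.
Variables (c : 'cV[R]_d) (al be zeta : R).
Hypotheses (Ppsd : psd P) (Pu : P \in unitmx) (al_be : al < be) (zeta_gt1 : 1 < zeta).
Hypothesis zetaE : (be - al) * ((zeta + zeta^-1) / 2) = be + al.
Hypothesis S_bounds : forall x,
  al * energy M x x <= energy M x (invmx P *m M *m x) <= be * energy M x x.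

Let solution := invmx M *m c.
Let C := ((zeta + zeta^-1) / 2)%:M - (2 / (be - al)) *: (invmx P *m M).

Let C_adj : energy_self_adjoint M C.
Proof.
move=> x y; rewrite !mulmxBl !mul_scalar_mx -!scalemxAl.
by rewrite energyBl energyBr !(energyZl, energyZr) invmx_mul_self_adjoint.
Qed.

Let C_contract x : energy M (C *m x) (C *m x) <= energy M x x.
Proof.
have diff_gt0 : 0 < be - al by rewrite subr_gt0.
have CE : (be - al) *: (C *m x) = (be + al) *: x - 2 *: (invmx P *m M *m x).
  rewrite mulmxBl mul_scalar_mx -scalemxAl scalerBr !scalerA zetaE.
  by rewrite [_ * (2 / _)]mulrC divfK ?gt_eqF.
have := energy_interval_contraction Mpsd x (invmx_mul_self_adjoint Ppsd Pu) al_be S_bounds.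
by rewrite -CE energyZl energyZr mulrA -expr2 ler_pM2l ?exprn_gt0.
Qed.

Lemma pcg_error_interval n :
  energy M (solution - pcg M P c n) (solution - pcg M P c n) <=
  (2 * zeta^-1 ^+ n) ^+ 2 * energy M solution solution.
Proof.
have := pcg_error_chebyshev c Mpsd Mu Ppsd Pu zeta_gt1 n C_adj C_contract.
rewrite -/solution; move: (solution - _) => e bound.
apply: (@le_trans _ _ ((2 * zeta^-1 ^+ n * chebyshevT_value zeta n) ^+ 2 * energy M e e)).
  by rewrite ler_peMl ?energy_ge0// exprn_ege1// chebyshevT_value_rate.
by rewrite exprMn -mulrA ler_wpM2l ?sqr_ge0.
Qed.

End spectral_interval.

Lemma pcg_energy_error (c : 'cV[R]_d) (al k : R) (n : nat) : 0 < al -> 1 < k ->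
  psd_le (al *: P) M -> psd_le M ((al * k ^+ 2) *: P) ->
  energy M (invmx M *m c - pcg M P c n) (invmx M *m c - pcg M P c n) <=
  (2 * ((k - 1) / (k + 1)) ^+ n) ^+ 2 * energy M (invmx M *m c) (invmx M *m c).
Proof.
move=> al_gt0 k_gt1 PM MP.
have km1 : 0 < k - 1 by rewrite subr_gt0.
have kp1 : 0 < k + 1 by rewrite addr_gt0// (lt_trans ltr01).
have be_gt0 : 0 < al * k ^+ 2 by rewrite mulr_gt0// exprn_gt0// (lt_trans ltr01).
have Pu : P \in unitmx.
  by have := psd_le_unitmx MP Mpsd Mu; rewrite unitmxZ// unitfE gt_eqF.
have Ppsd : psd P.
  have := psdZ (ltW (divr_gt0 ltr01 be_gt0)) (psd_le_psd MP Mpsd).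
  by rewrite scalerA mul1r mulVf ?gt_eqF// scale1r.
rewrite -[(k - 1) / _]invrK invf_div; apply: (@pcg_error_interval _ al (al * k ^+ 2)) => //.
- by rewrite ltr_pMr// exprn_egt1.
- by rewrite ltr_pdivlMr//; lra.
- by rewrite invf_div; field; rewrite !gt_eqF.
- exact: energy_invmx_mul_bounds.
Qed.

Lemma energy_error_norm2 (rho a : R) (c e : 'cV[R]_d) :
  0 < rho -> 0 <= a -> psd_le rho%:M M ->
  energy M e e <= a ^+ 2 * energy M (invmx M *m c) (invmx M *m c) ->
  norm2 e <= a * (norm2 c / rho).
Proof.
move=> rho_gt0 a_ge0 rhoM err.
have solE : energy M (invmx M *m c) (invmx M *m c) = dotv c (invmx M *m c).
  by rewrite /energy mulKVmx// dotvC.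
have e_ge := psd_le_dotv e rhoM; rewrite mul_scalar_mx dotvZr in e_ge.
have rho_unit : (rho%:M : 'M[R]_d) \in unitmx by rewrite scalar_mx_unitmx ?gt_eqF.
have sol_le := psd_le_dotv c (psd_le_invmx (psd_scalar d (ltW rho_gt0)) rho_unit rhoM).
rewrite invmx_scalar mul_scalar_mx dotvZr -norm2_sqr in sol_le.
have bound_ge0 : 0 <= a * (norm2 c / rho).
  by rewrite mulr_ge0// divr_ge0 ?norm2_ge0// ltW.
rewrite norm2_le_sqr//.
rewrite -(ler_pM2l rho_gt0); apply: le_trans e_ge _; apply: le_trans err _.
rewrite solE; apply: le_trans (ler_wpM2l (sqr_ge0 a) sol_le) _.
by rewrite le_eqVlt; apply/orP; left; apply/eqP; field; rewrite gt_eqF.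
Qed.

End pcg_rate.

Section iteration_count.
Context (R : realType) (Rb eps rho : R).

Lemma pcg_iters_ge : 4 + 2 * ln (Rb / (eps * rho)) <= (pcg_iters Rb eps rho)%:R.
Proof.
rewrite /pcg_iters; set z := 4 + Num.ceil _.
have z_ge : 4 + 2 * ln (Rb / (eps * rho)) <= z%:~R by rewrite intrD lerD2l ceil_ge.
apply: le_trans z_ge _; case: z => n; first by rewrite -pmulrn truncnK ?natr_nat.
by rewrite NegzE mulrNz (le_trans _ (ler0n _ _))// oppr_le0.
Qed.

Lemma pcg_iters_error (q : R) : 0 <= q <= expR (- 2^-1) -> 0 <= Rb -> 0 < eps -> 0 < rho ->
  2 * q ^+ pcg_iters Rb eps rho * (Rb / rho) <= eps.
Proof.
move=> /andP[q_ge0 q_le] Rb_ge0 eps_gt0 rho_gt0.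
move: Rb_ge0; rewrite le_eqVlt => /predU1P[<-|Rb_gt0]; first by rewrite mul0r mulr0 ltW.
have := pcg_iters_ge; set L := Rb / _; set n := pcg_iters _ _ _ => n_ge.
have L_gt0 : 0 < L by rewrite divr_gt0 ?mulr_gt0.
have qn_le : q ^+ n <= expR (- 2) / L.
  apply: (@le_trans _ _ (expR (- 2^-1) ^+ n)); first by rewrite lerXn2r ?nnegrE ?expR_ge0.
  by rewrite -[L]lnK ?posrE// -expRN -expRD -expRM_natr ler_expR; lra.
have e2_le : expR (- 2) <= (2^-1 : R).
  by rewrite expRN lef_pV2 ?posrE ?expR_gt0// (le_trans _ (expR_ge1Dx _))// lerDr.
have -> : Rb / rho = L * eps by rewrite /L; field; rewrite !gt_eqF.
apply: (@le_trans _ _ (2 * (expR (- 2) / L) * (L * eps))).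
  by rewrite ler_wpM2r ?ler_wpM2l// mulr_ge0// ltW.
have -> : 2 * (expR (- 2) / L) * (L * eps) = 2 * expR (- 2) * eps by field; rewrite gt_eqF.
by rewrite ler_piMl ?(ltW eps_gt0)// -ler_pdivlMl// mulr1.
Qed.

End iteration_count.

Lemma pcg_rate4_le_expR (R : realType) : (4 - 1) / (4 + 1) <= expR (- 2^-1) :> R.
Proof.
have -> : (4 - 1) / (4 + 1) = (5 / 3)^-1 :> R by field.
have half_le : 2^-1 <= ln (5 / 3 : R).
  apply: le_trans (@le_ln_expn R (5 / 3) (32 / 31) 16 _ _); rewrite ?divr_gt0//.
    by rewrite invf_div; lra.
  by rewrite !exprS expr0; lra.
by rewrite -[5 / 3]lnK ?posrE ?divr_gt0// -expRN ler_expR lerN2.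
Qed.

Lemma pcg_norm2_error (R : realType) (d : nat) (H P : 'M[R]_d) (c : 'cV[R]_d)
    (al k rho Rb eps : R) :
  psd H -> 0 < rho -> 0 < eps -> 0 < al -> 1 < k -> (k - 1) / (k + 1) <= expR (- 2^-1) ->
  psd_le (al *: P) (H + rho%:M) -> psd_le (H + rho%:M) ((al * k ^+ 2) *: P) ->
  norm2 c <= Rb ->
  norm2 (pcg (H + rho%:M) P c (pcg_iters Rb eps rho) - invmx (H + rho%:M) *m c) <= eps.
Proof.
move=> Hpsd rho_gt0 eps_gt0 al_gt0 k_gt1 rate_le PM MP c_le.
have Mpsd := psd_add_scalar Hpsd (ltW rho_gt0); have Mu := add_scalar_unitmx Hpsd rho_gt0.
have rate_ge0 : 0 <= (k - 1) / (k + 1) by rewrite divr_ge0; lra.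
rewrite -norm2N opprB.
apply: le_trans (energy_error_norm2 Mu rho_gt0 _ (scalar_le_add rho Hpsd)
  (pcg_energy_error Mpsd Mu c _ al_gt0 k_gt1 PM MP)) _; first by rewrite mulr_ge0 ?exprn_ge0.
have rate01 : 0 <= (k - 1) / (k + 1) <= expR (- 2^-1) by rewrite rate_ge0.
apply: le_trans (pcg_iters_error rate01 (le_trans (norm2_ge0 c) c_le) eps_gt0 rho_gt0).
by rewrite ler_wpM2l ?mulr_ge0 ?exprn_ge0// ler_wpM2r ?invr_ge0// ltW.
Qed.

(** * Inexact iteration of firmly nonexpansive relations *)

Section euclidean_limits.
Context (R : realType) (T : Type) (F : set_system T).
Context {FF : Filter F}.

Lemma cvg_mxP (m n : nat) (f : T -> 'M[R]_(m, n)) (M : 'M[R]_(m, n)) :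
  f @ F --> M <-> forall i j, f t i j @[t --> F] --> M i j.
Proof.
split=> [fM i j|fM A [B BM BA]].
  exact: (cvg_comp _ _ fM (@coord_continuous R m n i j M)).
apply: (filterS (P := [set t | forall ij, B ij.1 ij.2 (f t ij.1 ij.2)])).
  by move=> t fB; apply: BA => i j; exact: fB (i, j).
by apply: filter_forall => -[i j]; exact: fM (BM i j).
Qed.

Lemma cvg_dotv (n : nat) (f g : T -> 'cV[R]_n) (u v : 'cV[R]_n) :
  f @ F --> u -> g @ F --> v -> dotv (f t) (g t) @[t --> F] --> dotv u v.
Proof.
move=> /cvg_mxP fu /cvg_mxP gv; rewrite dotvE; under eq_cvg do rewrite dotvE.
by apply: cvg_big => [|i _]; [exact: add_continuous | exact: cvgM].
Qed.

Lemma cvg_mulmx (m n : nat) (M : 'M[R]_(m, n)) (f : T -> 'cV[R]_n) (v : 'cV[R]_n) :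
  f @ F --> v -> M *m f t @[t --> F] --> M *m v.
Proof.
move=> fv; apply/cvg_mxP => i j; rewrite ord1 -dotv_delta_mx dotv_mulmx.
under eq_cvg do rewrite -dotv_delta_mx dotv_mulmx.
by apply: cvg_dotv => //; exact: cvg_cst.
Qed.

Lemma entry_le_norm2 (n : nat) (v : 'cV[R]_n) i : `|v i 0| <= norm2 v.
Proof.
rewrite -(ler_pXn2r (n := 2)) ?nnegrE ?norm2_ge0// real_normK ?num_real// norm2_sqr.
exact: entry_sqr_le_dotv.
Qed.

Lemma norm2_cvg0P (n : nat) (f : T -> 'cV[R]_n) (v : 'cV[R]_n) :
  norm2 (f t - v) @[t --> F] --> (0 : R) <-> f @ F --> v.
Proof.
split=> [fv|fv].
  apply/cvg_mxP => i j; rewrite ord1; apply/subr_cvg0/norm_cvg0P.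
  apply: (squeeze_cvgr _ (cvg_cst 0) fv); apply: nearW => t /=.
  by rewrite normr_ge0 /=; have := entry_le_norm2 (f t - v) i; rewrite !mxE.
have : dotv (f t - v) (f t - v) @[t --> F] --> dotv (v - v) (v - v).
  by apply: cvg_dotv; apply: cvgB => //; exact: cvg_cst.
rewrite subrr dotv0r => sqr0; under eq_cvg do rewrite norm2E.
by have := cvg_comp _ _ sqr0 (@sqrt_continuous R 0); rewrite sqrtr0.
Qed.

End euclidean_limits.

Lemma ultra_fmap (T U : Type) (F : set_system T) (f : T -> U) :
  UltraFilter F -> UltraFilter (f @ F).
Proof.
move=> FU; split=> [|G GF fFG]; first exact: fmap_proper_filter.
rewrite eqEsubset; split=> // A GA; have [//|fnA] := in_ultra_setVsetC (f @^-1` A) FU.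
have : G (A `&` ~` A) by apply: filterI => //; exact: fFG fnA.
by rewrite setICr => /filter_not_empty.
Qed.

Lemma bounded_ultra_cvg (R : realType) (n : nat) (T : Type) (F : set_system T)
    (f : T -> 'cV[R]_n) (B : R) :
  UltraFilter F -> (\forall t \near F, norm2 (f t) <= B) -> exists v : 'cV[R]_n, f @ F --> v.
Proof.
move=> FU fB.
have coord_cvg i : exists l : R, f t i 0 @[t --> F] --> l.
  have := @segment_compact R (- B) B; rewrite compact_ultra.
  move=> /(_ _ (ultra_fmap (fun t => f t i 0) FU)) [|l [_ fl]]; last by exists l.
  by apply: filterS fB => t /= fB; rewrite in_itv /= -ler_norml (le_trans (entry_le_norm2 _ _)).
have [l fl] := choice coord_cvg; exists (\col_i l i).
by apply/cvg_mxP => i j; rewrite ord1 mxE.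
Qed.

Lemma quasi_nonincreasing_is_cvgn (R : realType) (D eps : nat -> R) :
  (forall k, 0 <= D k) -> (forall k, 0 <= eps k) -> cvgn (series eps) ->
  (forall k, D k.+1 <= D k + eps k) -> cvgn D.
Proof.
move=> D_ge0 eps_ge0 eps_cvg DS; pose E k := D k - series eps k.
have seriesS k : series eps k.+1 = series eps k + eps k by rewrite /series /= big_nat_recr.
have series_le k : series eps k <= limn (series eps).
  apply: nondecreasing_cvgn_le => //; apply/nondecreasing_seqP => n.
  by rewrite seriesS lerDl.
have E_cvg : cvgn E.
  apply: nonincreasing_is_cvgn.
    by apply/nonincreasing_seqP => n; rewrite /E seriesS; have := DS n; lra.
  exists (- limn (series eps)) => _ [k _ <-].
  by have := D_ge0 k; have := series_le k; rewrite /E; lra.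
have -> : D = (fun k => E k + series eps k) by apply/funext => k; rewrite /E subrK.
exact: is_cvgD.
Qed.

Section firmly_nonexpansive_relation.
Context (R : realType) (d : nat) (G : 'cV[R]_d -> 'cV[R]_d -> Prop).

Definition firmly_nonexpansive := forall w w' v v', G w w' -> G v v' ->
  dotv (w' - v') (w' - v') <= dotv (w' - v') (w - v).

Definition ultra_closed_at_fixed_points :=
  forall (U : set_system nat) (w w' : nat -> 'cV[R]_d) (ws : 'cV[R]_d), UltraFilter U ->
  (forall k, G (w k) (w' k)) -> w @ U --> ws -> w' @ U --> ws -> G ws ws.

Hypothesis G_firm : firmly_nonexpansive.

Section inexact_iteration.
Variables (w w' : nat -> 'cV[R]_d) (eps : nat -> R).
Hypotheses (Gw : forall k, G (w k) (w' k)) (eps_ge0 : forall k, 0 <= eps k).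
Hypotheses (eps_cvg : cvgn (series eps)).
Hypothesis inexact_step : forall k, norm2 (w k.+1 - w' k) <= eps k.

Section distance_to_fixed_point.
Variable v : 'cV[R]_d.
Hypothesis Gv : G v v.

Lemma firmly_nonexpansive_descent k :
  dotv (w' k - v) (w' k - v) + dotv (w k - w' k) (w k - w' k) <= dotv (w k - v) (w k - v).
Proof.
have := G_firm (Gw k) Gv.
have -> : w k - v = (w' k - v) + (w k - w' k) by rewrite [RHS]addrC subrKA.
by move: (w' k - v) (w k - w' k) => a b; rewrite dotvvD dotvDr; lra.
Qed.

Let step_le k : norm2 (w' k - v) <= norm2 (w k - v).
Proof.
rewrite norm2_le_sqr ?norm2_ge0// norm2_sqr.
by have := firmly_nonexpansive_descent k; have := dotvv_ge0 (w k - w' k); lra.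
Qed.

Let distS_le k : norm2 (w k.+1 - v) <= norm2 (w' k - v) + eps k.
Proof.
have -> : w k.+1 - v = (w k.+1 - w' k) + (w' k - v) by rewrite subrKA.
by rewrite [leRHS]addrC; apply: le_trans (norm2D _ _) _; rewrite lerD2r.
Qed.

Lemma is_cvgn_dist_fixed_point : cvgn (fun k => norm2 (w k - v)).
Proof.
apply: (quasi_nonincreasing_is_cvgn (eps := eps)) => // k; first exact: norm2_ge0.
by apply: le_trans (distS_le k) _; rewrite lerD2r step_le.
Qed.

Lemma iteration_gap_cvg0 : norm2 (w k - w' k) @[k --> \oo] --> (0 : R).
Proof.
have [l dist_cvg] := (cvg_ex _).1 is_cvgn_dist_fixed_point.
have dist'_cvg : norm2 (w' k - v) @[k --> \oo] --> l.
  have shift_cvg : norm2 (w k.+1 - v) - eps k @[k --> \oo] --> l.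
    rewrite -[l]subr0; apply: cvgB; last exact: cvg_series_cvg_0.
    by rewrite (cvg_shiftS (fun k => norm2 (w k - v))).
  apply: (squeeze_cvgr _ shift_cvg dist_cvg); apply: nearW => k.
  by rewrite lerBlDr distS_le step_le.
have sqr_gap_cvg : norm2 (w k - v) ^+ 2 - norm2 (w' k - v) ^+ 2 @[k --> \oo] --> (0 : R).
  rewrite -[X in _ --> X](subrr (l ^+ 2)) !expr2.
  by apply: cvgB; apply: cvgM.
have dotv_gap_cvg : dotv (w k - w' k) (w k - w' k) @[k --> \oo] --> (0 : R).
  apply: (squeeze_cvgr _ (cvg_cst 0) sqr_gap_cvg); apply: nearW => k /=.
  by rewrite dotvv_ge0 !norm2_sqr; have := firmly_nonexpansive_descent k; lra.
under eq_cvg do rewrite norm2E.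
by have := cvg_comp _ _ dotv_gap_cvg (@sqrt_continuous R 0); rewrite sqrtr0.
Qed.

End distance_to_fixed_point.

(* Along an ultrafilter the bounded iterates have a limit, which is a fixed point; the
   distance to that point converges, so the limit of the distance is zero. *)
Lemma inexact_iteration_cvg : ultra_closed_at_fixed_points -> (exists v, G v v) ->
  exists ws, G ws ws /\ w @ \oo --> ws.
Proof.
move=> G_closed [v Gv].
have [U [U_ultra U_oo]] := ultraFilterLemma (eventually_filter : ProperFilter \oo).
have [B w_le] : exists B, \forall k \near U, norm2 (w k) <= B.
  have dist_cvg := is_cvgn_dist_fixed_point Gv; set l := limn _ in dist_cvg.
  exists (l + 1 + norm2 v); apply: U_oo.
  have : \forall k \near \oo, norm2 (w k - v) <= l + 1.
    by apply: cvgr_le dist_cvg _ _; rewrite ltrDl.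
  apply: filterS => k dist_le; rewrite -[w k](subrK v).
  by apply: le_trans (norm2D _ _) _; rewrite lerD2r.
have [ws w_ws] := bounded_ultra_cvg U_ultra w_le.
have gap_cvg : w k - w' k @[k --> U] --> (0 : 'cV[R]_d).
  apply/norm2_cvg0P; under eq_cvg do rewrite subr0.
  by move=> A /(iteration_gap_cvg0 Gv); exact: U_oo.
have w'_ws : w' @ U --> ws.
  have -> : w' = (fun k => w k - (w k - w' k)) by apply/funext => k; rewrite subKr.
  by rewrite -[ws]subr0; exact: cvgB.
have Gws := G_closed _ _ _ _ U_ultra Gw w_ws w'_ws; exists ws; split=> //; apply/norm2_cvg0P.
have dist_cvg := is_cvgn_dist_fixed_point Gws; set l := limn _ in dist_cvg.
have dist_U : norm2 (w k - ws) @[k --> U] --> l by move=> A /dist_cvg; exact: U_oo.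
have dist_U0 : norm2 (w k - ws) @[k --> U] --> (0 : R) by apply/norm2_cvg0P.
by rewrite (cvg_unique _ dist_U0 dist_U).
Qed.

End inexact_iteration.
End firmly_nonexpansive_relation.

(** * Convex splitting *)

Lemma le_of_le_addM (R : realType) (p q c : R) :
  (forall t, 0 < t <= 1 -> p <= q + t * c) -> p <= q.
Proof.
move=> le_add; have : q + harmonic n * c @[n --> \oo] --> q + 0 * c.
  by apply: cvgD; [exact: cvg_cst | apply: cvgM; [exact: cvg_harmonic | exact: cvg_cst]].
rewrite mul0r addr0 => /cvgr_to_ge; apply; apply: nearW => n.
by rewrite le_add// harmonic_gt0 /= invf_le1 ?ler1n.
Qed.

Lemma lt_fin_ereal_dense (R : realType) (b : R) (x : \bar R) :
  (b%:E < x)%E -> exists2 a : R, b < a & (a%:E < x)%E.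
Proof.
case: x => [c| |] //; last by move=> _; exists (b + 1); rewrite ?ltry// ltrDl.
by rewrite lte_fin => bc; exists ((b + c) / 2); rewrite ?lte_fin ?midf_lt.
Qed.

Definition subgradient {R : realType} {d : nat} (h : 'cV[R]_d -> \bar R)
    (z g : 'cV[R]_d) : Prop :=
  exists2 a : R, h z = a%:E & forall y, ((a + dotv g (y - z))%:E <= h y)%E.

Lemma subgradient_monotone (R : realType) (d : nat) (h : 'cV[R]_d -> \bar R) z g z' g' :
  subgradient h z g -> subgradient h z' g' -> 0 <= dotv (g - g') (z - z').
Proof.
move=> [a hz hg] [a' hz' hg']; have := hg z'; have := hg' z; rewrite hz hz' !lee_fin.
by rewrite dotvBl !dotvBr; lra.
Qed.

Section closed_proper_convex.
Context (R : realType) (d : nat) (h : 'cV[R]_d -> \bar R).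
Hypothesis h_cpc : closed_proper_convex h.

Lemma minimizer_subgradient (phi : 'cV[R]_d -> R) (M : 'M[R]_d) (z G : 'cV[R]_d) :
  (forall v, phi (z + v) <= phi z + dotv G v + energy M v v) ->
  (forall y, ((phi z)%:E + h z <= (phi y)%:E + h y)%E) ->
  subgradient h z (- G).
Proof.
case: h_cpc => _ [h_nNy [x0 hx0]] h_conv phi_le z_min.
have : h z \is a fin_num.
  rewrite fin_numE h_nNy /=; apply/negP => /eqP hz.
  by have := z_min x0; rewrite hz; move: hx0; case: (h x0) => // b _; rewrite addey.
case hz : (h z) => [a| |] // _; exists a => // y.
have := h_nNy y; case hy : (h y) => [b| |] // _; last by rewrite leey.
rewrite lee_fin dotvNl; set v := y - z.
suff : a - b <= dotv G v by lra.
apply: (@le_of_le_addM _ _ _ (energy M v v)) => t /andP[t_gt0 t_le1].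
have yE : z + t *: v = t *: y + (1 - t) *: z.
  by rewrite /v; apply/matrixP => i j; rewrite !mxE; ring.
have := h_conv y z t; rewrite t_le1 (ltW t_gt0) => /(_ isT).
rewrite hy hz -!EFinM -EFinD -yE => segment_le.
have := z_min (z + t *: v); rewrite hz; move: segment_le.
have := h_nNy (z + t *: v); case: (h _) => [c| |] // _.
rewrite lee_fin -!EFinD lee_fin => segment_le min_le.
have := phi_le (t *: v); rewrite energyZl energyZr dotvZr => phi_tv_le.
rewrite -(ler_pM2l t_gt0); move: phi_tv_le segment_le min_le.
by move: (phi _) (phi _) (energy _ _ _) => p p' e; lra.
Qed.

Lemma subgradient_closed (T : Type) (F : set_system T) (z g : T -> 'cV[R]_d)
    (zs gs : 'cV[R]_d) : ProperFilter F ->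
  (forall t, subgradient h (z t) (g t)) -> z @ F --> zs -> g @ F --> gs ->
  subgradient h zs gs.
Proof.
case: h_cpc => h_lsc [h_nNy [x0 hx0]] _ FF zg z_zs g_gs.
have limit_le (y : 'cV[R]_d) (b : R) : h y = b%:E -> (h zs <= (b - dotv gs (y - zs))%:E)%E.
  move=> hy; rewrite leNgt; apply/negP => /lt_fin_ereal_dense[a a_gt /h_lsc[V V_zs V_gt]].
  have slope_cvg : b - dotv (g t) (y - z t) @[t --> F] --> b - dotv gs (y - zs).
    apply: cvgB; first exact: cvg_cst.
    by apply: cvg_dotv => //; apply: cvgB => //; exact: cvg_cst.
  have near_V : \forall t \near F, V (z t) by exact: z_zs.
  have : a <= b - dotv gs (y - zs).
    move/cvgr_to_ge: slope_cvg; apply; apply: filterS near_V => t /V_gt.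
    have [c -> /(_ y)] := zg t; rewrite hy lte_fin lee_fin; lra.
  by rewrite leNgt a_gt.
have := h_nNy zs; case hzs : (h zs) => [a| |] // _; last first.
  by move: hx0; case hx : (h x0) => [b| |] // _; have := limit_le _ _ hx; rewrite hzs.
exists a => // y; have := h_nNy y; case hy : (h y) => [b| |] // _; last by rewrite leey.
by have := limit_le y b hy; rewrite hzs !lee_fin; lra.
Qed.

End closed_proper_convex.

Section douglas_rachford.
Context (R : realType) (d : nat) (H : 'M[R]_d) (q : 'cV[R]_d) (rho : R).
Context (h : 'cV[R]_d -> \bar R).
Hypotheses (Hpsd : psd H) (rho_gt0 : 0 < rho) (h_cpc : closed_proper_convex h).

(* One step of ADMM in the variable [w = z + u], where [x = w' - u] is the exact
   minimizer for the smooth term, of gradient [H x + q]. *)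
Definition douglas_rachford (w w' : 'cV[R]_d) : Prop := exists z,
  subgradient h z (rho *: (w - z)) /\ H *m (w' - (w - z)) + q = rho *: (z - w').

Lemma douglas_rachford_fixed_point z y :
  subgradient h z y -> H *m z + q = - y ->
  douglas_rachford (z + rho^-1 *: y) (z + rho^-1 *: y).
Proof.
move=> hzy stationary; exists z.
have scaleE : rho *: (rho^-1 *: y) = y by rewrite scalerA mulfV ?scale1r// gt_eqF.
split; first by rewrite addrC addKr scaleE.
by rewrite subKr opprD addNKr scalerN scaleE.
Qed.

Lemma prox_nonexpansive w z v y :
  subgradient h z (rho *: (w - z)) -> subgradient h y (rho *: (v - y)) ->
  norm2 (z - y) <= norm2 (w - v).
Proof.
move=> hz hy; have := subgradient_monotone hz hy.
rewrite -scalerBr dotvZl pmulr_rge0// => monotone.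
rewrite norm2_le_sqr ?norm2_ge0// norm2_sqr.
have -> : w - v = (z - y) + (w - z - (v - y)).
  by apply/matrixP => i j; rewrite !mxE; ring.
move: (z - y) (w - z - (v - y)) monotone => a b.
by rewrite dotvC dotvvD; have := dotvv_ge0 b; lra.
Qed.

Lemma douglas_rachford_firmly_nonexpansive : firmly_nonexpansive douglas_rachford.
Proof.
move=> w w' v v' [z [hz wE]] [y [hy vE]].
have := subgradient_monotone hz hy; rewrite -scalerBr dotvZl pmulr_rge0//.
have := psd_ge0 (w' - (w - z) - (v' - (v - y))) Hpsd.
have -> : H *m (w' - (w - z) - (v' - (v - y))) = rho *: ((z - w') - (y - v')).
  rewrite mulmxBr; move: wE vE => /(canRL (addrK _)) -> /(canRL (addrK _)) ->.
  by apply/matrixP => i j; rewrite !mxE; ring.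
rewrite dotvZr pmulr_rge0//.
have -> : z - w' - (y - v') =
    (z - y) - (w - z - (v - y)) - (w' - (w - z) - (v' - (v - y))).
  by apply/matrixP => i j; rewrite !mxE; ring.
have -> : w' - v' = (w - z - (v - y)) + (w' - (w - z) - (v' - (v - y))).
  by apply/matrixP => i j; rewrite !mxE; ring.
have -> : w - v = (z - y) + (w - z - (v - y)).
  by apply/matrixP => i j; rewrite !mxE; ring.
move: (z - y) (w - z - (v - y)) (w' - (w - z) - (v' - (v - y))) => a b c.
rewrite !(dotvDl, dotvDr, dotvNr) (dotvC b a) (dotvC c a) (dotvC c b); lra.
Qed.

Lemma douglas_rachford_closed : ultra_closed_at_fixed_points douglas_rachford.
Proof.
move=> U w w' ws U_ultra step w_ws w'_ws; have [z zP] := choice step.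
have [B z_le] : exists B, \forall k \near U, norm2 (z k) <= B.
  have dist_cvg : norm2 (w k - ws) @[k --> U] --> (0 : R) by apply/norm2_cvg0P.
  exists (1 + norm2 (ws - w 0) + norm2 (z 0)).
  have near_le : \forall k \near U, norm2 (w k - ws) <= 1 by exact: cvgr_le dist_cvg _ _.
  apply: filterS near_le => k dist_le; rewrite -[z k](subrK (z 0)).
  apply: le_trans (norm2D _ _) _; rewrite lerD2r.
  apply: le_trans (prox_nonexpansive (zP k).1 (zP 0).1) _.
  by rewrite -(subrKA ws); apply: le_trans (norm2D _ _) _; rewrite lerD2r.
have [zs z_zs] := bounded_ultra_cvg U_ultra z_le.
exists zs; split.
  apply: (subgradient_closed h_cpc _ (fun k => (zP k).1) z_zs).
  by apply: cvgZ; [exact: cvg_cst | exact: cvgB].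
have lhs_cvg : H *m (w' k - (w k - z k)) + q @[k --> U] --> H *m (ws - (ws - zs)) + q.
  by apply: cvgD; [apply: cvg_mulmx; do 2![apply: cvgB => //] | exact: cvg_cst].
have rhs_cvg : rho *: (z k - w' k) @[k --> U] --> rho *: (zs - ws).
  by apply: cvgZ; [exact: cvg_cst | exact: cvgB].
move: lhs_cvg; under eq_cvg do rewrite (zP _).2.
by move=> lhs_cvg; exact: (cvg_unique _ lhs_cvg rhs_cvg).
Qed.

Section inexact_admm.
Variables (x z u : nat -> 'cV[R]_d) (eps : nat -> R).
Hypotheses (eps_ge0 : forall k, 0 <= eps k) (eps_cvg : cvgn (series eps)).
Hypothesis x_step : forall k,
  norm2 (x k.+1 - invmx (H + rho%:M) *m (rho *: (z k - u k) - q)) <= eps k.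
Hypothesis z_step : forall k y,
  ((rho / 2 * norm2 (x k.+1 - z k.+1 + u k) ^+ 2)%:E + h (z k.+1)
   <= (rho / 2 * norm2 (x k.+1 - y + u k) ^+ 2)%:E + h y)%E.
Hypothesis u_step : forall k, u k.+1 = u k + x k.+1 - z k.+1.

Let dual_subgradient k : subgradient h (z k.+1) (rho *: u k.+1).
Proof.
rewrite -[rho *: u k.+1]opprK.
apply: (minimizer_subgradient h_cpc
  (phi := fun y => rho / 2 * norm2 (x k.+1 - y + u k) ^+ 2) (M := (rho / 2)%:M)) (z_step k) => v.
have -> : x k.+1 - (z k.+1 + v) + u k = u k.+1 - v.
  by rewrite u_step; apply/matrixP => i j; rewrite !mxE; ring.
have -> : x k.+1 - z k.+1 + u k = u k.+1 by rewrite u_step addrC addrA.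
rewrite !norm2_sqr dotvvB dotvNl dotvZl /energy mul_scalar_mx dotvZr.
by rewrite le_eqVlt; apply/orP; left; apply/eqP; field.
Qed.

Let exact_x k := invmx (H + rho%:M) *m (rho *: (z k - u k) - q).

Let exact_xE k : H *m exact_x k + q = rho *: (z k - u k - exact_x k).
Proof.
have := mulKVmx (add_scalar_unitmx Hpsd rho_gt0) (rho *: (z k - u k) - q).
rewrite -/(exact_x k) mulmxDl mul_scalar_mx => /(canRL (addrK _)) ->.
by rewrite [in RHS]scalerBr addrAC subrK.
Qed.

Let w k := z k.+1 + u k.+1.
Let w' k := exact_x k.+1 + u k.+1.

Let admm_douglas_rachford k : douglas_rachford (w k) (w' k).
Proof.
exists (z k.+1); rewrite /w /w' [z k.+1 + _]addrC addrK; split; first exact: dual_subgradient.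
by rewrite addrK exact_xE opprD addrA addrAC.
Qed.

Let inexact_step k : norm2 (w k.+1 - w' k) <= eps k.+1.
Proof.
have -> : w k.+1 - w' k = x k.+2 - exact_x k.+1; last exact: x_step.
by rewrite /w /w' [u k.+2]u_step; apply/matrixP => i j; rewrite !mxE; ring.
Qed.

Let shifted_eps_cvg : cvgn (series (fun k => eps k.+1)).
Proof.
have -> : series (fun k => eps k.+1) = (fun n => series eps n.+1 - eps 0%N).
  by apply/funext => n; rewrite /series /= big_nat_recl// addrAC subrr add0r.
apply: is_cvgB; last exact: is_cvg_cst.
by apply/cvg_ex; exists (limn (series eps)); rewrite (cvg_shiftS (series eps)).
Qed.

Lemma inexact_admm_cvg : (exists v, douglas_rachford v v) -> exists zs us,
  [/\ subgradient h zs (rho *: us), H *m zs + q = - (rho *: us),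
      x @ \oo --> zs & u @ \oo --> us].
Proof.
move=> fixed_point.
have [ws [[zs [hzs zsE]] w_ws]] := inexact_iteration_cvg
  douglas_rachford_firmly_nonexpansive admm_douglas_rachford (fun k => eps_ge0 k.+1)
  shifted_eps_cvg inexact_step douglas_rachford_closed fixed_point.
have z_zs : z k.+1 @[k --> \oo] --> zs.
  apply/norm2_cvg0P; have /norm2_cvg0P dist_cvg := w_ws.
  apply: (squeeze_cvgr _ (cvg_cst 0) dist_cvg); apply: nearW => k.
  rewrite norm2_ge0 /=; apply: prox_nonexpansive hzs.
  by rewrite /w addrC addKr; exact: dual_subgradient.
have u_us : u k.+1 @[k --> \oo] --> ws - zs.
  have -> : (fun k => u k.+1) = (fun k => w k - z k.+1).
    by apply/funext => k; rewrite /w addrC addKr.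
  exact: cvgB.
exists zs, (ws - zs); split=> //.
- by move: zsE; rewrite subKr => ->; rewrite -scalerN opprB.
- rewrite -(cvg_shiftS x) -(cvg_shiftS (fun k => x k.+1)) /=.
  have -> : (fun k => x k.+2) = (fun k => w k.+1 - u k.+1).
    by apply/funext => k; rewrite /w [u k.+2]u_step; apply/matrixP => i j; rewrite !mxE; ring.
  by rewrite -[zs](subKr ws); apply: cvgB => //; rewrite (cvg_shiftS w).
- by rewrite -(cvg_shiftS u).
Qed.

End inexact_admm.
End douglas_rachford.

Lemma is_derive_line (R : realType) (V W : normedModType R) (phi : V -> W) (x v : V) (t : R) :
  differentiable phi (x + t *: v) ->
  is_derive t 1 (fun s : R => phi (x + s *: v)) ('d phi (x + t *: v) v).
Proof.
move=> phi_diff.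
have line_diff : is_diff t (cst x + ( *:%R^~ v : R -> V)) (0 + *:%R^~ v) by exact: is_diffD.
have phi_at : is_diff ((cst x + ( *:%R^~ v : R -> V)) t) phi ('d phi (x + t *: v)).
  exact: differentiableP.
have comp_diff := is_diff_comp line_diff phi_at.
have comp_at : differentiable (phi \o (cst x + ( *:%R^~ v : R -> V))) t by case: comp_diff.
apply: DeriveDef; first exact/derivable1_diffP.
rewrite (@deriveE _ _ _ (phi \o (cst x + ( *:%R^~ v : R -> V))))//.
by rewrite (@diff_val _ _ _ _ _ _ _ comp_diff) /= add0r scale1r.
Qed.

Lemma affine_derivative_increment (R : realType) (f : R -> R) (c a : R) :
  (forall t : R, is_derive t 1 f (c + t * a)) -> f 1 = f 0 + c + a / 2.
Proof.
move=> f_derive; pose f0 t := f t - (t * c + t ^+ 2 * (a / 2)).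
suff f0_derive (t : R) : is_derive t (1 : R) f0 (0 : R).
  have : f0 1 = f0 0 by exact: is_derive_0_is_cst.
  by rewrite /f0 expr1n !mul1r mul0r expr0n /= mul0r; lra.
have quad_derive : is_derive t 1 (fun s : R => s * c + s ^+ 2 * (a / 2)) (c + t * a).
  by apply: is_derive_eq; rewrite /GRing.scale /=; field.
by rewrite -(subrr (c + t * a)); exact: is_deriveB.
Qed.

Section constant_hessian.
Context (R : realType) (d : nat) (g : 'cV[R]_d -> R) (Hg : 'M[R]_d).
Hypothesis g_hess : twice_diff_const_hessian g Hg.
Implicit Types x v : 'cV[R]_d.

Let is_derive_grad_entry x v i (t : R) :
  is_derive t 1 (fun s : R => grad g (x + s *: v) i 0) ((Hg *m v) i 0).
Proof.
have entry_lin : linear (fun M : 'cV[R]_d => M i 0) by move=> k a b; rewrite !mxE.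
pose entry : {linear 'cV[R]_d -> R} :=
  HB.pack (fun M : 'cV[R]_d => M i 0) (GRing.isLinear.Build _ _ _ _ _ entry_lin).
have entry_cont : continuous entry by exact: coord_continuous.
have [_ grad_diff grad_diffE] := g_hess (x + t *: v).
have entry_diff y : differentiable entry y by exact: linear_differentiable.
have := @is_derive_line R _ _ (entry \o grad g) x v t
  (differentiable_comp grad_diff (entry_diff _)).
by rewrite diff_comp// diff_lin//= grad_diffE.
Qed.

Lemma grad_affine x v : grad g (x + v) = grad g x + Hg *m v.
Proof.
apply/matrixP => i j; rewrite ord1 [RHS]mxE.
have := @affine_derivative_increment R (fun s => grad g (x + s *: v) i 0) ((Hg *m v) i 0) 0.
rewrite scale1r scale0r addr0 mul0r addr0; apply=> t.
by rewrite mulr0 addr0; exact: is_derive_grad_entry.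
Qed.

Lemma diff_grad x v : 'd g x v = dotv (grad g x) v.
Proof.
rewrite -[v in LHS]mul1mx mulmx_sum_col raddf_sum dotvE; apply: eq_bigr => i _.
transitivity (v i 0 * 'd g x (col i 1%:M)); first exact: (linearZ_LR ('d g x)).
by rewrite colE mul1mx mxE mulrC.
Qed.

Lemma quadratic_expansion x v :
  g (x + v) = g x + dotv (grad g x) v + dotv v (Hg *m v) / 2.
Proof.
have := @affine_derivative_increment R (fun s => g (x + s *: v)) (dotv (grad g x) v)
  (dotv v (Hg *m v)).
rewrite scale1r scale0r addr0; apply=> t; have [g_diff _ _] := g_hess (x + t *: v).
have := is_derive_line g_diff.
by rewrite diff_grad grad_affine -scalemxAr dotvDl dotvZl [dotv (Hg *m v) v]dotvC.
Qed.

End constant_hessian.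

Section composite_problem.
Context (R : realType) (n d : nat) (A : 'M[R]_(n, d)) (b : 'cV[R]_n).
Context (g : 'cV[R]_d -> R) (Hg : 'M[R]_d) (h : 'cV[R]_d -> \bar R).
Hypotheses (g_hess : twice_diff_const_hessian g Hg) (Hg_psd : psd Hg).

Let H := A^T *m A + Hg.
Let q := grad g 0 - A^T *m b.
Let f := fsmooth A b g.

Lemma fsmooth_hessian_psd : psd H.
Proof. exact: psdD (psd_gram A) Hg_psd. Qed.

Let gradE x : grad g x = grad g 0 + Hg *m x.
Proof. by rewrite -(grad_affine g_hess) add0r. Qed.

Lemma fsmooth_expansion (x v : 'cV[R]_d) :
  f (x + v) = f x + dotv (H *m x + q) v + dotv v (H *m v) / 2.
Proof.
have -> : dotv (H *m x + q) v = dotv (A *m x - b) (A *m v) + dotv (grad g x) v.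
  rewrite [dotv _ (A *m v)]dotv_mulmx -dotvDl gradE; congr (dotv _ v).
  by rewrite /H /q mulmxDl mulmxBr mulmxA; apply/matrixP => i j; rewrite !mxE; ring.
have -> : dotv v (H *m v) = dotv (A *m v) (A *m v) + dotv v (Hg *m v).
  by rewrite mulmxDl dotvDr -mulmxA [dotv v (A^T *m _)]dotv_mulmx trmxK.
rewrite /f /fsmooth (quadratic_expansion g_hess) mulmxDr addrAC !norm2_sqr dotvvD.
by field.
Qed.

Lemma admm_rhsE (rho : R) (x z u : 'cV[R]_d) :
  admm_rhs A b g Hg rho x z u = rho *: (z - u) - q.
Proof.
rewrite /admm_rhs gradE /q mulmxBr mulmxA.
by apply/matrixP => i j; rewrite !mxE; ring.
Qed.

Lemma primal_solution_subgradient xs : closed_proper_convex h ->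
  primal_solution A b g h xs -> subgradient h xs (- (H *m xs + q)).
Proof.
move=> h_cpc; apply: (minimizer_subgradient h_cpc (phi := f) (M := 2^-1 *: H)) => v.
by rewrite fsmooth_expansion /energy -scalemxAl dotvZr mulrC.
Qed.

Section kkt.
Variables (zs ys : 'cV[R]_d).
Hypotheses (sub : subgradient h zs ys) (stationary : H *m zs + q = - ys).

Let f_ge x : f zs - dotv ys (x - zs) <= f x.
Proof.
have := fsmooth_expansion zs (x - zs); rewrite subrKC stationary dotvNl => ->.
by have := psd_ge0 (x - zs) fsmooth_hessian_psd; lra.
Qed.

Lemma kkt_primal_solution : primal_solution A b g h zs.
Proof.
have [a hzs h_ge] := sub; move=> x; rewrite /primal_obj hzs -/(f zs) -/(f x).
apply: le_trans (leeD2l _ (h_ge x)).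
by rewrite -!EFinD lee_fin; have := f_ge x; lra.
Qed.

(* Both conjugates are attained at [zs], so the dual value of [ys] is [- (f + h) zs];
   evaluating the conjugates at [zs] bounds every other dual value by it. *)
Lemma kkt_dual_solution : dual_solution A b g h ys.
Proof.
have [a hzs h_ge] := sub; move=> y; rewrite /dual_obj leeN2.
apply: (@le_trans _ _ ((- dotv ys zs - f zs)%:E + (dotv ys zs - a)%:E)%E).
  apply: leeD; apply: ge_ereal_sup => _ [x _ <-].
    by rewrite -EFinB lee_fin dotvNl; have := f_ge x; rewrite dotvBr -/(f x); lra.
  apply: (@le_trans _ _ ((dotv ys x)%:E - (a + dotv ys (x - zs))%:E)%E); first by rewrite leeB.
  by rewrite -EFinB lee_fin dotvBr; lra.
apply: (@le_trans _ _ ((dotv (- y) zs - f zs)%:E + (dotv y zs - a)%:E)%E).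
  by rewrite -!EFinD lee_fin dotvNl; lra.
by apply: leeD; apply: ereal_sup_ubound; exists zs; rewrite // hzs.
Qed.

End kkt.

Lemma nysadmm_cvg (rho : R) (x z u : nat -> 'cV[R]_d) (eps : nat -> R) :
  closed_proper_convex h -> (exists xs, primal_solution A b g h xs) -> 0 < rho ->
  (forall k, 0 <= eps k) -> cvgn (series eps) ->
  (forall k, norm2 (x k.+1 -
     invmx (H + rho%:M) *m admm_rhs A b g Hg rho (x k) (z k) (u k)) <= eps k) ->
  (forall k y,
    ((rho / 2 * norm2 (x k.+1 - z k.+1 + u k) ^+ 2)%:E + h (z k.+1)
     <= (rho / 2 * norm2 (x k.+1 - y + u k) ^+ 2)%:E + h y)%E) ->
  (forall k, u k.+1 = u k + x k.+1 - z k.+1) ->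
  (exists xs, primal_solution A b g h xs /\ norm2 (x k - xs) @[k --> \oo] --> (0 : R)) /\
  (exists ys, dual_solution A b g h ys /\ norm2 (rho *: u k - ys) @[k --> \oo] --> (0 : R)).
Proof.
move=> h_cpc [xs xs_min] rho_gt0 eps_ge0 eps_cvg x_step z_step u_step.
have fixed_point : exists v, douglas_rachford H q rho h v v.
  eexists; apply: (douglas_rachford_fixed_point rho_gt0 (y := - (H *m xs + q))) (esym (opprK _)).
  exact: primal_solution_subgradient.
have [k|zs [us [sub stationary x_zs u_us]]] := inexact_admm_cvg fsmooth_hessian_psd rho_gt0
  h_cpc eps_ge0 eps_cvg _ z_step u_step fixed_point.
  by rewrite -(admm_rhsE rho (x k)); exact: x_step.
split; [exists zs | exists (rho *: us)]; split.
- exact: kkt_primal_solution sub stationary.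
- exact/norm2_cvg0P.
- exact: kkt_dual_solution sub stationary.
- by apply/norm2_cvg0P; apply: cvgZ => //; exact: cvg_cst.
Qed.

End composite_problem.

(** * Randomized Nystrom preconditioning within ADMM *)

Section nystrom_sketch.
Context (R : realType) (d s : nat) (H : 'M[R]_d) (rho delta : R).
Hypotheses (Hpsd : psd H) (rho_gt0 : 0 < rho) (delta01 : 0 < delta < 1).
Hypothesis sketch_size :
  8 * (Num.sqrt (deff H rho) + Num.sqrt (8 * ln (16 / delta))) ^+ 2 <= s%:R.

Lemma gaussian_nystrom_residual_le (dT : measure_display) (T : measurableType dT)
    (P : probability T R) (Om : T -> 'M[R]_(d, s)) : std_gaussian_matrix P Om ->
  exists E : set T, [/\ measurable E, ((1 - delta)%:E <= P E)%E &
    forall w, E w -> psd_le (H - nystrom H (Om w)) (13 * rho)%:M].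
Proof.
move=> Om_std; have [F [FF F_contraction mass_deff]] := deff_factor rho_gt0 Hpsd.
have size_le := sketch_size; rewrite -mass_deff in size_le.
have [E [E_meas E_prob null_le]] := gaussian_sketch_null F_contraction delta01 size_le Om_std.
exists E; split=> // w Ew; apply: (nystrom_residual_le Hpsd rho_gt0 _ FF) => // v Om_Fv.
by rewrite natr1; exact: null_le Ew Om_Fv.
Qed.

Let sqrt_ln_gt0 : 0 < Num.sqrt (8 * ln (16 / delta)).
Proof.
have /andP[delta_gt0 delta_lt1] := delta01.
by rewrite sqrtr_gt0 mulr_gt0// ln_gt0// ltr_pdivlMr//; lra.
Qed.

Let sketch_size_gt0 : (0 < s)%N.
Proof.
rewrite -(ltr_nat R); apply: lt_le_trans sketch_size.
by rewrite mulr_gt0// exprn_gt0// ltr_wpDl// sqrtr_ge0.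
Qed.

Let deff_le_sketch_size : (7 + 1) * deff H rho <= s%:R.
Proof.
apply: le_trans sketch_size; rewrite natr1 ler_pM2l//.
rewrite -[leLHS]sqr_sqrtr ?deff_ge0// ler_pXn2r ?nnegrE ?addr_ge0 ?sqrtr_ge0//.
by rewrite lerDl ltW.
Qed.

(* With [7 l <= rho] for the last eigenvalue [l] and a residual at most [13 rho], the
   preconditioned matrix has condition number at most [(1 + 1/7) 14 = 4^2]. *)
Lemma nystrom_preconditioning (Om U : 'M[R]_(d, s)) (lam : 'rV[R]_s) :
  nystrom_eig H Om U lam -> psd_le (H - nystrom H Om) (13 * rho)%:M ->
  exists al, [/\ 0 < al, psd_le (al *: nys_precond rho U lam) (H + rho%:M) &
    psd_le (H + rho%:M) ((al * 4 ^+ 2) *: nys_precond rho U lam)].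
Proof.
move=> eig res_le; have l_ge0 := lam_last_ge0 Hpsd sketch_size_gt0 eig.
have l_le := lam_last_le_deff Hpsd rho_gt0 sketch_size_gt0 eig (ler0n R 7) deff_le_sketch_size.
exists ((lam_last lam + rho) / (1 + 1 / 7)); split.
- by rewrite divr_gt0// ltr_wpDl.
- by apply: (nys_precond_le Hpsd rho_gt0 sketch_size_gt0 eig); lra.
- have -> : (lam_last lam + rho) / (1 + 1 / 7) * 4 ^+ 2 = (13 + 1) * (lam_last lam + rho).
    by field.
  exact: (le_nys_precond Hpsd rho_gt0 sketch_size_gt0 eig (ler0n R 13) res_le).
Qed.

End nystrom_sketch.

Theorem theorem4p3
  (R : realType) (n d s : nat)
  (A : 'M[R]_(n, d)) (b : 'cV[R]_n)
  (g : 'cV[R]_d -> R) (Hg : 'M[R]_d) (h : 'cV[R]_d -> \bar R)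
  (x0 z0 u0 : 'cV[R]_d) (rho : R) (eps : nat -> R) (delta : R) (Rb : R)
  (dT : measure_display) (T : measurableType dT) (P : probability T R)
  (Om : T -> 'M[R]_(d, s)) (U : T -> 'M[R]_(d, s)) (lam : T -> 'rV[R]_s)
  (xt zt ut : T -> nat -> 'cV[R]_d) :
  (* g convex, twice differentiable, constant psd Hessian Hg *)
  convex_function [set: 'cV[R]_d] g ->
  twice_diff_const_hessian g Hg ->
  psd Hg ->
  (* h closed proper convex *)
  closed_proper_convex h ->
  (* the problem has a solution *)
  (exists xs, primal_solution A b g h xs) ->
  (* parameters *)
  0 < rho ->
  (forall k, 0 < eps k) -> cvgn (series eps) ->
  0 < delta < 1 ->
  (* sketch size *)
  let H := A^T *m A + Hg in
  8 * (Num.sqrt (deff H rho) + Num.sqrt (8 * ln (16 / delta))) ^+ 2 <= s%:R ->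
  (* Gaussian test matrix and Nystrom preconditioner *)
  std_gaussian_matrix P Om ->
  (forall w, nystrom_eig H (Om w) (U w) (lam w)) ->
  let Pc w := nys_precond rho (U w) (lam w) in
  let r w k := admm_rhs A b g Hg rho (xt w k) (zt w k) (ut w k) in
  (* NysADMM iterations *)
  (forall w, [/\ xt w 0 = x0, zt w 0 = z0 & ut w 0 = u0]) ->
  (forall w k, xt w k.+1 =
     pcg (H + rho%:M) (Pc w) (r w k) (pcg_iters Rb (eps k) rho)) ->
  (forall w k z,
     ((rho / 2 * norm2 (xt w k.+1 - zt w k.+1 + ut w k) ^+ 2)%:E
        + h (zt w k.+1)
      <= (rho / 2 * norm2 (xt w k.+1 - z + ut w k) ^+ 2)%:E + h z)%E) ->
  (forall w k, ut w k.+1 = ut w k + xt w k.+1 - zt w k.+1) ->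
  (* bounded right-hand sides *)
  (forall w k, norm2 (r w k) <= Rb) ->
  exists E : set T,
    [/\ measurable E, ((1 - delta)%:E <= P E)%E &
      forall w, E w ->
        [/\ forall k, norm2 (xt w k.+1 - invmx (H + rho%:M) *m r w k) <= eps k,
            exists xs, primal_solution A b g h xs /\
              (fun k => norm2 (xt w k - xs)) @ \oo --> (0 : R)
          & exists ys, dual_solution A b g h ys /\
              (fun k => norm2 (rho *: ut w k - ys)) @ \oo --> (0 : R)]].
Proof.
move=> _ g_hess Hg_psd h_cpc solvable rho_gt0 eps_gt0 eps_cvg delta01 H sketch_size Om_std
  eig Pc r _ x_step z_step u_step r_le.
have Hpsd : psd H := fsmooth_hessian_psd A Hg_psd.
have [E [E_meas E_prob res_le]] :=
  gaussian_nystrom_residual_le Hpsd rho_gt0 delta01 sketch_size Om_std.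
exists E; split=> // w Ew.
have [al [al_gt0 PM MP]] :=
  nystrom_preconditioning Hpsd rho_gt0 delta01 sketch_size (eig w) (res_le w Ew).
have x_error k : norm2 (xt w k.+1 - invmx (H + rho%:M) *m r w k) <= eps k.
  rewrite x_step; apply: pcg_norm2_error (pcg_rate4_le_expR R) PM MP (r_le w k) => //.
  by rewrite ltr1n.
have [primal_cvg dual_cvg] := nysadmm_cvg g_hess Hg_psd h_cpc solvable rho_gt0
  (fun k => ltW (eps_gt0 k)) eps_cvg x_error (z_step w) (u_step w).
by split.
Qed.
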